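(* Let $m>n\ge 2$ be integers. For every $p$ with $0\le p\le 1$, $\theta_H(p)>0$ if and only if $\theta_V(p)>0$. Moreover $p_H=p_V$.
   Context: Fix integers $m>n\ge 2$. For $k\ge 1$ the level-$k$ rectangles are the $(mn)^k$ closed rectangles $[an^{-k},(a+1)n^{-k}]\times[bm^{-k},(b+1)m^{-k}]$ with $0\le a\le n^k-1$, $0\le b\le m^k-1$, which tile $[0,1]^2$. Given a probability $p\in[0,1]$, each level-$k$ rectangle, for every $k\ge1$, is selected with probability $p$, independently of all other rectangles of all levels (whether or not the rectangles of lower level containing it are selected). Let $S_j$ be the union of the selected level-$j$ rectangles, $E_k=\bigcap_{j=1}^k S_j$ and $F=\bigcap_{j=1}^\infty S_j=\bigcap_{k=1}^\infty E_k$, a random compact subset of $[0,1]^2$ (the statistically self-affine carpet). Two sets $A,B\subset\mathbb{R}^2$ are connected in a set $F\subset\mathbb{R}^2$ if there are points $x_1\in A\cap F$, $x_2\in B\cap F$ lying in the same connected component of $F$. $F$ is a horizontal (H-) crossing of $[0,1]^2$ if $\{0\}\times[0,1]$ and $\{1\}\times[0,1]$ are connected in $F$, and a vertical (V-) crossing if $[0,1]\times\{0\}$ and $[0,1]\times\{1\}$ are connected in $F$. $\theta_H(p)$ and $\theta_V(p)$ denote the probabilities that $F$ has a horizontal, respectively vertical, crossing of $[0,1]^2$. The critical probabilities $p_H,p_V\in(0,1)$ are the numbers such that $\theta_H(p)=0$ for $0\le p<p_H$ and $\theta_H(p)>0$ for $p_H<p\le 1$, and $\theta_V(p)=0$ for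 $0\le p<p_V$ and $\theta_V(p)>0$ for $p_V<p\le1$. *)

(* Defs.v *)
From mathcomp Require Import all_boot all_order all_algebra finmap.
From mathcomp Require Import all_classical all_reals all_analysis.

Set Implicit Arguments.
Unset Strict Implicit.
Unset Printing Implicit Defensive.

Import Order.TTheory GRing.Theory Num.Theory.
Import numFieldNormedType.Exports.

Local Open Scope classical_set_scope.
Local Open Scope ring_scope.

Definition mutually_independent d (T : measurableType d) (R : realType)
    (P : probability T R) (I : choiceType) (E : I -> set T) : Prop :=
  forall J : {fset I},
    (P (\bigcap_(i in [set` J]) E i) = \prod_(i <- J) P (E i))%E.

(* The tag [k] stands for level [k.+1], since the levels start at 1; the value
   is the pair (a, b) of the column and row numbers. *)
Definition rect_index (n m : nat) : Type :=
  {k : nat & ('I_(n ^ k.+1) * 'I_(m ^ k.+1))%type}.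

Definition level n m (r : rect_index n m) : nat := (tag r).+1.

Definition rect (R : realType) n m (r : rect_index n m) : set (R * R) :=
  let k := level r in
  let a : nat := (tagged r).1 in
  let b : nat := (tagged r).2 in
  `[a%:R * n%:R ^- k, a.+1%:R * n%:R ^- k] `*`
  `[b%:R * m%:R ^- k, b.+1%:R * m%:R ^- k].

(* [sel r] is the event that the rectangle [r] is selected. *)
Definition bernoulli_selection d (T : measurableType d) (R : realType)
    (P : probability T R) n m (p : R) (sel : rect_index n m -> set T) : Prop :=
  [/\ forall r, measurable (sel r),
      forall r, P (sel r) = p%:E &
      mutually_independent P sel].

Section carpet.
Variables (R : realType) (T : Type) (n m : nat).
Variable sel : rect_index n m -> set T.

Definition selected_union (w : T) (k : nat) : set (R * R) :=
  \bigcup_(r in [set r | level r = k /\ sel r w]) rect r.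

Definition carpet (w : T) : set (R * R) :=
  \bigcap_(k in [set k | (1 <= k)%N]) selected_union w k.

End carpet.
Arguments carpet R {T n m} sel w.

Definition connected_in (T : topologicalType) (F A B : set T) : Prop :=
  exists x1 x2, [/\ (A `&` F) x1, (B `&` F) x2 & connected_component F x1 x2].

Definition H_crossing (R : realType) (F : set (R * R)) : Prop :=
  connected_in F ([set 0] `*` `[0, 1]) ([set 1] `*` `[0, 1]).

Definition V_crossing (R : realType) (F : set (R * R)) : Prop :=
  connected_in F (`[0, 1] `*` [set 0]) (`[0, 1] `*` [set 1]).

(* By compactness, a crossing exists in the carpet iff it exists in each of its
   finite-level approximations, so the crossing events are measurable and [P]
   is not applied to a set outside its sigma-algebra. *)
Definition theta_H d (T : measurableType d) (R : realType)
    (P : probability T R) n m (sel : rect_index n m -> set T) : \bar R :=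
  P [set w | H_crossing (carpet R sel w)].

Definition theta_V d (T : measurableType d) (R : realType)
    (P : probability T R) n m (sel : rect_index n m -> set T) : \bar R :=
  P [set w | V_crossing (carpet R sel w)].

Definition critical_probability (R : realType) (theta : R -> \bar R) (pc : R)
    : Prop :=
  [/\ 0 < pc < 1,
      forall p : R, 0 <= p < pc -> theta p = 0%E &
      forall p : R, pc < p <= 1 -> (0 < theta p)%E].

(* Main.v *)
From Stdlib Require Import ZArith Lia.
Require Import Defs.
From mathcomp Require Import all_boot all_order all_algebra finmap.
From mathcomp Require Import all_classical all_reals all_analysis.
From mathcomp Require Import ssrZ zify ring lra.

(** View the level-[i] rectangles as unit cells, each carrying an independent
    copy of the carpet, and call a crossing of a box of unit cells possible if
    its probability is positive, i.e., bounded away from 0 at all finite levels.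
    By the FKG inequality finitely many possible increasing events occur
    together, so crossings that must meet can be glued; and the box [w x h]
    behaves like the box [n^i w x m^i h].

    A crossing confined to few columns (rows) at a deep level is unlikely, so
    possible V-crossings of the unit square yield possible H-crossings of boxes
    of any width, and conversely.  Now consider an arc: a path on one side of a
    vertical line of cells joining the line below and above one of its unit
    segments.  Suppose that arcs are impossible.  Then a path meeting a vertical
    line at two distant heights meets it almost everywhere in between, which is
    unlikely; since [m^i / n^i] is unbounded, a V-crossing of [n^i x m^i] cells
    must thus cross tall boxes within a single column.  If arcs are possible, a
    horizontal path ending on a unit segment of a line is attached to the arc
    around that segment; joining a path, an arc, a path, a mirrored arc and a
    mirrored path prolongs H-crossings at bounded cost in height, so that
    H-crossings of [w x (a + c w)] are possible for all large [w].  As [n < m],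
    the box [n^i x m^i] is eventually higher than this.  In each case gluing
    gives the crossing in the other direction.

    The carpet itself is not the limit of nested rectangles, because a point on a
    common side may be covered by different rectangles at different levels; but
    with probability close to 1 every side has a gap at a deeper level, so this
    does not help crossings. *)

Set Implicit Arguments.
Unset Strict Implicit.
Unset Printing Implicit Defensive.
Import Order.TTheory GRing.Theory Num.Theory.
Import numFieldNormedType.Exports.
Local Open Scope ring_scope.
Delimit Scope Z_scope with coqZ.
#[local] Arguments Z.mul : simpl never.
#[local] Arguments Z.add : simpl never.
#[local] Arguments Z.sub : simpl never.
#[local] Arguments Z.div : simpl never.
#[local] Arguments Z.opp : simpl never.

(** * Finite product Bernoulli measures *)

(** Level-k cells of a common corner already touch, so paths are king paths; two such paths may
    cross without a common cell, and meeting always means having adjacent cells. Two horizontal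
    crossings that end on the same unit segment of a line need not meet at all, and this is the
    obstacle to prolonging them: an arc around the segment is a set that both are forced to meet.

    All probabilities are those of a finite product measure on sites of the whole plane of cells,
    and limits in the level are avoided: the events decrease with the level, so if a finite
    disjunction is possible then one of its members is. The position of an end, of a column or of an
    arc is fixed in this way, without any estimate of constants.

    Most geometric lemmas need only n, m at least 2, so that exchanging the coordinates turns each
    into its vertical counterpart. The inequality n < m enters through [power_gap] alone: once to
    find arcs, and then to make boxes higher than the linear cost of prolonging. The restriction p <
    1 makes the unlikely events unlikely, and p > 0 allows a box to be scaled down; p = 0 and p = 1
    are treated apart. *)

Section Bernoulli.
Variables (R : realType) (p : R).
Hypothesis p01 : 0 <= p <= 1.

Let p_ge0 : 0 <= p. Proof. by case/andP: p01. Qed.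
Let p_le1 : 0 <= 1 - p. Proof. by rewrite subr_ge0; case/andP: p01. Qed.

Section Expectation.
Variable I : eqType.
Implicit Types (s : I -> bool) (S : seq I) (f g : (I -> bool) -> R)
  (A B : (I -> bool) -> Prop).

Definition upd s i b : I -> bool := fun j => if j == i then b else s j.

(** The bits of [S] are averaged one at a time and the others keep their values in [s], so that
    independence and the FKG inequality become inductions on [S]. *)
Fixpoint expect S f s : R :=
  if S is i :: S' then
    p * expect S' f (upd s i true) + (1 - p) * expect S' f (upd s i false)
  else f s.

Definition supported S (T : Type) (f : (I -> bool) -> T) :=
  forall s s', {in S, s =1 s'} -> f s = f s'.

Definition ind A s : R := (`[< A s >])%:R.

Definition increasing A := forall s s' : I -> bool, (forall i, s i -> s' i) -> A s -> A s'.

Lemma updC s i j b c : i != j -> upd (upd s i b) j c = upd (upd s j c) i b.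
Proof.
move=> ij; apply/funext => k; rewrite /upd.
by case: (eqVneq k i) => [->|//]; rewrite (negbTE ij).
Qed.

Lemma expect_le S f g s : (forall s, f s <= g s) -> expect S f s <= expect S g s.
Proof.
move=> fg; elim: S s => [|i S IH] s //=.
by apply: lerD; apply: ler_wpM2l.
Qed.

Lemma expectD S f g s :
  expect S (fun s => f s + g s) s = expect S f s + expect S g s.
Proof. by elim: S s => [|i S IH] s //=; rewrite !IH; ring. Qed.

Lemma expectZ S c f s : expect S (fun s => c * f s) s = c * expect S f s.
Proof. by elim: S s => [|i S IH] s //=; rewrite !IH; ring. Qed.

Lemma expect_cst S c s : expect S (fun=> c) s = c.
Proof. by elim: S s => [|i S IH] s //=; rewrite !IH; ring. Qed.

Lemma expect_cat S S' f s :
  expect (S ++ S') f s = expect S (fun s => expect S' f s) s.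
Proof. by elim: S s => [|i S IH] s //=; rewrite !IH. Qed.

Lemma expect_upd S f s i b : i \notin S ->
  expect S f (upd s i b) = expect S (fun s => f (upd s i b)) s.
Proof.
elim: S s => [|j S IH] s //=; rewrite inE negb_or => /andP[ij iS].
by rewrite !(updC _ _ _ ij) !IH.
Qed.

Lemma expect_perm S S' f s : uniq S -> perm_eq S S' ->
  expect S f s = expect S' f s.
Proof.
elim: S S' s => [|i S IH] S' s /=.
  by rewrite perm_sym => _ /perm_nilP ->.
move=> /andP[iS uS] pS.
have iS' : i \in S' by rewrite -(perm_mem pS) mem_head.
have uS' : uniq S' by rewrite -(perm_uniq pS) /= iS.
case/splitPr: iS' pS uS' => S1 S2 pS uS'.
have pS' : perm_eq S (S1 ++ S2).
  rewrite -(perm_cons i); apply: (perm_trans pS).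
  by rewrite -cat1s perm_catCA.
rewrite !(IH _ _ uS pS') !expect_cat.
have iS1 : i \notin S1.
  by move: uS'; rewrite cat_uniq /= negb_or => /and3P[_ /andP[]].
rewrite !(expect_upd _ _ _ iS1) /=.
rewrite (expectD S1 (fun s => p * _) (fun s => (1 - p) * _)).
by rewrite !expectZ.
Qed.

Lemma expect_out S S' f s s' : supported S' f ->
  (forall i, i \in S -> i \notin S') -> (forall i, i \in S' -> s i = s' i) ->
  expect S f s = f s'.
Proof.
move=> fS; elim: S s s' => [|i S IH] s s' dis ss' /=; first exact: fS.
have iS' := dis i (mem_head _ _).
rewrite !(IH _ s'); first (by ring).
- by move=> j jS; apply: dis; rewrite inE jS orbT.
- move=> j jS'; rewrite /upd; case: eqVneq => [ji|_]; last exact: ss'.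
  by rewrite -ji jS' in iS'.
- by move=> j jS; apply: dis; rewrite inE jS orbT.
- move=> j jS'; rewrite /upd; case: eqVneq => [ji|_]; last exact: ss'.
  by rewrite -ji jS' in iS'.
Qed.

Lemma expect_supp S f s s' : supported S f -> expect S f s = expect S f s'.
Proof.
move=> fS.
(* Generalized to sublists: the starting points need to agree only on the coordinates of [S] that
   are not averaged any more. *)
suff H S0 s0 s0' : (forall i, i \in S -> i \notin S0 -> s0 i = s0' i) ->
    expect S0 f s0 = expect S0 f s0'.
  by apply: H => i iS; rewrite iS.
elim: S0 s0 s0' => [|i S0 IH] s0 s0' ss /=.
  by apply: fS => j jS; apply: ss.
by congr (_ * _ + _ * _); apply: IH => j jS jS0; rewrite /upd; case: eqVneq => // ji;
  apply: ss => //; rewrite inE negb_or ji.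
Qed.

Lemma expect_widen S S' f s s' : supported S f -> uniq S -> uniq S' ->
  {subset S <= S'} -> expect S' f s = expect S f s'.
Proof.
move=> fS uS uS' SS'.
rewrite (@expect_perm _ (S ++ [seq i <- S' | i \notin S])) //.
  rewrite expect_cat -(expect_supp s s' fS).
  congr expect; apply/funext => s0; apply: (@expect_out _ S) => // i.
  by rewrite mem_filter => /andP[].
apply: uniq_perm => //.
  rewrite cat_uniq uS filter_uniq // andbT.
  by apply/hasPn => i; rewrite mem_filter => /andP[].
move=> i; rewrite mem_cat mem_filter /=.
by case: (boolP (i \in S)) => //= iS; rewrite SS'.
Qed.

Lemma expect_inc S f s i : (forall s s' : I -> bool, (forall i, s i -> s' i) -> f s <= f s') ->
  expect S f (upd s i false) <= expect S f (upd s i true).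
Proof.
move=> fi.
suff H (s0 s0' : I -> bool) : (forall i, s0 i -> s0' i) -> expect S f s0 <= expect S f s0'.
  by apply: H => j; rewrite /upd; case: eqP.
elim: S s0 s0' => [|j S IH] s0 s0' ss /=; first exact: fi.
have H1 : expect S f (upd s0 j true) <= expect S f (upd s0' j true).
  by apply: IH => k; rewrite /upd; case: eqP => // _; apply: ss.
have H2 : expect S f (upd s0 j false) <= expect S f (upd s0' j false).
  by apply: IH => k; rewrite /upd; case: eqP => // _; apply: ss.
by apply: lerD; apply: ler_wpM2l.
Qed.

(** Harris' inequality. Conditioning on the first bit leaves the covariance p(1-p)(f1-f0)(g1-g0),
    which is nonnegative because both conditional means increase with the bit. *)
Lemma expect_fkg S f g s :
  (forall s s' : I -> bool, (forall i, s i -> s' i) -> f s <= f s') ->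
  (forall s s' : I -> bool, (forall i, s i -> s' i) -> g s <= g s') ->
  expect S f s * expect S g s <= expect S (fun s => f s * g s) s.
Proof.
move=> fi gi; elim: S s => [|i S IH] s //=.
have f1 := expect_inc S s i fi; have g1 := expect_inc S s i gi.
have h1 := IH (upd s i true); have h2 := IH (upd s i false).
move: f1 g1 h1 h2.
set f1 := expect S f (upd s i true); set f0 := expect S f (upd s i false).
set g1 := expect S g (upd s i true); set g0 := expect S g (upd s i false).
set e1 := expect S _ (upd s i true); set e0 := expect S _ (upd s i false).
move=> ff gg h1 h2.
have h3 : 0 <= p * (1 - p) * ((f1 - f0) * (g1 - g0)).
  by apply: mulr_ge0; [apply: mulr_ge0|apply: mulr_ge0; lra].
have h4 : p * (f1 * g1) <= p * e1 by apply: ler_wpM2l.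
have h5 : (1 - p) * (f0 * g0) <= (1 - p) * e0 by apply: ler_wpM2l.
apply: le_trans (lerD h4 h5); rewrite -subr_ge0.
apply: (le_trans h3); rewrite le_eqVlt; apply/orP; left; apply/eqP; ring.
Qed.

Lemma expect_indep S S' f g s : supported S f -> supported S' g ->
  (forall i, i \in S' -> i \notin S) ->
  expect (S ++ S') (fun s => f s * g s) s = expect S f s * expect S' g s.
Proof.
move=> fS gS dis; rewrite expect_cat.
rewrite -[RHS]mulrC -expectZ; congr expect; apply/funext => s0.
rewrite (_ : expect S' _ s0 = expect S' (fun s => f s0 * g s) s0).
  by rewrite expectZ mulrC (expect_supp s s0).
suff H T s1 : {subset T <= S'} -> {in S, s1 =1 s0} ->
    expect T (fun s => f s * g s) s1 = expect T (fun s => f s0 * g s) s1.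
  by apply: H.
elim: T s1 => [|i T IH] s1 TS ss /=; first by rewrite (fS _ _ ss).
have iS : i \notin S by apply: dis; apply: TS; rewrite mem_head.
by rewrite !IH // => [j jT|j jS|j jT|j jS]; rewrite ?TS ?inE ?jT ?orbT // /upd;
  case: eqVneq => [ji|_]; rewrite -?ss //; rewrite ji (negbTE iS) in jS.
Qed.

Definition sfalse : I -> bool := fun=> false.

Definition finitary A := exists2 S, uniq S & supported S A.

(* Junk value 0 on events that depend on infinitely many coordinates. *)
Definition pr A : R :=
  if pselect (finitary A) is left h then
    expect (s2val (cid2 h)) (ind A) sfalse else 0.

Lemma supported_ind S A : supported S A -> supported S (ind A).
Proof. by move=> AS s s' ss; rewrite /ind (AS _ _ ss). Qed.

Lemma prE S A s : uniq S -> supported S A -> pr A = expect S (ind A) s.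
Proof.
move=> uS AS; rewrite /pr; case: pselect => [h|[]]; last by exists S.
case: cid2 => /= S' uS' AS'.
have sub1 : {subset S <= undup (S ++ S')}.
  by move=> i iS; rewrite mem_undup mem_cat iS.
have sub2 : {subset S' <= undup (S ++ S')}.
  by move=> i iS; rewrite mem_undup mem_cat iS orbT.
have /supported_ind AS1 := AS; have /supported_ind AS1' := AS'.
rewrite -(@expect_widen S' _ _ s sfalse AS1' uS' (undup_uniq _) sub2).
by rewrite -(@expect_widen S _ _ s s AS1 uS (undup_uniq _) sub1).
Qed.

Lemma supported_sub S S' (T : Type) (f : (I -> bool) -> T) :
  {subset S <= S'} -> supported S f -> supported S' f.
Proof. by move=> SS fS s s' ss; apply: fS => i /SS; apply: ss. Qed.

Lemma finitary2 A B : finitary A -> finitary B ->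
  exists S, [/\ uniq S, supported S A & supported S B].
Proof.
move=> [S uS AS] [S' uS' BS]; exists (undup (S ++ S')); split.
- exact: undup_uniq.
- by apply: (supported_sub _ AS) => i iS; rewrite mem_undup mem_cat iS.
- by apply: (supported_sub _ BS) => i iS; rewrite mem_undup mem_cat iS orbT.
Qed.

Lemma finitary_and A B : finitary A -> finitary B ->
  finitary (fun s => A s /\ B s).
Proof.
move=> fA fB; have [S [uS AS BS]] := finitary2 fA fB.
by exists S => // s s' ss; rewrite (AS _ _ ss) (BS _ _ ss).
Qed.

Lemma finitary_or A B : finitary A -> finitary B ->
  finitary (fun s => A s \/ B s).
Proof.
move=> fA fB; have [S [uS AS BS]] := finitary2 fA fB.
by exists S => // s s' ss; rewrite (AS _ _ ss) (BS _ _ ss).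
Qed.

Lemma finitary_bit i : finitary (fun s => s i).
Proof.
by exists [:: i] => // s s' ss; rewrite (ss i) // mem_head.
Qed.

Lemma finitary_cst (P : Prop) : finitary (fun=> P).
Proof. by exists [::]. Qed.

Lemma pr_le A B : finitary A -> finitary B -> (forall s, A s -> B s) ->
  pr A <= pr B.
Proof.
move=> fA fB AB; have [S [uS AS BS]] := finitary2 fA fB.
rewrite !(@prE S _ sfalse) //; apply: expect_le => s; rewrite /ind ler_nat.
by case: asboolP => [/AB/asboolP->|].
Qed.

Lemma pr_ext A B : (forall s, A s <-> B s) -> pr A = pr B.
Proof. by move=> AB; congr pr; apply/funext => s; apply/propext. Qed.

Lemma pr_cst (P : Prop) : pr (fun=> P) = (`[< P >])%:R.
Proof. by rewrite (@prE [::] _ sfalse). Qed.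

Lemma pr_ge0 A : 0 <= pr A.
Proof.
case: (pselect (finitary A)) => [[S uS AS]|nA]; last first.
  by rewrite /pr; case: pselect.
rewrite (@prE S _ sfalse) // -(expect_cst S 0 sfalse); apply: expect_le => s.
by rewrite ler0n.
Qed.

Lemma pr_le1 A : pr A <= 1.
Proof.
case: (pselect (finitary A)) => [[S uS AS]|nA]; last first.
  by rewrite /pr; case: pselect.
rewrite (@prE S _ sfalse) // -[leRHS](expect_cst S 1 sfalse).
by apply: expect_le => s; rewrite /ind; case: asbool; rewrite ?lexx ?ler01.
Qed.

Lemma pr_or A B : finitary A -> finitary B ->
  pr (fun s => A s \/ B s) <= pr A + pr B.
Proof.
move=> fA fB; have [S [uS AS BS]] := finitary2 fA fB.
rewrite !(@prE S _ sfalse) //; last first.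
  by move=> s s' ss; rewrite (AS _ _ ss) (BS _ _ ss).
rewrite -expectD; apply: expect_le => s; rewrite /ind -natrD ler_nat.
case: (asboolP (A s)) => a; case: (asboolP (B s)) => b;
  by case: asboolP => //; case.
Qed.

Lemma pr_fkg A B : finitary A -> finitary B -> increasing A -> increasing B ->
  pr A * pr B <= pr (fun s => A s /\ B s).
Proof.
move=> fA fB iA iB; have [S [uS AS BS]] := finitary2 fA fB.
rewrite !(@prE S _ sfalse) //; last first.
  by move=> s s' ss; rewrite (AS _ _ ss) (BS _ _ ss).
have mono C : increasing C -> forall s s' : I -> bool, (forall i, s i -> s' i) ->
    ind C s <= ind C s'.
  move=> iC s s' ss; rewrite /ind ler_nat.
  by case: asboolP => // /(iC _ _ ss) /asboolP ->.
apply: (le_trans (expect_fkg _ _ (mono _ iA) (mono _ iB))).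
apply: expect_le => s; rewrite /ind asbool_and -natrM.
by case: asbool; case: asbool.
Qed.

Lemma pr_indep S S' A B : uniq S -> uniq S' ->
  (forall i, i \in S' -> i \notin S) -> supported S A -> supported S' B ->
  pr (fun s => A s /\ B s) = pr A * pr B.
Proof.
move=> uS uS' dis AS BS.
have uSS : uniq (S ++ S').
  rewrite cat_uniq uS uS' andbT /=.
  by apply/hasPn => i /dis.
have sub1 : {subset S <= S ++ S'} by move=> i iS; rewrite mem_cat iS.
have sub2 : {subset S' <= S ++ S'} by move=> i iS; rewrite mem_cat iS orbT.
have AS2 := supported_sub sub1 AS; have BS2 := supported_sub sub2 BS.
rewrite (@prE (S ++ S') _ sfalse) //; last first.
  by move=> s s' ss; rewrite (AS2 _ _ ss) (BS2 _ _ ss).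
rewrite (@prE S A sfalse) // (@prE S' B sfalse) //.
rewrite -(expect_indep _ (supported_ind AS) (supported_ind BS) dis).
congr expect; apply/funext => s; rewrite /ind asbool_and -natrM.
by case: asbool; case: asbool.
Qed.

Lemma pr_bit i : pr (fun s => s i) = p.
Proof.
rewrite (@prE [:: i] _ sfalse) //=.
  by rewrite /ind /upd eqxx asboolT // asboolF //= mulr1 mulr0 addr0.
by move=> s s' ss; rewrite (ss i) // mem_head.
Qed.

Lemma finitary_all S : finitary (fun s => all s S).
Proof.
exists (undup S); first exact: undup_uniq.
by move=> s s' ss; congr is_true; apply: eq_in_all => i iS; apply: ss; rewrite mem_undup.
Qed.

Lemma finitary_has S : finitary (fun s => has s S).
Proof.
exists (undup S); first exact: undup_uniq.
by move=> s s' ss; congr is_true; apply: eq_in_has => i iS; apply: ss; rewrite mem_undup.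
Qed.

(** FKG replaces independence here, so repetitions in [S] do no harm. *)
Lemma pr_all S : p ^+ size S <= pr (fun s => all s S).
Proof.
elim: S => [|i S IH] /=.
  by rewrite expr0 pr_cst asboolT.
rewrite exprS -[X in X * _](pr_bit i).
apply: (@le_trans _ _ (pr (fun s => s i) * pr (fun s => all s S))).
  by apply: ler_wpM2l => //; exact: pr_ge0.
apply: (@le_trans _ _ (pr (fun s => s i /\ all s S))).
  apply: pr_fkg; [exact: finitary_bit|exact: finitary_all| |].
  - by move=> s s' ss /ss.
  - by move=> s s' ss; apply: sub_all.
apply: pr_le => [||s]; last by move=> [-> ->].
  by apply: finitary_and; [exact: finitary_bit|exact: finitary_all].
exact: (finitary_all (i :: S)).
Qed.

Lemma pr_has S : pr (fun s => has s S) <= 1 - (1 - p) ^+ size S.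
Proof.
(* Equality holds without repetitions, and [undup] only shortens the list. *)
suff H T : uniq T -> pr (fun s => has s T) = 1 - (1 - p) ^+ size T.
  have -> : (fun s : I -> bool => is_true (has s S)) = (fun s => has s (undup S)).
    apply/funext => s; congr is_true; apply: eq_has_r => i.
    by rewrite mem_undup.
  rewrite (H _ (undup_uniq S)) lerD2l lerN2.
  by apply: ler_wiXn2l; [exact: p_le1|by rewrite gerBl|exact: size_undup].
elim: T => [|i T IH] /=; first by rewrite pr_cst asboolF // subrr.
move=> /andP[iT uT].
have sup (U : seq I) : supported U (fun s : I -> bool => is_true (has s U)).
  by move=> s s' ss; congr is_true; apply: eq_in_has.
have upi (s : I -> bool) b : has (upd s i b) T = has s T.
  apply: eq_in_has => j jT; rewrite /upd; case: eqVneq => // ji.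
  by rewrite -ji jT in iT.
have -> : pr (fun s => s i || has s T) = p + (1 - p) * pr (fun s => has s T).
  rewrite (@prE (i :: T) _ sfalse); [|by rewrite /= iT|exact: (sup (i :: T))].
  rewrite /= !expect_upd //.
  rewrite (_ : (fun s => _) = fun=> 1); last first.
    by apply/funext => s; rewrite /ind /upd eqxx /= asboolT.
  rewrite expect_cst mulr1 (@prE T _ sfalse) //; congr (_ + _ * expect _ _ _).
  by apply/funext => s; rewrite /ind upi /upd eqxx.
by rewrite IH // exprS; ring.
Qed.

(** Disjoint blocks are independent. All exponential bounds of the proof come from here: columns met
    by a path, rows met along a line, sides without a gap. *)
Lemma pr_blocks (S : nat -> seq I) M N :
  (forall a, a < N -> size (S a) <= M)%N ->
  (forall a b i, a < N -> b < N -> i \in S a -> i \in S b -> a = b)%N ->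
  pr (fun s => forall a, (a < N)%N -> has s (S a)) <= (1 - (1 - p) ^+ M) ^+ N.
Proof.
elim: N => [|N IH] sz dis; first by rewrite expr0 pr_le1.
pose U := undup (flatten [seq S a | a <- iota 0 N]).
have memU i : (i \in U) -> exists2 a, (a < N)%N & i \in S a.
  rewrite mem_undup => /flatten_mapP[a]; rewrite mem_iota add0n /= => aN iS.
  by exists a.
have supU : supported U (fun s : I -> bool => forall a, (a < N)%N -> has s (S a)).
  move=> s s' ss.
  have e a : (a < N)%N -> has s (S a) = has s' (S a).
    move=> aN; apply: eq_in_has => i iS; apply: ss.
    by rewrite mem_undup; apply/flatten_mapP; exists a; rewrite // mem_iota.
  by apply/propext; split=> h a aN; have := h a aN; rewrite e.
rewrite exprS mulrC.
rewrite (@pr_ext _ (fun s => (forall a, (a < N)%N -> has s (S a)) /\ has s (S N))).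
- rewrite (@pr_indep U (undup (S N))) ?undup_uniq //.
  + apply: ler_pM; rewrite ?pr_ge0 //.
    * by apply: IH => [a aN|a b i aN bN]; [apply: sz|apply: dis]; exact: ltnW.
    * apply: (le_trans (pr_has _)); rewrite lerD2l lerN2.
      by apply: ler_wiXn2l; [exact: p_le1|by rewrite gerBl|exact: sz].
  + move=> i; rewrite mem_undup => iN; apply/negP => /memU[a aN iS].
    by have := dis a N i (ltnW aN) (ltnSn _) iS iN => aE; rewrite aE ltnn in aN.
  + move=> s s' ss; congr is_true; apply: eq_in_has => i iS.
    by apply: ss; rewrite mem_undup.
- move=> s; split=> [h|[h hN] a].
    by split=> [a aN|]; apply: h => //; exact: ltnW.
  by rewrite ltnS leq_eqVlt => /orP[/eqP->|/h].
Qed.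

End Expectation.

Lemma expect_map (I J : eqType) (f : I -> J) S (g : (I -> bool) -> R) s :
  injective f ->
  expect (map f S) (fun s => g (s \o f)) s = expect S g (s \o f).
Proof.
move=> fi; elim: S s => [|i S IH] s //=; rewrite !IH.
have H b : upd s (f i) b \o f = upd (s \o f) i b.
  by apply/funext => j; rewrite /upd /= (inj_eq fi).
by rewrite !H.
Qed.

Lemma supported_map (I J : eqType) (f : I -> J) S (A : (I -> bool) -> Prop) :
  supported S A -> supported (map f S) (fun s => A (s \o f)).
Proof.
by move=> AS s s' ss; apply: AS => i iS; apply: ss; rewrite map_f.
Qed.

Lemma finitary_map (I J : eqType) (f : I -> J) (A : (I -> bool) -> Prop) :
  finitary A -> finitary (fun s => A (s \o f)).
Proof.
move=> [S uS AS]; exists (undup (map f S)); first exact: undup_uniq.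
apply: (supported_sub _ (supported_map AS)) => i; by rewrite mem_undup.
Qed.

(** An injective renaming of the coordinates preserves the law; translations, reflections,
    transposition and the passage to the next level are all of this kind. *)
Lemma pr_map (I J : eqType) (f : I -> J) (A : (I -> bool) -> Prop) :
  injective f -> finitary A -> pr (fun s => A (s \o f)) = pr A.
Proof.
move=> fi [S uS AS].
rewrite (@prE _ (map f S) _ (@sfalse J)).
- rewrite (@prE _ S A (@sfalse I)) //.
  exact: (expect_map S (ind A) (@sfalse J) fi).
- by rewrite map_inj_uniq.
- exact: supported_map.
Qed.

End Bernoulli.

(** * King paths in the plane *)

Definition cell := (Z * Z)%type.

Section KingPaths.
Local Open Scope Z_scope.
Implicit Types (u v w a b : cell) (O Q : cell -> Prop).

Definition adj u v := Z.abs (u.1 - v.1) <= 1 /\ Z.abs (u.2 - v.2) <= 1.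

Lemma adjC u v : adj u v -> adj v u.
Proof. rewrite /adj; lia. Qed.

Lemma adj_refl u : adj u u.
Proof. rewrite /adj; lia. Qed.

Inductive link O u : cell -> Prop :=
| link0 : O u -> link O u u
| link_step v w : link O u v -> adj v w -> O w -> link O u w.

Lemma link_in O u v : link O u v -> O u /\ O v.
Proof. by elim=> // w t _ []. Qed.

Lemma link_trans O u v w : link O u v -> link O v w -> link O u w.
Proof. by move=> uv; elim=> // x y _ ux xy Oy; exact: link_step ux xy Oy. Qed.

Lemma link_adj O u v w t :
  link O u v -> adj v w -> link O w t -> link O u t.
Proof.
move=> uv vw wt; apply: link_trans (wt); apply: (link_step uv vw).
by case: (link_in wt).
Qed.

Lemma link_sym O u v : link O u v -> link O v u.
Proof.
elim=> [Ou|x y _ xu xy Oy]; first exact: link0.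
exact: link_adj (link0 Oy) (adjC xy) xu.
Qed.

Lemma link_sub O Q u v : (forall a, O a -> Q a) -> link O u v -> link Q u v.
Proof.
move=> OQ; elim=> [/OQ Qu|x y _ ux xy /OQ Qy]; first exact: link0.
exact: link_step ux xy Qy.
Qed.

Lemma link_map O Q (f : cell -> cell) u v :
  (forall a, O a -> Q (f a)) -> (forall a b, adj a b -> adj (f a) (f b)) ->
  link O u v -> link Q (f u) (f v).
Proof.
move=> OQ ff; elim=> [/OQ Qu|x y _ ux /ff xy /OQ Qy]; first exact: link0.
exact: link_step ux xy Qy.
Qed.

(** Replacing [O] by the part of it that is reachable from [u] makes the adjacent cells found by the
    crossing lemmas automatically linked to the starting points. *)
Lemma link_reach O u v : link O u v -> link (link O u) u v.
Proof.
elim=> [Ou|x y ux ux' xy Oy]; first by do 2 apply: link0.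
by apply: (link_step ux' xy); apply: (link_step ux xy).
Qed.

Lemma link_seq O u v : link O u v -> exists l (c : nat -> cell),
  [/\ c 0%N = u, c l = v, forall i, (i <= l)%N -> O (c i) &
      forall i, (i < l)%N -> adj (c i) (c i.+1)].
Proof.
elim=> [Ou|x w _ [l [c [c0 cl cO ca]]] vw Ow].
  by exists 0%N, (fun=> u); split.
exists l.+1, (fun i => if (i <= l)%N then c i else w); split=> //.
- by rewrite ltnn.
- by move=> i il; case: ifP => // /cO.
- move=> i; rewrite ltnS => il; rewrite il; case: ifP => [/ca//|li].
  have -> : i = l by lia.
  by rewrite cl.
Qed.

Fixpoint parity (f : nat -> bool) k :=
  if k is k'.+1 then f k' (+) parity f k' else false.

(** The square identity below, summed along the second path: the inner terms cancel modulo 2. *)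
Lemma parity_telescope (f g h : nat -> bool) k :
  (forall j, (j < k)%N -> f j (+) g j = h j (+) h j.+1) ->
  parity f k (+) parity g k = h 0%N (+) h k.
Proof.
elim: k => [|k IH] fg /=; first by rewrite addbb.
have := IH (fun j jk => fg j (ltnW jk)); have := fg k (ltnSn _).
by case: (f k); case: (g k); case: (h k); case: (h k.+1); case: (h 0%N);
  case: (parity f k); case: (parity g k).
Qed.

Section Crossing.
Variables (l l' : nat) (c d : nat -> cell).
Hypothesis ca : forall i, (i < l)%N -> adj (c i) (c i.+1).
Hypothesis da : forall j, (j < l')%N -> adj (d j) (d j.+1).
Hypothesis far : forall i j, (i <= l)%N -> (j <= l')%N -> ~ adj (c i) (d j).

Let above i j := (c i).2 <? (d j).2.
Let right i j := (c i).1 <? (d j).1.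
Let flip i j := (above i j (+) above i j.+1) && right i j.
Let hflip i j := (above i j (+) above i.+1 j) && right i j.

(** The changes of [above] around a square of the grid of indices cancel. Where [above] changes, the
    two cells are nearly at the same height, hence at horizontal distance at least 2, and one step
    cannot change [right]. *)
Let square i j : (i < l)%N -> (j < l')%N ->
  flip i j (+) flip i.+1 j = hflip i j (+) hflip i j.+1.
Proof.
move=> il jl.
have := ca il; have := da jl.
have := far (ltnW il) (ltnW jl); have := far (ltnW il) jl.
have := far il (ltnW jl); have := far il jl.
rewrite /flip /hflip /above /right /adj.
case: (c i) => a1 a2; case: (c i.+1) => b1 b2; case: (d j) => e1 e2.
case: (d j.+1) => f1 f2 /=.
case: (Z.ltb_spec a2 e2) => ?; case: (Z.ltb_spec a2 f2) => ?;
case: (Z.ltb_spec b2 e2) => ?; case: (Z.ltb_spec b2 f2) => ? //=;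
case: (Z.ltb_spec a1 e1) => ?; case: (Z.ltb_spec b1 e1) => ? //=;
case: (Z.ltb_spec a1 f1) => ? //=; lia.
Qed.

(* [flip i] counts the passages of [d] through the horizontal ray to the right
   of [c i]; its parity does not change along [c]. *)
Lemma crossing_far_absurd :
  (forall j, (j <= l')%N -> (c 0%N).1 <= (d j).1 <= (c l).1) ->
  (forall i, (i <= l)%N -> (d 0%N).2 <= (c i).2 < (d l').2) -> False.
Proof.
move=> dx cy.
have ab0 i : (i <= l)%N -> above i 0 = false.
  by move=> il; have := cy i il; rewrite /above; lia.
have abl i : (i <= l)%N -> above i l' = true.
  by move=> il; have := cy i il; rewrite /above; lia.
have par i : (i <= l)%N -> parity (flip i) l' = parity (flip 0) l'.
  elim: i => [//|i IH] il; rewrite -(IH (ltnW il)).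
  have tel := @parity_telescope (flip i) (flip i.+1) (hflip i) l'
    (fun j => @square i j il).
  have h0 : hflip i 0 = false by rewrite /hflip !ab0 // ltnW.
  have hl : hflip i l' = false by rewrite /hflip !abl // ltnW.
  move: tel; rewrite h0 hl.
  by move: (parity (flip i) l') (parity (flip i.+1) l') => [] [].
have pl : parity (flip l) l' = false.
  have H k : (k <= l')%N -> parity (flip l) k = false.
    elim: k => //= k IH kl; rewrite IH; last lia.
    have := dx k (ltnW kl); rewrite /flip /right.
    by case: Z.ltb_spec; [lia|rewrite andbF].
  exact: H.
(* No cell of [d] is to the left of [c 0], so all passages count. In the column of [c 0] itself
   [right] is false, but there [above] cannot change without the paths being adjacent. *)
have p0 : parity (flip 0) l' = true.
  have H k : (k <= l')%N -> parity (flip 0) k = above 0 k.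
    elim: k => [|k IH] kl /=; first by rewrite ab0.
    rewrite IH; last lia.
    have dk := dx k (ltnW kl).
    have f1 := far (leq0n l) (ltnW kl); have f2 := far (leq0n l) kl.
    have := da kl; rewrite /flip.
    case: (boolP (right 0 k)) => [|nr]; first by case: above; case: above.
    rewrite andbF /= => dd; move: nr; rewrite /right /above.
    case: Z.ltb_spec => // r _; move: dd f1 f2; rewrite /adj => dd f1 f2; lia.
  by rewrite H // abl.
by move: (par l (leqnn _)); rewrite pl p0.
Qed.

End Crossing.

Lemma cross_adj_strict O Q u v s t : link O u v -> link Q s t ->
  (forall b, Q b -> u.1 <= b.1 <= v.1) ->
  (forall a, O a -> s.2 <= a.2 < t.2) ->
  exists a b, [/\ O a, Q b & adj a b].
Proof.
move=> /link_seq[l [c [c0 cl cO ca]]] /link_seq[l' [d [d0 dl dQ da]]] bx ay.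
have [//|none] := EM (exists a b, [/\ O a, Q b & adj a b]).
exfalso; apply: (@crossing_far_absurd l l' c d) => //.
- move=> i j il jl ad; apply: none; exists (c i), (d j); split=> //.
    exact: cO.
  exact: dQ.
- by move=> j jl; rewrite c0 cl; apply: bx; apply: dQ.
- by move=> i il; rewrite d0 dl; apply: ay; apply: cO.
Qed.

(** The strict version is applied after adding a cell [t'] on top of [t]; a cell of [O] adjacent to
    [t'] is not higher than [t], so it is adjacent to [t] as well. *)
Lemma cross_adj O Q u v s t : link O u v -> link Q s t ->
  (forall b, Q b -> u.1 <= b.1 <= v.1) ->
  (forall a, O a -> s.2 <= a.2 <= t.2) ->
  exists a b, [/\ O a, Q b & adj a b].
Proof.
move=> uv st bx ay; pose t' : cell := (t.1, t.2 + 1).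
have [Qs Qt] := link_in st.
have [|||a [b [Oa [Qb|->] ab]]] :=
    @cross_adj_strict O (fun b => Q b \/ b = t') u v s t' uv.
- apply: (@link_step _ _ t); last by right.
    by apply: link_sub st; left.
  by rewrite /adj /t' /=; lia.
- by move=> b [/bx//|->]; exact: (bx t).
- by move=> a /ay; rewrite /t' /=; lia.
- by exists a, b.
- exists a, t; split=> //.
  by have := ay _ Oa; move: ab; rewrite /adj /t' /=; lia.
Qed.

(** The piece between the first arrival at height [yb] and the last visit of height [ya] before it;
    king steps cannot jump over a height. *)
Lemma sub_crossing O u v ya yb : link O u v -> u.2 <= ya -> ya <= yb -> yb <= v.2 ->
  exists s t, [/\ link O u s, s.2 = ya, t.2 = yb &
    link (fun a => O a /\ ya <= a.2 <= yb) s t].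
Proof.
move=> uv uy yy yv; pose strip a := O a /\ ya <= a.2 <= yb.
(* Invariant along the path: a crossing of the strip has been completed, or the path is below it, or
   it has stayed in it since a cell of height [ya]. *)
have : (exists s t, [/\ link O u s, s.2 = ya, t.2 = yb & link strip s t]) \/
    v.2 < ya \/ exists s, [/\ link O u s, s.2 = ya & link strip s v].
  elim: uv {yv} => [Ou|x y ux IH xy Oy].
    have [?|uE] : u.2 < ya \/ u.2 = ya by lia.
      by right; left.
    right; right; exists u; split=> //; first exact: link0.
    by apply: link0; split=> //; lia.
  have uyl := link_step ux xy Oy.
  case: IH => [|[xa|[s [us sy sx]]]]; first by left.
    have [?|yE] : y.2 < ya \/ y.2 = ya by move: xy; rewrite /adj; lia.
      by right; left.
    right; right; exists y; split=> //.
    by apply: link0; split=> //; lia.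
  have [_ [_ xb]] := link_in sx.
  have [?|[yb'|yE]] : y.2 < ya \/ ya <= y.2 <= yb \/ x.2 = yb.
  - by move: xy; rewrite /adj; lia.
  - by right; left.
  - by right; right; exists s; split=> //; apply: link_step sx xy _.
  - by left; exists s, x.
case=> // -[?|[s [us sy sv]]]; first lia.
exists s, v; split=> //; have [_ [_]] := link_in sv; lia.
Qed.

Lemma sub_column O u v x : link O u v -> u.1 <= x <= v.1 ->
  exists2 c, link O u c & c.1 = x.
Proof.
elim=> [Ou|a b ua IH ab Ob] ux; first by exists u; [exact: link0|lia].
have [xa|xb] : x <= a.1 \/ x = b.1 by move: ab; rewrite /adj; lia.
  by apply: IH; lia.
by exists b => //; exact: link_step ua ab Ob.
Qed.

(* Both paths are prolonged by two columns to the right of the last one, so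
   that they cross a common box. *)
Lemma tip_arc O Q u v s t x0 : link O u v -> link Q s t ->
  (forall a, O a -> x0 <= a.1 <= v.1) -> u.1 = x0 ->
  (forall b, Q b -> x0 <= b.1 <= v.1) -> s.1 = v.1 -> t.1 = v.1 ->
  s.2 < v.2 < t.2 ->
  (exists y0, forall a, O a \/ Q a -> - y0 <= a.2 <= y0) ->
  exists a b, [/\ O a, Q b & adj a b].
Proof.
move=> uv st Ox ux Qx sx tx svt [y0 bd].
have [Ou Ov] := link_in uv; have [Qs Qt] := link_in st.
pose e : cell := (v.1 + 2, v.2).
pose O' a := O a \/ a = (v.1 + 1, v.2) \/ a = e.
pose Q' b := Q b \/ b = (v.1 + 1, s.2) \/ b = (v.1 + 1, t.2) \/
  (b.1 = v.1 + 2 /\ (b.2 <= s.2 \/ t.2 <= b.2)).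
have ve : link O' u e.
  apply: (@link_step _ _ (v.1 + 1, v.2)); last by right; right.
    apply: (@link_step _ _ v); last by right; left.
      by apply: link_sub uv; left.
    by rewrite /adj /=; lia.
  by rewrite /adj /=; lia.
have ray y k : t.2 <= y -> link Q' (v.1 + 2, y) (v.1 + 2, y + Z.of_nat k).
  move=> ty; elim: k => [|k IH].
    rewrite Z.add_0_r; apply: link0; do 3 right; rewrite /=; lia.
  apply: (link_step IH); first by rewrite /adj /=; lia.
  by do 3 right; rewrite /=; lia.
have ray' y k : y <= s.2 -> link Q' (v.1 + 2, y - Z.of_nat k) (v.1 + 2, y).
  move=> ty; elim: k => [|k IH].
    rewrite Z.sub_0_r; apply: link0; do 3 right; rewrite /=; lia.
  apply: (link_adj (link0 _) _ IH); last by rewrite /adj /=; lia.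
  by do 3 right; rewrite /=; lia.
(* Long enough for both rays to leave the band of height [y0] around 0, as [cross_adj] requires. *)
pose k := Z.to_nat (2 * Z.abs y0 + 5).
have st' : link Q' (v.1 + 2, s.2 - Z.of_nat k) (v.1 + 2, t.2 + Z.of_nat k).
  have Q'st : link Q' s t by apply: link_sub st; left.
  apply: (@link_adj _ _ (v.1 + 2, s.2) (v.1 + 1, s.2)); first exact: ray' (Z.le_refl _).
    by rewrite /adj /=; lia.
  apply: (@link_adj _ _ (v.1 + 1, s.2) s); first by apply: link0; right; left.
    by rewrite /adj /=; lia.
  apply: (link_trans Q'st).
  apply: (@link_adj _ _ t (v.1 + 1, t.2)); first exact: link0 (or_introl Qt).
    by rewrite /adj /=; lia.
  apply: (@link_adj _ _ (v.1 + 1, t.2) (v.1 + 2, t.2)).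
  - by apply: link0; right; right; left.
  - by rewrite /adj /=; lia.
  - exact: ray (Z.le_refl _).
have := bd s (or_intror Qs); have := bd t (or_intror Qt) => bt bs.
have [||a [b [Oa Qb ab]]] := cross_adj ve st'.
- move=> b; rewrite /e /= ux; case=> [/Qx|[->|[->|]]] /=; have := Ox _ Ov; lia.
- move=> a; rewrite /= /O' /e; have bv := bd _ (or_introl Ov).
  case=> [Oa|[->|->]] /=; try lia.
  by have := bd a (or_introl Oa); lia.
have near (x y : cell) : O x -> Q y -> adj x y -> exists a b, [/\ O a, Q b & adj a b].
  by move=> *; exists x, y.
move: Oa Qb ab; rewrite /O' /Q' /adj /e; case=> [Oa|aE]; case=> [Qb|bE].
- exact: near.
- have ax := Ox _ Oa; case: bE => [->|[->|bE]] /= ab.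
  + by apply: (near a s) => //; rewrite /adj; lia.
  + by apply: (near a t) => //; rewrite /adj; lia.
  + lia.
- have bx := Qx _ Qb; case: aE => -> /= ab; last lia.
  by apply: (near v b) => //; rewrite /adj; lia.
(* The two prolongations are adjacent only if [v] is one row away from [s] or [t]; as these lie in
   the same column, the original paths are then adjacent too. *)
- have [hs|ht] : v.2 = s.2 + 1 /\ True \/ v.2 + 1 = t.2 /\ True \/
      (Z.abs (a.1 - b.1) <= 1 /\ Z.abs (a.2 - b.2) <= 1 -> False).
    case: aE => ->; case: bE => [->|[->|]] /=; lia.
  + by move=> _; apply: (near v s) => //; rewrite /adj; lia.
  + case: ht => [ht _|//]; apply: (near v t) => //; rewrite /adj; lia.
Qed.

Lemma tip_arc_left O Q u v s t x1 : link O u v -> link Q s t ->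
  (forall a, O a -> u.1 <= a.1 <= x1) -> v.1 = x1 ->
  (forall b, Q b -> u.1 <= b.1 <= x1) -> s.1 = u.1 -> t.1 = u.1 ->
  s.2 < u.2 < t.2 ->
  (exists y0, forall a, O a \/ Q a -> - y0 <= a.2 <= y0) ->
  exists a b, [/\ O a, Q b & adj a b].
Proof.
move=> /link_sym vu st Ox vx Qx sx tx sut [y0 bd].
pose f (c : cell) : cell := (- c.1, c.2).
have fK c : f (f c) = c by case: c => x y; rewrite /f /= Z.opp_involutive.
have fadj a b : adj a b -> adj (f a) (f b) by rewrite /adj /=; lia.
have vu' : link (O \o f) (f v) (f u).
  by apply: link_map vu => // a Oa; rewrite /= fK.
have st' : link (Q \o f) (f s) (f t).
  by apply: link_map st => // a Oa; rewrite /= fK.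
have [|||||||a [b [Oa Qb ab]]] := @tip_arc _ _ _ _ _ _ (- x1) vu' st' => //=.
- by move=> a /Ox /=; lia.
- by rewrite vx.
- by move=> a /Qx /=; lia.
- by rewrite sx.
- by rewrite tx.
- by exists y0 => a /bd.
by exists (f a), (f b); split=> //; exact: fadj.
Qed.

End KingPaths.

(** * Level-[k] crossings and possible events *)

Definition site := (nat * cell)%type.
Definition config := site -> bool.
Definition event_seq := nat -> config -> Prop.

(** Finitary, so that [pr] is meaningful; decreasing in the level, so that bounds at deep levels
    suffice; increasing in the configuration, as the FKG inequality demands. *)
Record good (F : event_seq) : Prop := Good {
  good_fin : forall k, finitary (F k);
  good_dec : forall k s, F k.+1 s -> F k s;
  good_inc : forall k, increasing (F k) }.

Lemma good_decn F k l s : good F -> (k <= l)%N -> F l s -> F k s.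
Proof.
move=> gF; elim: l => [|l IH]; first by rewrite leqn0 => /eqP ->.
by rewrite leq_eqVlt => /orP[/eqP->//|kl] /(good_dec gF); apply: IH.
Qed.

Lemma good_and F G : good F -> good G -> good (fun k s => F k s /\ G k s).
Proof.
move=> gF gG; split=> k.
- by apply: finitary_and; apply: good_fin.
- by move=> s [/(good_dec gF) ? /(good_dec gG)].
- by move=> s s' ss [Fs Gs]; split; [apply: (good_inc gF) Fs|apply: (good_inc gG) Gs].
Qed.

Lemma good_or F G : good F -> good G -> good (fun k s => F k s \/ G k s).
Proof.
move=> gF gG; split=> k.
- by apply: finitary_or; apply: good_fin.
- by move=> s [/(good_dec gF)|/(good_dec gG)]; [left|right].
- by move=> s s' ss [Fs|Gs]; [left; apply: (good_inc gF) Fs|right; apply: (good_inc gG) Gs].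
Qed.

Lemma finitary_ex (I : eqType) (F : nat -> (I -> bool) -> Prop) N :
  (forall i, finitary (F i)) ->
  finitary (fun s => exists2 i, (i < N)%N & F i s).
Proof.
move=> fF; elim: N => [|N IH].
  have -> : (fun s => exists2 i, (i < 0)%N & F i s) = fun=> False.
    by apply/funext => s; apply/propext; split=> // -[].
  exact: finitary_cst.
have -> : (fun s => exists2 i, (i < N.+1)%N & F i s) =
    (fun s => F N s \/ exists2 i, (i < N)%N & F i s).
  apply/funext => s; apply/propext; split=> [[i]|[FN|[i iN Fi]]].
  - by rewrite ltnS leq_eqVlt => /orP[/eqP->|iN] Fi; [left|right; exists i].
  - by exists N.
  - by exists i => //; exact: ltnW.
exact: finitary_or.
Qed.

Lemma good_ex (F : nat -> event_seq) N : (forall i, good (F i)) ->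
  good (fun k s => exists2 i, (i < N)%N & F i k s).
Proof.
move=> gF; split=> k.
- by apply: finitary_ex => i; exact: good_fin.
- by move=> s [i iN Fi]; exists i => //; exact: good_dec.
- by move=> s s' ss [i iN Fi]; exists i => //; exact: (good_inc (gF i)) Fi.
Qed.

Section Possible.
Variables (R : realType) (p : R).
Hypothesis p01 : 0 <= p <= 1.

Definition possible (F : event_seq) := exists2 e : R, 0 < e & forall k, e <= pr p (F k).

Lemma possible_le F G : good F -> good G -> (forall k s, F k s -> G k s) ->
  possible F -> possible G.
Proof.
move=> gF gG FG [e e0 eF]; exists e => // k.
by apply: (le_trans (eF k)); apply: pr_le => //; [exact: good_fin|exact: good_fin|exact: FG].
Qed.

Lemma possible_and F G : good F -> good G -> possible F -> possible G ->
  possible (fun k s => F k s /\ G k s).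
Proof.
move=> gF gG [e e0 eF] [f f0 fG]; exists (e * f); first exact: mulr_gt0.
move=> k; apply: (le_trans _ (pr_fkg p01 (good_fin gF k) (good_fin gG k)
  (@good_inc _ gF k) (@good_inc _ gG k))).
by apply: ler_pM => //; exact: ltW.
Qed.

Lemma possible_tail F k0 (e : R) : good F -> 0 < e ->
  (forall k, (k0 <= k)%N -> e <= pr p (F k)) -> possible F.
Proof.
move=> gF e0 eF; exists e => // k.
apply: (le_trans (eF _ (leq_maxr k k0))); apply: pr_le => //; try exact: good_fin.
by move=> s; apply: good_decn => //; exact: leq_maxl.
Qed.

Lemma not_possible F (e : R) : good F -> ~ possible F -> 0 < e ->
  exists k0, forall k, (k0 <= k)%N -> pr p (F k) < e.
Proof.
move=> gF nF e0; have [//|H] := EM (exists k, pr p (F k) < e).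
  case=> k0 Fk0; exists k0 => k kk; apply: le_lt_trans Fk0.
  apply: pr_le => //; try exact: good_fin.
  by move=> s; apply: good_decn.
exfalso; apply: nF; exists e => // k; rewrite leNgt; apply/negP => Fk.
by apply: H; exists k.
Qed.

(** If [F] is not possible, its decreasing probabilities eventually fall below e/2, and the union
    bound leaves e/2 to [G]. *)
Lemma possible_or F G : good F -> good G ->
  possible (fun k s => F k s \/ G k s) -> possible F \/ possible G.
Proof.
move=> gF gG [e e0 eFG]; have [?|nF] := EM (possible F); [by left|right].
have [k0 Fk0] : exists k0, forall k, (k0 <= k)%N -> pr p (F k) < e / 2.
  by apply: not_possible => //; lra.
apply: (@possible_tail _ k0 (e / 2)) => //; first by lra.
move=> k kk; have := pr_or p01 (good_fin gF k) (good_fin gG k).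
by have := eFG k; have := Fk0 k kk; lra.
Qed.

Lemma possible_ex (F : nat -> event_seq) N : (forall i, good (F i)) ->
  possible (fun k s => exists2 i, (i < N)%N & F i k s) ->
  exists2 i, (i < N)%N & possible (F i).
Proof.
move=> gF; elim: N => [|N IH] pF.
  case: pF => e e0 /(_ 0%N); rewrite (@pr_ext _ _ _ _ (fun=> False)).
    by rewrite pr_cst // asboolF //= => e1; lra.
  by move=> s; split=> // -[].
have {pF} : possible (fun k s => F N k s \/ exists2 i, (i < N)%N & F i k s).
  apply: possible_le pF.
  - exact: good_ex.
  - by apply: good_or => //; exact: good_ex.
  - move=> k s [i]; rewrite ltnS leq_eqVlt => /orP[/eqP->|iN] Fi; first by left.
    by right; exists i.
case/possible_or => [//||pN|/IH[i iN pi]].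
- exact: good_ex.
- by exists N.
- by exists i => //; exact: ltnW.
Qed.

Lemma possible_map F G (f : site -> site) : injective f -> good F -> good G ->
  (forall k s, F k (s \o f) -> G k s) -> possible F -> possible G.
Proof.
move=> fi gF gG FG [e e0 eF]; exists e => // k; apply: (le_trans (eF k)).
rewrite -(pr_map p fi (good_fin gF k)); apply: pr_le => //.
- by apply: finitary_map; exact: good_fin.
- exact: good_fin.
- exact: FG.
Qed.

End Possible.

Local Open Scope Z_scope.

Fixpoint pw (n : Z) (k : nat) : Z := if k is k'.+1 then n * pw n k' else 1.

Lemma pw_gt0 n k : 0 < n -> 0 < pw n k.
Proof. by move=> n0; elim: k => //= k IH; lia. Qed.

Lemma pwD n k l : pw n (k + l) = pw n k * pw n l.
Proof.
elim: k => [|k IH]; first by rewrite add0n /= Z.mul_1_l.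
by rewrite addSn /= IH Z.mul_assoc.
Qed.

Lemma div_between n A B x : 0 < n -> n * A <= x < n * B -> A <= x / n < B.
Proof.
move=> n0 [Ax xB]; split; first by apply: Z.div_le_lower_bound.
by apply: Z.div_lt_upper_bound.
Qed.

Lemma div_last n A : 0 < n -> (n * A - 1) / n = A - 1.
Proof. by move=> n0; have := @div_between n (A - 1) A (n * A - 1) n0; lia. Qed.

Lemma div_mulK n A : 0 < n -> (n * A) / n = A.
Proof. by move=> n0; rewrite Z.mul_comm Z.div_mul //; lia. Qed.

Lemma div_adj n a b : 0 < n -> Z.abs (a - b) <= 1 -> Z.abs (a / n - b / n) <= 1.
Proof.
move=> n0 ab; have := Z.div_mod a n; have := Z.div_mod b n.
have := Z.mod_pos_bound a n n0; have := Z.mod_pos_bound b n n0.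
move: (a / n) (b / n) (a mod n) (b mod n) => x y r t *.
have : n * (x - y) < 2 * n by nia.
have : - (2 * n) < n * (x - y) by nia.
nia.
Qed.

Lemma div_opp x q A : 0 < q -> (q * A - 1 - x) / q = A - 1 - x / q.
Proof.
move=> q0; have := @div_between q (A - 1 - x / q) (A - x / q) (q * A - 1 - x) q0.
have := Z.div_mod x q; have := Z.mod_pos_bound x q q0; nia.
Qed.

(** * Independent nested percolations in the unit cells of the plane *)

Section Model.
Variables n m : Z.
Hypotheses (n2 : 2 <= n) (m2 : 2 <= m).
Let n0 : 0 < n. Proof. lia. Qed.
Let m0 : 0 < m. Proof. lia. Qed.
Local Notation N := (pw n).
Local Notation M := (pw m).

Definition parent (c : cell) : cell := (c.1 / n, c.2 / m).

(** A cell is open if it and its ancestors down to level 1 are selected; a unit cell, of level 0,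
    carries no condition. Cells range over the whole plane, so that translations act on
    configurations. *)
Fixpoint is_open (k : nat) (s : config) (c : cell) : bool :=
  if k is k'.+1 then s (k, c) && is_open k' s (parent c) else true.

Lemma parent_adj u v : adj u v -> adj (parent u) (parent v).
Proof. by rewrite /adj => -[? ?]; split; apply: div_adj. Qed.

Implicit Types A B Q : nat -> cell -> Prop.

(** The image of a path under [parent] stays in such a region, which is why the events [joined]
    decrease with the level. *)
Definition stable A := forall k c, A k.+1 c -> A k (parent c).

Definition bounded Q :=
  forall k, exists b, forall c, Q k c -> Z.abs c.1 <= b /\ Z.abs c.2 <= b.

Definition joined A B Q : event_seq := fun k s =>
  exists u v, [/\ A k u, B k v & link (fun c => Q k c /\ is_open k s c) u v].

Lemma is_open_inc k (s s' : config) c : (forall i, s i -> s' i) ->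
  is_open k s c -> is_open k s' c.
Proof.
by move=> ss; elim: k c => //= k IH c /andP[/ss-> /IH].
Qed.

Definition zrange b : seq Z := [seq Z.of_nat i - b | i <- iota 0 (Z.to_nat (2 * b + 1))].

Lemma mem_zrange b x : Z.abs x <= b -> x \in zrange b.
Proof.
move=> xb; apply/mapP; exists (Z.to_nat (x + b)); last by lia.
by rewrite mem_iota; lia.
Qed.

Definition indices k b : seq site :=
  undup [seq (j, c) | j <- iota 0 k.+1,
                      c <- [seq (x, y) | x <- zrange b, y <- zrange b]].

Lemma mem_indices k b j (c : cell) : (j <= k)%N -> Z.abs c.1 <= b ->
  Z.abs c.2 <= b -> (j, c) \in indices k b.
Proof.
case: c => x y jk xb yb; rewrite mem_undup; apply/allpairsP.
exists (j, (x, y)); split=> //; first by rewrite mem_iota add0n ltnS.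
by apply/allpairsP; exists (x, y); split=> //=; apply: mem_zrange.
Qed.

(** Floor division keeps the interval from -b to b, so one index set serves a cell and all its
    ancestors. *)
Lemma div_abs x q b : 0 < q -> Z.abs x <= b -> Z.abs (x / q) <= b.
Proof.
move=> q0 xb; have := Z.div_mod x q; have := Z.mod_pos_bound x q q0; nia.
Qed.

Lemma is_open_ext k b (s s' : config) c : Z.abs c.1 <= b -> Z.abs c.2 <= b ->
  {in indices k b, s =1 s'} -> is_open k s c = is_open k s' c.
Proof.
move=> cx cy ss.
suff H j : (j <= k)%N -> is_open j s c = is_open j s' c by exact: H.
elim: j c cx cy => //= j IH c cx cy jk.
rewrite ss ?mem_indices // IH //; try exact: div_abs.
exact: ltnW.
Qed.

Lemma good_joined A B Q : stable A -> stable B -> stable Q -> bounded Q ->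
  good (joined A B Q).
Proof.
move=> sA sB sQ bQ; split=> k.
- have [b Qb] := bQ k; exists (indices k b); first exact: undup_uniq.
  have H s s' : {in indices k b, s =1 s'} ->
      joined A B Q k s -> joined A B Q k s'.
    move=> ss [u [v [Au Bv uv]]]; exists u, v; split=> //.
    apply: link_sub uv => c [Qc op]; split=> //.
    by have [cx cy] := Qb _ Qc; rewrite -(is_open_ext cx cy ss).
  move=> s s' ss; apply/propext; split; apply: H => // i /ss //.
- move=> s [u [v [Au Bv uv]]]; exists (parent u), (parent v); split.
  + exact: sA.
  + exact: sB.
  + apply: link_map uv; last exact: parent_adj.
    by move=> c [Qc /= /andP[_ op]]; split=> //; exact: sQ.
- move=> s s' ss [u [v [Au Bv uv]]]; exists u, v; split=> //.
  by apply: link_sub uv => c [Qc /(is_open_inc ss)].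
Qed.

Lemma joined_sub A B Q A' B' Q' k s :
  (forall c, A k c -> A' k c) -> (forall c, B k c -> B' k c) ->
  (forall c, Q k c -> Q' k c) -> joined A B Q k s -> joined A' B' Q' k s.
Proof.
move=> AA BB QQ [u [v [Au Bv uv]]]; exists u, v; split; auto.
by apply: link_sub uv => c [/QQ].
Qed.

(** A symmetry acts by a different map at each level; compatibility with [parent] is what transports
    [is_open]. *)
Definition levelwise (g : nat -> cell -> cell) (i : site) : site :=
  (i.1, g i.1 i.2).

Lemma is_open_levelwise g k (s : config) c :
  (forall j c, parent (g j.+1 c) = g j (parent c)) ->
  is_open k (s \o levelwise g) c = is_open k s (g k c).
Proof. by move=> pg; elim: k c => //= k IH c; rewrite IH -pg. Qed.

Lemma joined_levelwise g A B Q A' B' Q' k s :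
  (forall j c, parent (g j.+1 c) = g j (parent c)) ->
  (forall a b, adj a b -> adj (g k a) (g k b)) ->
  (forall c, A k c -> A' k (g k c)) -> (forall c, B k c -> B' k (g k c)) ->
  (forall c, Q k c -> Q' k (g k c)) ->
  joined A B Q k (s \o levelwise g) -> joined A' B' Q' k s.
Proof.
move=> pg ag AA BB QQ [u [v [Au Bv uv]]].
exists (g k u), (g k v); split; auto.
apply: link_map uv; last exact: ag.
by move=> c [Qc]; rewrite is_open_levelwise // => op; split; auto.
Qed.

Definition shift dx dy j (c : cell) : cell := (N j * dx + c.1, M j * dy + c.2).

(** The reflection in the line of abscissa dx/2; the term -1 appears because a cell is named by its
    lower left corner. *)
Definition mirror dx j (c : cell) : cell := (N j * dx - 1 - c.1, c.2).

Lemma parent_shift dx dy j c :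
  parent (shift dx dy j.+1 c) = shift dx dy j (parent c).
Proof.
rewrite /parent /shift /= -!Z.mul_assoc.
by rewrite ![_ * (_ * _) + _]Z.add_comm ![_ * (_ * _)]Z.mul_comm !Z.div_add;
  try lia; congr pair; lia.
Qed.

Lemma parent_mirror dx j c :
  parent (mirror dx j.+1 c) = mirror dx j (parent c).
Proof. by rewrite /parent /mirror /= -Z.mul_assoc div_opp. Qed.

Lemma levelwise_inj g : (forall j, injective (g j)) -> injective (levelwise g).
Proof. by move=> gi [j c] [k d] [<- /gi ->]. Qed.

Lemma shift_inj dx dy : injective (levelwise (shift dx dy)).
Proof. by apply: levelwise_inj => j [x y] [x' y'] [? ?]; congr pair; lia. Qed.

Lemma mirror_inj dx : injective (levelwise (mirror dx)).
Proof. by apply: levelwise_inj => j [x y] [x' y'] [? ?]; congr pair; lia. Qed.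

Lemma shift_adj dx dy j a b : adj a b -> adj (shift dx dy j a) (shift dx dy j b).
Proof. rewrite /adj /=; lia. Qed.

Lemma mirror_adj dx j a b : adj a b -> adj (mirror dx j a) (mirror dx j b).
Proof. rewrite /adj /=; lia. Qed.

(* The corners of a box are given in unit cells, i.e., cells of level 0. *)
Definition box x0 x1 y0 y1 k (c : cell) :=
  (N k * x0 <= c.1 < N k * x1) /\ (M k * y0 <= c.2 < M k * y1).
Definition rows y0 y1 k (c : cell) := M k * y0 <= c.2 < M k * y1.
Definition left_col x k (c : cell) := c.1 = N k * x.
Definition right_col x k (c : cell) := c.1 = N k * x - 1.
Definition bottom_row y k (c : cell) := c.2 = M k * y.
Definition top_row y k (c : cell) := c.2 = M k * y - 1.

Lemma stable_box x0 x1 y0 y1 : stable (box x0 x1 y0 y1).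
Proof.
by move=> k c []; rewrite /= -!Z.mul_assoc => cx cy; split; apply: div_between.
Qed.

Lemma stable_rows y0 y1 : stable (rows y0 y1).
Proof.
by move=> k c; rewrite /rows /= -!Z.mul_assoc => cy; apply: div_between.
Qed.

Lemma stable_left x : stable (left_col x).
Proof. by move=> k c; rewrite /left_col /= -Z.mul_assoc => ->; apply: div_mulK. Qed.

Lemma stable_right x : stable (right_col x).
Proof. by move=> k c; rewrite /right_col /= -Z.mul_assoc => ->; apply: div_last. Qed.

Lemma stable_bottom y : stable (bottom_row y).
Proof. by move=> k c; rewrite /bottom_row /= -Z.mul_assoc => ->; apply: div_mulK. Qed.

Lemma stable_top y : stable (top_row y).
Proof. by move=> k c; rewrite /top_row /= -Z.mul_assoc => ->; apply: div_last. Qed.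

Lemma stable_and A B : stable A -> stable B -> stable (fun k c => A k c /\ B k c).
Proof. by move=> sA sB k c [/sA ? /sB]. Qed.

Definition above_row y k (c : cell) := M k * y <= c.2.
Definition below_row y k (c : cell) := c.2 < M k * y.

Lemma stable_above y : stable (above_row y).
Proof.
move=> k c; rewrite /above_row /= -Z.mul_assoc => cy.
by apply: Z.div_le_lower_bound.
Qed.

Lemma stable_below y : stable (below_row y).
Proof.
move=> k c; rewrite /below_row /= -Z.mul_assoc => cy.
by apply: Z.div_lt_upper_bound.
Qed.

Lemma bounded_box x0 x1 y0 y1 : bounded (box x0 x1 y0 y1).
Proof.
move=> k; exists (Z.abs (N k * x0) + Z.abs (N k * x1) +
  (Z.abs (M k * y0) + Z.abs (M k * y1))) => c [? ?]; lia.
Qed.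

Definition hcross x0 x1 y0 y1 : event_seq :=
  joined (left_col x0) (right_col x1) (box x0 x1 y0 y1).
Definition vcross x0 x1 y0 y1 : event_seq :=
  joined (bottom_row y0) (top_row y1) (box x0 x1 y0 y1).
Definition hpath x0 x1 y0 y1 a b : event_seq :=
  joined (fun k c => left_col x0 k c /\ rows a (a + 1) k c)
         (fun k c => right_col x1 k c /\ rows b (b + 1) k c) (box x0 x1 y0 y1).

(* A path inside a box on the left (resp. right) of the line of abscissa [x],
   joining the line below and above its unit segment [b]. *)
Definition larc x b r : event_seq :=
  joined (fun k c => right_col x k c /\ below_row b k c)
         (fun k c => right_col x k c /\ above_row (b + 1) k c)
         (box (x - r) x (b - r) (b + 1 + r)).
Definition rarc x b r : event_seq :=
  joined (fun k c => left_col x k c /\ below_row b k c)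
         (fun k c => left_col x k c /\ above_row (b + 1) k c)
         (box x (x + r) (b - r) (b + 1 + r)).

Lemma good_hcross x0 x1 y0 y1 : good (hcross x0 x1 y0 y1).
Proof.
apply: good_joined; [exact: stable_left|exact: stable_right|exact: stable_box|].
exact: bounded_box.
Qed.

Lemma good_vcross x0 x1 y0 y1 : good (vcross x0 x1 y0 y1).
Proof.
apply: good_joined; [exact: stable_bottom|exact: stable_top|exact: stable_box|].
exact: bounded_box.
Qed.

Lemma good_hpath x0 x1 y0 y1 a b : good (hpath x0 x1 y0 y1 a b).
Proof.
apply: good_joined; [| |exact: stable_box|exact: bounded_box].
  by apply: stable_and; [exact: stable_left|exact: stable_rows].
by apply: stable_and; [exact: stable_right|exact: stable_rows].
Qed.

Lemma good_larc x b r : good (larc x b r).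
Proof.
apply: good_joined; [| |exact: stable_box|exact: bounded_box].
  by apply: stable_and; [exact: stable_right|exact: stable_below].
by apply: stable_and; [exact: stable_right|exact: stable_above].
Qed.

Lemma good_rarc x b r : good (rarc x b r).
Proof.
apply: good_joined; [| |exact: stable_box|exact: bounded_box].
  by apply: stable_and; [exact: stable_left|exact: stable_below].
by apply: stable_and; [exact: stable_left|exact: stable_above].
Qed.

End Model.

(** * Exchange of the coordinates together with n and m *)

Section Swap.
Variables n m : Z.

Definition flip (c : cell) : cell := (c.2, c.1).

Definition iflip (i : site) : site := (i.1, flip i.2).

Lemma flipK : involutive flip. Proof. by case. Qed.

Lemma iflipK : involutive iflip. Proof. by case=> j []. Qed.

Lemma flip_adj a b : adj a b -> adj (flip a) (flip b).
Proof. by case. Qed.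

Lemma is_open_flip k s c :
  is_open n m k (s \o iflip) c = is_open m n k s (flip c).
Proof. by elim: k c => //= k IH c; rewrite IH. Qed.

Lemma vcross_flip x0 x1 y0 y1 k s :
  vcross n m x0 x1 y0 y1 k (s \o iflip) <-> hcross m n y0 y1 x0 x1 k s.
Proof.
split=> -[u [v [Au Bv uv]]]; exists (flip u), (flip v); split=> //;
  apply: link_map uv; try exact: flip_adj => //.
  by move=> a [[? ?]]; rewrite is_open_flip => op; split=> //; split.
by move=> a [[? ?] op]; split; [split|rewrite is_open_flip flipK].
Qed.

End Swap.

Lemma hcross_flip n m x0 x1 y0 y1 k s :
  hcross n m x0 x1 y0 y1 k (s \o iflip) <-> vcross m n y0 y1 x0 x1 k s.
Proof.
rewrite -vcross_flip; suff -> : (s \o iflip) \o iflip = s by [].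
by apply/funext => i; rewrite /= iflipK.
Qed.

Section Geometry.
Variables n m : Z.
Hypotheses (n2 : 2 <= n) (m2 : 2 <= m).
Local Notation N := (pw n).
Local Notation M := (pw m).

Let N0 k : 0 < N k. Proof. by apply: pw_gt0; lia. Qed.
Let M0 k : 0 < M k. Proof. by apply: pw_gt0; lia. Qed.

Lemma box_sub x0 x1 y0 y1 x0' x1' y0' y1' k c : x0' <= x0 -> x1 <= x1' ->
  y0' <= y0 -> y1 <= y1' -> box n m x0 x1 y0 y1 k c ->
  box n m x0' x1' y0' y1' k c.
Proof.
move=> h1 h2 h3 h4 [cx cy]; have Nk := N0 k; have Mk := M0 k.
by split; nia.
Qed.

Lemma vcross_sub x0 x1 y0 y1 ya yb k s : y0 <= ya -> ya < yb -> yb <= y1 ->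
  vcross n m x0 x1 y0 y1 k s -> vcross n m x0 x1 ya yb k s.
Proof.
move=> h1 h2 h3 [u [v [Au Bv uv]]]; have Mk := M0 k.
have [||| a [b [_ aE bE ab]]] := @sub_crossing _ u v (M k * ya) (M k * yb - 1) uv.
- by rewrite Au; nia.
- by nia.
- by rewrite Bv; nia.
exists a, b; split=> //; apply: link_sub ab => c [[[cx cy] op] cr].
by split=> //; split=> //; lia.
Qed.

(** Each vertical crossing contains a crossing of the strip from [ye] to [yf], and this one meets
    the horizontal crossing of the strip, which thus connects the two. *)
Lemma vcross_glue x0 x1 ya yb yc yd ye yf k s :
  ya <= yc -> yc <= ye -> ye < yf -> yf <= yb -> yb <= yd ->
  vcross n m x0 x1 ya yb k s -> vcross n m x0 x1 yc yd k s ->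
  hcross n m x0 x1 ye yf k s -> vcross n m x0 x1 ya yd k s.
Proof.
move=> h1 h2 h3 h4 h5 [u [v [Au Bv uv]]] [u' [v' [Au' Bv' uv']]].
move=> [w [z [Aw Bz wz]]]; have Mk := M0 k; have Nk := N0 k.
pose O c := box n m x0 x1 ya yd k c /\ is_open n m k s c.
have subO y1 y2 c : ya <= y1 -> y2 <= yd ->
    box n m x0 x1 y1 y2 k c /\ is_open n m k s c -> O c.
  by move=> h6 h7 [h8 h9]; split=> //; apply: box_sub h8; lia.
have meet y1 y2 a b : ya <= y1 -> y1 <= ye -> yf <= y2 -> y2 <= yd ->
    bottom_row m y1 k a -> top_row m y2 k b ->
    link (fun c => box n m x0 x1 y1 y2 k c /\ is_open n m k s c) a b ->
    link O a w.
  move=> g1 g2 g3 g4 Ga Gb ab.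
  have [||| a' [b' [aa' aE bE ab']]] :=
      @sub_crossing _ a b (M k * ye) (M k * yf - 1) ab.
  - by rewrite Ga; nia.
  - by nia.
  - by rewrite Gb; nia.
  have [||c [d [wc a'd cd]]] := cross_adj (link_reach wz) (link_reach ab').
  - by move=> c lc; have [_ [[[cx _] _] _]] := link_in lc; rewrite Aw Bz; lia.
  - by move=> c lc; have [_ [[_ cy] _]] := link_in lc; rewrite aE bE; lia.
  have aa'O : link O a a' by apply: link_sub aa' => e; exact: (@subO y1 y2 e g1 g4).
  have a'dO : link O a' d by apply: link_sub a'd => e [? _]; exact: (@subO y1 y2 e g1 g4).
  have wcO : link O w c.
    by apply: link_sub wc => e; apply: (@subO ye yf e); lia.
  apply: (link_trans aa'O); apply: (link_adj a'dO (adjC cd)).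
  exact: link_sym.
have uw : link O u w by apply: (meet ya yb u v) => //; lia.
have u'w : link O u' w by apply: (meet yc yd u' v') => //; lia.
exists u, v'; split=> //; apply: (link_trans uw); apply: (link_trans (link_sym u'w)).
by apply: link_sub uv' => e; apply: (@subO yc yd e); lia.
Qed.

End Geometry.

Section Symmetries.
Variables (R : realType) (p : R).
Hypothesis p01 : (0 <= p <= 1)%R.
Variables n m : Z.
Hypotheses (n2 : 2 <= n) (m2 : 2 <= m).
Local Notation N := (pw n).
Local Notation M := (pw m).
Let N0 k : 0 < N k. Proof. by apply: pw_gt0; lia. Qed.
Let M0 k : 0 < M k. Proof. by apply: pw_gt0; lia. Qed.

Local Notation poss := (possible p).

Lemma possible_flip x0 x1 y0 y1 :
  poss (vcross n m x0 x1 y0 y1) <-> poss (hcross m n y0 y1 x0 x1).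
Proof.
split; apply: (possible_map p01 (inv_inj iflipK)).
- exact: good_vcross.
- exact: good_hcross.
- by move=> k s; rewrite vcross_flip.
- exact: good_hcross.
- exact: good_vcross.
- by move=> k s; rewrite hcross_flip.
Qed.

Ltac shift_tac dx dy :=
  apply: (possible_map p01 (@shift_inj n m dx dy));
  [try exact: good_vcross; try exact: good_hcross; try exact: good_hpath;
     try exact: good_larc; exact: good_rarc
  |try exact: good_vcross; try exact: good_hcross; try exact: good_hpath;
     try exact: good_larc; exact: good_rarc
  |move=> k s; apply: joined_levelwise;
    [exact: parent_shift|exact: shift_adj
    | | | ] => c; have Nk := N0 k; have Mk := M0 k;
    rewrite /bottom_row /top_row /left_col /right_col /rows /box
      /below_row /above_row /shift /=; nia].

Lemma possible_hcross_shift x0 x1 y0 y1 dx dy :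
  poss (hcross n m x0 x1 y0 y1) ->
  poss (hcross n m (dx + x0) (dx + x1) (dy + y0) (dy + y1)).
Proof. shift_tac dx dy. Qed.

Lemma possible_vcross_shift x0 x1 y0 y1 dx dy :
  poss (vcross n m x0 x1 y0 y1) ->
  poss (vcross n m (dx + x0) (dx + x1) (dy + y0) (dy + y1)).
Proof. shift_tac dx dy. Qed.

Lemma possible_hpath_shift x0 x1 y0 y1 a b dx dy :
  poss (hpath n m x0 x1 y0 y1 a b) ->
  poss (hpath n m (dx + x0) (dx + x1) (dy + y0) (dy + y1) (dy + a) (dy + b)).
Proof. shift_tac dx dy. Qed.

Lemma possible_larc_shift x b r dx dy :
  poss (larc n m x b r) -> poss (larc n m (dx + x) (dy + b) r).
Proof. shift_tac dx dy. Qed.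

Lemma possible_rarc_shift x b r dx dy :
  poss (rarc n m x b r) -> poss (rarc n m (dx + x) (dy + b) r).
Proof. shift_tac dx dy. Qed.

Lemma joinedC A B Q k s : joined n m A B Q k s -> joined n m B A Q k s.
Proof. by move=> [u [v [Au Bv /link_sym vu]]]; exists v, u. Qed.

Lemma possible_hpath_mirror x0 x1 y0 y1 a b dx :
  poss (hpath n m x0 x1 y0 y1 a b) ->
  poss (hpath n m (dx - x1) (dx - x0) y0 y1 b a).
Proof.
apply: (possible_map p01 (@mirror_inj n dx)); try exact: good_hpath.
move=> k s; rewrite /hpath => /joinedC; apply: joined_levelwise;
    [exact: parent_mirror|exact: mirror_adj
    | | | ] => c; have Nk := N0 k; have Mk := M0 k;
    rewrite /left_col /right_col /rows /box /mirror /=; nia.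
Qed.

Lemma possible_larc_mirror x b r dx :
  poss (larc n m x b r) -> poss (rarc n m (dx - x) b r).
Proof.
apply: (possible_map p01 (@mirror_inj n dx)); [exact: good_larc|exact: good_rarc|].
move=> k s; apply: joined_levelwise;
    [exact: parent_mirror|exact: mirror_adj
    | | | ] => c; have Nk := N0 k; have Mk := M0 k;
    rewrite /left_col /right_col /above_row /below_row /box /mirror /=; nia.
Qed.

Lemma possible_rarc_mirror x b r dx :
  poss (rarc n m x b r) -> poss (larc n m (dx - x) b r).
Proof.
apply: (possible_map p01 (@mirror_inj n dx)); [exact: good_rarc|exact: good_larc|].
move=> k s; apply: joined_levelwise;
    [exact: parent_mirror|exact: mirror_adj
    | | | ] => c; have Nk := N0 k; have Mk := M0 k;
    rewrite /left_col /right_col /above_row /below_row /box /mirror /=; nia.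
Qed.

(** Forgetting level 1 and reading its cells as unit cells: a box w by h becomes a box nw by mh. *)
Definition next_level (i : site) : site := (i.1.+1, i.2).

Lemma next_level_inj : injective next_level.
Proof. by move=> [j c] [k d] [-> ->]. Qed.

Lemma is_open_next k (s : config) c :
  is_open n m k.+1 s c =
  is_open n m k (s \o next_level) c && s (1%N, iter k (parent n m) c).
Proof.
elim: k c => [|k IH] c; first by rewrite /= andbT.
rewrite iterSr -[LHS]/(s (k.+2, c) && is_open n m k.+1 s (parent n m c)).
by rewrite IH andbA.
Qed.

Lemma hcross_next x0 x1 y0 y1 k s : hcross n m x0 x1 y0 y1 k.+1 s ->
  hcross n m (n * x0) (n * x1) (m * y0) (m * y1) k (s \o next_level).
Proof.
move=> [u [v [Au Bv uv]]]; exists u, v; split.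
- by rewrite /left_col Au /=; lia.
- by rewrite /right_col Bv /=; lia.
- apply: link_sub uv => c [[cx cy]]; rewrite is_open_next => /andP[op _].
  by split=> //; move: cx cy; rewrite /box /=; nia.
Qed.

Lemma stable_iter (Q : nat -> cell -> Prop) k l c : stable n m Q -> Q (k + l)%N c ->
  Q l (iter k (parent n m) c).
Proof.
move=> sQ; elim: k c => [|k IH] c; first by rewrite add0n.
by rewrite addSn => /sQ /IH; rewrite iterSr.
Qed.

Lemma hcross_prev b x0 x1 y0 y1 k s :
  (forall c, box n m x0 x1 y0 y1 1 c -> Z.abs c.1 <= b /\ Z.abs c.2 <= b) ->
  all s (indices 1 b) ->
  hcross n m (n * x0) (n * x1) (m * y0) (m * y1) k (s \o next_level) ->
  hcross n m x0 x1 y0 y1 k.+1 s.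
Proof.
move=> bd sel [u [v [Au Bv uv]]]; exists u, v; split.
- by rewrite /left_col Au /=; lia.
- by rewrite /right_col Bv /=; lia.
- apply: link_sub uv => c [cb op].
  have cb' : box n m x0 x1 y0 y1 k.+1 c.
    by case: cb => cx cy; split; rewrite /= -!Z.mul_assoc ![_ * (_ k * _)]Z.mul_comm
      -!Z.mul_assoc; nia.
  split=> //; rewrite is_open_next op /=.
  have [|c1 c2] := bd (iter k (parent n m) c).
    by apply: stable_iter; [exact: stable_box|rewrite addn1].
  by apply: (allP sel); exact: mem_indices.
Qed.

Lemma pr_hcross_next x0 x1 y0 y1 k :
  (pr p (hcross n m x0 x1 y0 y1 k.+1) <=
   pr p (hcross n m (n * x0) (n * x1) (m * y0) (m * y1) k))%R.
Proof.
rewrite -(pr_map p next_level_inj (good_fin (good_hcross n2 m2 _ _ _ _) k)).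
apply: pr_le => //.
- exact/good_fin/good_hcross.
- exact/finitary_map/good_fin/good_hcross.
- by move=> s; apply: hcross_next.
Qed.

Lemma pr_hcross_scale x0 x1 y0 y1 i k :
  (pr p (hcross n m x0 x1 y0 y1 (i + k)%N) <=
   pr p (hcross n m (N i * x0) (N i * x1) (M i * y0) (M i * y1) k))%R.
Proof.
elim: i k => [|i IH] k.
  by rewrite add0n /= !Z.mul_1_l.
rewrite addSnnS; apply: le_trans (IH _) _.
by apply: le_trans (pr_hcross_next _ _ _ _ _) _; rewrite /= !Z.mul_assoc.
Qed.

Lemma possible_scale x0 x1 y0 y1 i : poss (hcross n m x0 x1 y0 y1) ->
  poss (hcross n m (N i * x0) (N i * x1) (M i * y0) (M i * y1)).
Proof.
move=> [e e0 eF]; exists e => // k; apply: le_trans (eF _) (pr_hcross_scale _ _ _ _ _ _).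
Qed.

(** The price of adding level 1 is that all its cells in the box must be selected. By FKG this costs
    at most the factor p to the number of these cells, positive since p > 0. *)
Lemma possible_unscale x0 x1 y0 y1 i : (0 < p)%R ->
  poss (hcross n m (N i * x0) (N i * x1) (M i * y0) (M i * y1)) ->
  poss (hcross n m x0 x1 y0 y1).
Proof.
move=> p0; elim: i => [|i IH].
  by rewrite /= !Z.mul_1_l.
rewrite /= -!Z.mul_assoc => -[e e0 eF]; apply: IH.
have [b bd] := @bounded_box n m (N i * x0) (N i * x1) (M i * y0) (M i * y1) 1%N.
set S := indices 1 b.
apply: (@possible_tail _ _ _ _ 1%N (p ^+ size S * e)%R) => //.
- exact: good_hcross.
- by rewrite mulr_gt0 // exprn_gt0.
case=> // k _.
have gF := good_hcross n2 m2 (n * (N i * x0)) (n * (N i * x1))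
  (m * (M i * y0)) (m * (M i * y1)).
have fF : finitary (fun s : config => hcross n m (n * (N i * x0)) (n * (N i * x1))
    (m * (M i * y0)) (m * (M i * y1)) k (s \o next_level)).
  exact/finitary_map/good_fin.
apply: (@le_trans _ _ (pr p (fun s : config => all s S /\ hcross n m
  (n * (N i * x0)) (n * (N i * x1)) (m * (M i * y0)) (m * (M i * y1)) k
  (s \o next_level)))).
  apply: le_trans (pr_fkg p01 (finitary_all S) fF _ _).
  - apply: ler_pM; [by rewrite exprn_ge0 // ltW|exact: ltW|exact: pr_all|].
    by rewrite pr_map //; [exact: next_level_inj|exact: good_fin].
  - by move=> s s' ss; apply: sub_all.
  - by move=> s s' ss; apply: (good_inc gF) => j; exact: ss.
apply: pr_le => //.
- by apply: finitary_and => //; exact: finitary_all.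
- exact/good_fin/good_hcross.
- by move=> s [sel]; apply: (hcross_prev bd).
Qed.

End Symmetries.

(** * Prolonging horizontal crossings *)

Section Extension.
Variables n m : Z.
Hypotheses (n2 : 2 <= n) (m2 : 2 <= m).
Local Notation N := (pw n).
Local Notation M := (pw m).
Let N0 k : 0 < N k. Proof. by apply: pw_gt0; lia. Qed.
Let M0 k : 0 < M k. Proof. by apply: pw_gt0; lia. Qed.

Lemma hcross_sub x0 x1 y0 y1 xa xb k s : x0 <= xa -> xa < xb -> xb <= x1 ->
  hcross n m x0 x1 y0 y1 k s -> hcross n m xa xb y0 y1 k s.
Proof.
move=> h1 h2 h3; rewrite -2!vcross_flip.
by apply: vcross_sub.
Qed.

Lemma hcross_tall x0 x1 y0 y1 ya yb k s : ya <= y0 -> y1 <= yb ->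
  hcross n m x0 x1 y0 y1 k s -> hcross n m x0 x1 ya yb k s.
Proof.
move=> h1 h2; apply: joined_sub => // c; apply: box_sub; lia.
Qed.

Local Notation cells k s x0 x1 y0 y1 :=
  (fun c => box n m x0 x1 y0 y1 k c /\ is_open n m k s c).

Lemma cells_sub k s x0 x1 y0 y1 X0 X1 Y0 Y1 c : X0 <= x0 -> x1 <= X1 ->
  Y0 <= y0 -> y1 <= Y1 -> cells k s x0 x1 y0 y1 c -> cells k s X0 X1 Y0 Y1 c.
Proof. by move=> h1 h2 h3 h4 [h5 h6]; split=> //; apply: box_sub h5. Qed.

Lemma link_meet O Q P u v s t a b : (forall c, O c -> P c) -> (forall c, Q c -> P c) ->
  link O u v -> link Q s t -> link O u a -> link Q s b -> adj a b -> link P u s.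
Proof.
move=> OP QP uv st ua sb ab; apply: (link_adj (link_sub OP ua) ab).
by apply: link_sym; apply: link_sub sb.
Qed.

(** The end [v] of the path lies on the line between the ends [c] and [d] of the arc, so [tip_arc]
    applies. The link is stated in a large box so that several such links can be concatenated. *)
Lemma join_larc k s x0 x1 y0 y1 b r X0 X1 Y0 Y1 u v c d :
  x0 <= x1 - r -> 0 <= r ->
  X0 <= x0 -> x1 <= X1 -> Y0 <= y0 -> y1 <= Y1 -> Y0 <= b - r -> b + 1 + r <= Y1 ->
  left_col n x0 k u -> right_col n x1 k v -> rows m b (b + 1) k v ->
  link (cells k s x0 x1 y0 y1) u v ->
  right_col n x1 k c -> below_row m b k c ->
  right_col n x1 k d -> above_row m (b + 1) k d ->
  link (cells k s (x1 - r) x1 (b - r) (b + 1 + r)) c d ->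
  link (cells k s X0 X1 Y0 Y1) u c.
Proof.
move=> xr r0 h1 h2 h3 h4 h5 h6 Lu Rv [v1 v2] uv Rc Bc Rd Ad cd.
have Nk := N0 k; have Mk := M0 k.
have [|||||||a [e [ua ce ae]]] :=
  @tip_arc _ _ _ _ _ _ (N k * x0) (link_reach uv) (link_reach cd).
- by move=> a ua; have [_ [[ax _] _]] := link_in ua; rewrite Rv; lia.
- exact: Lu.
- move=> a ua; have [_ [[ax _] _]] := link_in ua; rewrite Rv; nia.
- by rewrite Rc Rv.
- by rewrite Rd Rv.
- by move: Bc Ad; rewrite /below_row /above_row; lia.
- exists (Z.abs (M k * Y0) + Z.abs (M k * Y1)) => a [] ua;
  have [_ [[_ ax] _]] := link_in ua; nia.
apply: (link_meet _ _ uv cd ua ce ae) => e'; apply: cells_sub; lia.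
Qed.

Lemma join_rarc k s x0 x1 y0 y1 b r X0 X1 Y0 Y1 u v c d :
  x0 + r <= x1 -> 0 <= r ->
  X0 <= x0 -> x1 <= X1 -> Y0 <= y0 -> y1 <= Y1 -> Y0 <= b - r -> b + 1 + r <= Y1 ->
  left_col n x0 k u -> right_col n x1 k v -> rows m b (b + 1) k u ->
  link (cells k s x0 x1 y0 y1) u v ->
  left_col n x0 k c -> below_row m b k c ->
  left_col n x0 k d -> above_row m (b + 1) k d ->
  link (cells k s x0 (x0 + r) (b - r) (b + 1 + r)) c d ->
  link (cells k s X0 X1 Y0 Y1) u c.
Proof.
move=> xr r0 h1 h2 h3 h4 h5 h6 Lu Rv [v1 v2] uv Rc Bc Rd Ad cd.
have Nk := N0 k; have Mk := M0 k.
have [|||||||a [e [ua ce ae]]] :=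
  @tip_arc_left _ _ _ _ _ _ (N k * x1 - 1) (link_reach uv) (link_reach cd).
- by move=> a ua; have [_ [[ax _] _]] := link_in ua; rewrite Lu; lia.
- exact: Rv.
- move=> a ua; have [_ [[ax _] _]] := link_in ua; rewrite Lu; nia.
- by rewrite Rc Lu.
- by rewrite Rd Lu.
- by move: Bc Ad; rewrite /below_row /above_row; lia.
- exists (Z.abs (M k * Y0) + Z.abs (M k * Y1)) => a [] ua;
  have [_ [[_ ax] _]] := link_in ua; nia.
apply: (link_meet _ _ uv cd ua ce ae) => e'; apply: cells_sub; lia.
Qed.

(* A path ending in the unit row [b2] of the line [x = w0] is attached, through
   an arc, a path crossing [0, w0] and a second arc, to a path starting in the
   unit row [a0] of the line [x = 0]. *)
Lemma hcross_extend k s r w0 w2 x y0 y1 y2 y3 y4 y5 a0 a2 b2 b4 Y0 Y1 :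
  0 <= r <= w0 -> w0 <= w2 -> x <= 0 ->
  hpath n m x w0 y0 y1 a2 b2 k s -> x <= w0 - r -> larc n m w0 b2 r k s ->
  hpath n m 0 w0 y2 y3 a0 b2 k s -> rarc n m 0 a0 r k s ->
  hpath n m 0 w2 y4 y5 a0 b4 k s ->
  Y0 <= y0 /\ Y0 <= y2 /\ Y0 <= y4 /\ Y0 <= b2 - r /\ Y0 <= a0 - r ->
  y1 <= Y1 /\ y3 <= Y1 /\ y5 <= Y1 /\ b2 + 1 + r <= Y1 /\ a0 + 1 + r <= Y1 ->
  hcross n m x w2 Y0 Y1 k s.
Proof.
move=> r0 w02 x_0 [u [v [[Lu Ru] [Rv RRv] uv]]] xr [c [d [[Rc Bc] [Rd Ad] cd]]].
move=> [u' [v' [[Lu' Ru'] [Rv' RRv'] uv']]] [c' [d' [[Lc Bc'] [Ld Ad'] cd']]].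
move=> [u'' [v'' [[Lu'' Ru''] [Rv'' RRv''] uv'']]] lo hi.
exists u, v''; split=> //.
have uc : link (cells k s x w2 Y0 Y1) u c.
  by apply: (join_larc _ _ _ _ _ _ _ _ Lu Rv RRv uv Rc Bc Rd Ad cd); lia.
have u'c : link (cells k s x w2 Y0 Y1) u' c.
  by apply: (join_larc _ _ _ _ _ _ _ _ Lu' Rv' RRv' uv' Rc Bc Rd Ad cd); lia.
have u'c' : link (cells k s x w2 Y0 Y1) u' c'.
  by apply: (join_rarc _ _ _ _ _ _ _ _ Lu' Rv' Ru' uv' Lc Bc' Ld Ad' cd'); lia.
have u''c' : link (cells k s x w2 Y0 Y1) u'' c'.
  by apply: (join_rarc _ _ _ _ _ _ _ _ Lu'' Rv'' Ru'' uv'' Lc Bc' Ld Ad' cd'); lia.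
apply: (link_trans uc); apply: (link_trans (link_sym u'c)).
apply: (link_trans u'c'); apply: (link_trans (link_sym u''c')).
by apply: link_sub uv'' => e; apply: cells_sub; lia.
Qed.

Section Possibility.
Variables (R : realType) (p : R).
Hypothesis p01 : (0 <= p <= 1)%R.
Local Notation poss := (possible p).

(** Since h' < h, the strip from 1 to 1 + h' lies in both the box and its translate by one unit
    upwards. *)
Lemma possible_vcross_glue w h h' : 0 < h' < h ->
  poss (vcross n m 0 w 0 h) -> poss (hcross n m 0 w 0 h') ->
  poss (vcross n m 0 w 0 (h + 1)).
Proof.
move=> hh Vh Hh.
have Vh1 := possible_vcross_shift p01 n2 m2 0 1 Vh.
have Hh1 := possible_hcross_shift p01 n2 m2 0 1 Hh.
have gV y0 y1 := good_vcross n2 m2 0 w y0 y1.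
have gV' y0 y1 := good_vcross n2 m2 (0 + 0) (0 + w) y0 y1.
have gH' y0 y1 := good_hcross n2 m2 (0 + 0) (0 + w) y0 y1.
have := possible_and p01 (gV _ _) (good_and (gV' _ _) (gH' _ _)) Vh
  (possible_and p01 (gV' _ _) (gH' _ _) Vh1 Hh1).
apply: possible_le => //; first by apply: good_and => //; apply: good_and.
move=> k s [v0 [v1 h1]]; rewrite !Z.add_0_l in v1 h1.
by rewrite Z.add_comm; apply: (vcross_glue n2 m2 _ _ _ _ _ v0 v1 h1); lia.
Qed.

Lemma possible_tall w h h' j : 0 < h' < h ->
  poss (vcross n m 0 w 0 h) -> poss (hcross n m 0 w 0 h') ->
  poss (vcross n m 0 w 0 (h + Z.of_nat j)).
Proof.
move=> hh Vh Hh; elim: j => [|j IH]; first by rewrite Z.add_0_r.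
rewrite (_ : h + _ = h + Z.of_nat j + 1); last lia.
by apply: possible_vcross_glue Hh => //; lia.
Qed.

(** There are finitely many pairs of unit rows for the two ends, so one of them is possible. *)
Lemma possible_hpath w h : 0 <= h -> poss (hcross n m 0 w 0 h) ->
  exists a b, [/\ 0 <= a < h, 0 <= b < h & poss (hpath n m 0 w 0 h a b)].
Proof.
move=> h0 Hh; set H := Z.to_nat h.
pose F i : event_seq := fun k s => exists2 j, (j < H)%N &
  hpath n m 0 w 0 h (Z.of_nat i) (Z.of_nat j) k s.
have gF i : good (F i) by apply: good_ex => j; exact: good_hpath.
have [|i iH Fi] := @possible_ex _ _ p01 F H gF.
  apply: possible_le Hh => //; [exact: good_hcross|exact: good_ex|].
  move=> k s [u [v [Lu Rv uv]]]; have Mk := M0 k.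
  have [[[_ u2] _] [[_ v2] _]] := link_in uv.
  have row (c : cell) : M k * 0 <= c.2 < M k * h -> exists2 i, (i < H)%N &
      rows m (Z.of_nat i) (Z.of_nat i + 1) k c.
    move=> [c1 c2]; exists (Z.to_nat (c.2 / M k)).
      have := Z.div_pos c.2 (M k); have := Z.div_lt_upper_bound c.2 (M k) h Mk c2.
      rewrite /H; lia.
    have c0 : 0 <= c.2 / M k by apply: Z.div_pos; lia.
    have := Z.div_mod c.2 (M k); have := Z.mod_pos_bound c.2 (M k) Mk.
    by rewrite /rows Z2Nat.id //; nia.
  have [i iH ui] := row _ u2; have [j jH vj] := row _ v2.
  by exists i => //; exists j => //; exists u, v.
have [|j jH pij] := possible_ex p01 _ Fi; first by move=> j; exact: good_hpath.
by exists (Z.of_nat i), (Z.of_nat j); split=> //; rewrite /H in iH jH; lia.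
Qed.

(** The result spans 2 w2 - w0 columns, of which w2 + 1 are kept. The point is that the added height
    depends on [h0] and [r] only, and not on [h2]: iteration costs a height linear in the width. *)
Lemma possible_extend r w0 h0 w2 h2 : 0 <= r <= w0 -> w0 < w2 -> 0 <= h0 -> 0 <= h2 ->
  poss (larc n m 0 0 r) -> poss (hcross n m 0 w0 0 h0) ->
  poss (hcross n m 0 w2 0 h2) ->
  poss (hcross n m 0 (w2 + 1) 0 (h2 + 2 * (h0 + r + 1))).
Proof.
move=> r0 w02 h0' h2' L H0 H2.
have [a0 [b0 [a00 b00 P0]]] := possible_hpath h0' H0.
have [a2 [b2 [a20 b20 P2]]] := possible_hpath h2' H2.
(* Vertical shifts that bring the right end of the short path to the row [b2] and, after reflection,
   the long path to the row a0 + t where the short one starts. Both exceed -h0, whence the lower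
   bound of the box below. *)
pose t := b2 - b0; pose t' := a0 - b0.
have Q1 := possible_hpath_shift p01 n2 m2 (w0 - w2) 0 P2.
have Q2 := possible_larc_shift p01 n2 m2 w0 b2 L.
have Q3 := possible_hpath_shift p01 n2 m2 0 t P0.
have Q4 := possible_rarc_shift p01 n2 m2 0 (a0 + t) (possible_larc_mirror p01 n2 m2 0 L).
have Q5 := possible_hpath_shift p01 n2 m2 0 t' (possible_hpath_mirror p01 n2 m2 w2 P2).
have g1 := good_hpath n2 m2; have g2 := good_larc n2 m2; have g3 := good_rarc n2 m2.
have := possible_and p01 (g1 _ _ _ _ _ _) (good_and (g2 _ _ _)
  (good_and (g1 _ _ _ _ _ _) (good_and (g3 _ _ _) (g1 _ _ _ _ _ _)))) Q1
  (possible_and p01 (g2 _ _ _) (good_and (g1 _ _ _ _ _ _) (good_and (g3 _ _ _)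
     (g1 _ _ _ _ _ _))) Q2
  (possible_and p01 (g1 _ _ _ _ _ _) (good_and (g3 _ _ _) (g1 _ _ _ _ _ _)) Q3
  (possible_and p01 (g3 _ _ _) (g1 _ _ _ _ _ _) Q4 Q5))).
move=> Q.
have : poss (hcross n m (w0 - w2) w2 (- (h0 + r)) (h2 + h0 + r + 1)).
  apply: possible_le Q => //; first by do 4! apply: good_and => //.
    exact: good_hcross.
  move=> k s [q1 [q2 [q3 [q4 q5]]]].
  have E1 : w0 - w2 + 0 = w0 - w2 by lia.
  have E2 : w0 - w2 + w2 = w0 by lia.
  have E3 : w2 - w2 = 0 by lia.
  have E4 : t + b0 = b2 by rewrite /t; lia.
  have E5 : t' + b2 = a0 + t by rewrite /t' /t; lia.
  have E6 : t + a0 = a0 + t by lia.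
  rewrite ?E1 ?E2 ?E3 ?E4 ?E5 ?E6 ?Z.add_0_l ?Z.add_0_r ?Z.sub_0_r in q1 q2 q3 q4 q5.
  apply: (hcross_extend _ _ _ q1 _ q2 q3 q4 q5); rewrite /t' /t; lia.
move=> /(possible_hcross_shift p01 n2 m2 (w2 - w0) (h0 + r)).
apply: possible_le => //; try exact: good_hcross.
move=> k s /(@hcross_sub _ _ _ _ 0 (w2 + 1)) h.
by apply: hcross_tall (h _ _ _); lia.
Qed.

Lemma possible_linear r w0 h0 w1 h1 : 0 <= r <= w0 -> w0 < w1 -> 0 <= h0 -> 0 <= h1 ->
  poss (larc n m 0 0 r) -> poss (hcross n m 0 w0 0 h0) ->
  poss (hcross n m 0 w1 0 h1) ->
  exists2 c, 0 <= c & forall j,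
    poss (hcross n m 0 (w1 + Z.of_nat j) 0 (h1 + c * Z.of_nat j)).
Proof.
move=> r0 w01 h0' h1' L H0 H1; exists (2 * (h0 + r + 1)); first lia.
elim=> [|j IH]; first by rewrite Z.mul_0_r !Z.add_0_r.
have := possible_extend r0 _ h0' _ L H0 IH.
rewrite (_ : w1 + Z.of_nat j + 1 = w1 + Z.of_nat j.+1); last lia.
rewrite (_ : h1 + _ + _ = h1 + 2 * (h0 + r + 1) * Z.of_nat j.+1); last first.
  by rewrite Nat2Z.inj_succ; lia.
by apply; nia.
Qed.

End Possibility.
End Extension.

(** * Confined crossings are unlikely *)

Local Close Scope Z_scope.

Lemma expr_small (R : realType) (r e : R) : 0 <= r < 1 -> 0 < e ->
  exists k, r ^+ k <= e.
Proof.
move=> /andP[r0 r1] e0.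
have /cvgr0Pnorm_le : ((fun k : nat => r ^+ k) @ \oo --> (0 : R))%classic.
  by apply: cvg_expr; rewrite ger0_norm.
move=> /(_ _ e0) [k _ /(_ k (leqnn k))] /= h; exists k.
by rewrite ger0_norm ?exprn_ge0 in h.
Qed.

Lemma half_pow_small (R : realType) (A e : R) : 0 < e ->
  exists j0, forall j, (j0 <= j)%N -> A * 2^-1 ^+ j <= e.
Proof.
move=> e0; exists (Num.bound `|A / e|) => j jb.
have Aj : A / e <= 2 ^+ j.
  apply: (@le_trans _ _ j%:R); last first.
    by rewrite -natrX ler_nat ltnW // ltn_expl.
  apply: (@le_trans _ _ (Num.bound `|A / e|)%:R); last by rewrite ler_nat.
  exact: le_trans (ler_norm _) (ltW (archi_boundP (normr_ge0 _))).
rewrite exprVn ler_pdivrMr ?exprn_gt0 //.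
by move: Aj; rewrite ler_pdivrMr // mulrC.
Qed.

Lemma double_exp_small (R : realType) (n m : nat) (r e : R) :
  (2 <= n)%N -> 0 <= r < 1 -> 0 < e ->
  exists l, (m ^ l)%:R * r ^+ (n ^ l) <= e.
Proof.
move=> n2 r01 e0; have /andP[r0 r1] := r01.
have [C mC] : exists C, m%:R * r ^+ C <= 2^-1.
  have [|C rC] := @expr_small _ r (2^-1 / m.+1%:R) r01; first by rewrite divr_gt0.
  exists C; apply: (@le_trans _ _ (m.+1%:R * r ^+ C)).
    by rewrite ler_wpM2r ?exprn_ge0 // ler_nat.
  by move: rC; rewrite ler_pdivlMr // mulrC.
have [j0 je] := half_pow_small 1 e0.
(* With l = 2j and j at least 2C one gets C l = 2Cj <= j^2 <= 2^j 2^j = 2^l <= n^l. *)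
pose j := (maxn j0 (2 * C)).+1; pose l := (j + j)%N.
have jC : (2 * C <= j)%N by rewrite leqW // leq_maxr.
have jj0 : (j0 <= j)%N by rewrite leqW // leq_maxl.
have nC : (C * l <= n ^ l)%N.
  apply: (@leq_trans (2 ^ l)); last by rewrite leq_exp2r // /l addSn.
  have := ltn_expl j (ltnSn 1); rewrite /l expnD => j2.
  by apply: (@leq_trans (j * j)); [nia|apply: leq_mul; exact: ltnW].
exists l; apply: (@le_trans _ _ ((m ^ l)%:R * r ^+ (C * l))).
  by rewrite ler_wpM2l // ler_wiXn2l // ltW.
rewrite natrX exprM -exprMn.
apply: (@le_trans _ _ (2^-1 ^+ l)).
  by rewrite lerXn2r // nnegrE ?mulr_ge0 ?exprn_ge0 // invr_ge0.
have := je l; rewrite mul1r; apply.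
by rewrite /l (leq_trans jj0) // leq_addr.
Qed.

(** Bernoulli's inequality bounds the ratio of powers below by a linear factor only; its square is
    quadratic and beats the given linear factor, hence the even exponents. *)
Lemma power_gap (n m A B : nat) : (0 < n < m)%N ->
  exists j0, forall j, (j0 <= j)%N -> ((A * (2 * j) + B) * n ^ (2 * j) <= m ^ (2 * j))%N.
Proof.
move=> /andP[n0 nm].
have bern j : ((n + j) * n ^ j <= n * n.+1 ^ j)%N.
  elim: j => [|j IH]; first by rewrite addn0.
  rewrite !expnS; move: IH; move: (n ^ j)%N (n.+1 ^ j)%N => x y IH; nia.
exists (2 * A * n ^ 2 + B * n ^ 2).+1 => j jb.
have nn : (n ^ 2 * ((A * (2 * j) + B) * n ^ (2 * j)) <= n ^ 2 * n.+1 ^ (2 * j))%N.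
  apply: (@leq_trans ((n + j) ^ 2 * n ^ (2 * j))).
    rewrite mulnA leq_mul2r; apply/orP; right.
    by move: jb; rewrite -!mulnn; nia.
  rewrite !(mulnC 2) !expnM -!expnMn leq_exp2r //; exact: bern.
rewrite leq_pmul2l ?expn_gt0 ?n0 // in nn.
by apply: (leq_trans nn); rewrite leq_exp2r //; lia.
Qed.

Local Open Scope Z_scope.

Lemma pw_nat n k : pw (Z.of_nat n) k = Z.of_nat (n ^ k).
Proof. by elim: k => //= k ->; rewrite expnS Nat2Z.inj_mul. Qed.

Section Confinement.
Variables n m : Z.
Hypotheses (n2 : 2 <= n) (m2 : 2 <= m).
Local Notation N := (pw n).
Local Notation M := (pw m).
Let N0 k : 0 < N k. Proof. by apply: pw_gt0; lia. Qed.
Let M0 k : 0 < M k. Proof. by apply: pw_gt0; lia. Qed.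

Lemma is_open_iter k j s c : is_open n m (k + j) s c ->
  is_open n m j s (iter k (parent n m) c).
Proof.
elim: k c => [|k IH] c //; rewrite addSn /= => /andP[_ /IH].
by rewrite -iterSr.
Qed.

Definition first_sites x w y h : seq site :=
  [seq (1%N, c) | c <- [seq (n * x + Z.of_nat i, m * y + Z.of_nat j) |
     i <- iota 0 (Z.to_nat (n * w)), j <- iota 0 (Z.to_nat (m * h))]].

Lemma size_first_sites x w y h :
  size (first_sites x w y h) = (Z.to_nat (n * w) * Z.to_nat (m * h))%N.
Proof. by rewrite size_map size_allpairs !size_iota. Qed.

Lemma mem_first_sites x w y h j c :
  ((j, c) \in first_sites x w y h) <-> j = 1%N /\ box n m x (x + w) y (y + h) 1 c.
Proof.
split.
  move=> /mapP[c' /allpairsP[[i k] /= [ii kk ->]] [-> ->]]; split=> //.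
  by move: ii kk; rewrite !mem_iota /box /= !Z.mul_1_r; lia.
move=> [-> [[x1 x2] [y1 y2]]]; apply/mapP; exists c => //; apply/allpairsP.
exists (Z.to_nat (c.1 - n * x), Z.to_nat (c.2 - m * y)).
move: x1 x2 y1 y2; rewrite /= !Z.mul_1_r => x1 x2 y1 y2.
by rewrite !mem_iota; split; try lia; case: c x1 x2 y1 y2 => /= *; congr pair; lia.
Qed.

(** Finitely many sites of level 1 suffice to close a whole box at every deeper level; this makes
    the bounds uniform in the level. *)
Lemma open_first_sites k s c x w y h : box n m x (x + w) y (y + h) k.+1 c ->
  is_open n m k.+1 s c -> has s (first_sites x w y h).
Proof.
rewrite -addn1 => cb /is_open_iter; rewrite /= andbT => op.
apply/hasP; exists (1%N, iter k (parent n m) c) => //.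
apply/mem_first_sites; split=> //.
by apply: stable_iter cb; exact: stable_box.
Qed.

(** If the path gets more than K rows away from the row [b] of its start, it crosses K full rows
    vertically. Otherwise it has an open cell in each column within the 2K + 1 rows around [b]. *)
Lemma hcross_confined W Ht K k s : 0 < K ->
  hcross n m 0 (Z.of_nat W) 0 (Z.of_nat Ht) k.+1 s ->
  (exists2 b, (b < Ht)%N & vcross n m 0 (Z.of_nat W) (Z.of_nat b) (Z.of_nat b + K) k.+1 s) \/
  (exists2 b, (b < Ht)%N & forall a, (a < W)%N ->
     has s (first_sites (Z.of_nat a) 1 (Z.of_nat b - K) (2 * K + 1))).
Proof.
move=> K0 [u [v [Lu Rv uv]]]; have Nk := N0 k.+1; have Mk := M0 k.+1.
set O := (fun c => _) in uv.
have OH c : O c -> exists2 b, (b < Ht)%N & rows m (Z.of_nat b) (Z.of_nat b + 1) k.+1 c.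
  move=> [[_ [c1 c2]] _]; have c0 : 0 <= c.2 / M k.+1 by apply: Z.div_pos; lia.
  have cH := Z.div_lt_upper_bound c.2 (M k.+1) (Z.of_nat Ht) Mk c2.
  exists (Z.to_nat (c.2 / M k.+1)); first lia.
  have := Z.div_mod c.2 (M k.+1); have := Z.mod_pos_bound c.2 (M k.+1) Mk.
  by rewrite /rows Z2Nat.id //; nia.
have up x y b b' : link O x y -> rows m (Z.of_nat b) (Z.of_nat b + 1) k.+1 x ->
    rows m (Z.of_nat b') (Z.of_nat b' + 1) k.+1 y -> Z.of_nat b + K < Z.of_nat b' ->
    vcross n m 0 (Z.of_nat W) (Z.of_nat b.+1) (Z.of_nat b.+1 + K) k.+1 s.
  move=> xy [_ x2] [y1 _] bb.
  have [||| p [q [_ pE qE pq]]] := @sub_crossing _ x y (M k.+1 * Z.of_nat b.+1)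
    (M k.+1 * (Z.of_nat b.+1 + K) - 1) xy.
  - by rewrite Nat2Z.inj_succ; lia.
  - by nia.
  - by rewrite Nat2Z.inj_succ; nia.
  exists p, q; split=> //; apply: link_sub pq => c [[[cx cy] op] cr].
  by split=> //; split=> //; lia.
have [b bH ub] := OH u (proj1 (link_in uv)).
have [far|near] := EM (exists c b', [/\ link O u c,
    rows m (Z.of_nat b') (Z.of_nat b' + 1) k.+1 c, (b' < Ht)%N &
    K < Z.abs (Z.of_nat b - Z.of_nat b')]).
  left; case: far => c [b' [uc cb' b'H far]].
  have [h|h] : Z.of_nat b + K < Z.of_nat b' \/ Z.of_nat b' + K < Z.of_nat b by lia.
    by exists b.+1; [lia|exact: up uc ub cb' h].
  by exists b'.+1; [lia|exact: up (link_sym uc) cb' ub h].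
right; exists b => // a aW.
have [|c uc cE] := sub_column (x := N k.+1 * Z.of_nat a) uv.
  by rewrite Lu Rv; nia.
have [_ [cb op]] := link_in uc; apply: open_first_sites op.
have [b' b'H cb'] := OH c (proj2 (link_in uc)).
have bb : Z.abs (Z.of_nat b - Z.of_nat b') <= K.
  have [//|h] : Z.abs (Z.of_nat b - Z.of_nat b') <= K \/
    K < Z.abs (Z.of_nat b - Z.of_nat b') by lia.
  by case: near; exists c, b'.
by move: cb'; rewrite /box /rows cE; nia.
Qed.

Section Probability.
Variables (R : realType) (p : R).
Hypothesis p01 : (0 <= p < 1)%R.
Let p01' : (0 <= p <= 1)%R. Proof. by case/andP: p01 => -> /ltW. Qed.
Local Notation poss := (possible p).

Lemma pr_ex_le (I : eqType) (F : nat -> (I -> bool) -> Prop) k (d : R) :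
  (forall i, finitary (F i)) -> (forall i, (i < k)%N -> (pr p (F i) <= d)%R) ->
  (pr p (fun s => exists2 i, (i < k)%N & F i s) <= k%:R * d)%R.
Proof.
move=> fF; elim: k => [|k IH] Fd.
  rewrite (@pr_ext _ _ _ _ (fun=> False)); last by move=> s; split=> // -[].
  by rewrite pr_cst // asboolF // mul0r.
have h : (pr p (fun s => exists2 i, (i < k.+1)%N & F i s) <=
    pr p (fun s => F k s \/ exists2 i, (i < k)%N & F i s))%R.
  apply: pr_le => //; first exact: finitary_ex.
    by apply: finitary_or => //; exact: finitary_ex.
  move=> s [i]; rewrite ltnS leq_eqVlt => /orP[/eqP->|ik] Fi; first by left.
  by right; exists i.
apply: (le_trans h); apply: (le_trans (pr_or p01' _ _)) => //; first exact: finitary_ex.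
rewrite -natr1 mulrDl mul1r addrC lerD //; last exact: Fd.
by apply: IH => i ik; apply: Fd; exact: ltnW.
Qed.

(** The probability that a box of w by h unit cells has at least one selected cell of level 1, i.e.,
    that it is not closed at once. *)
Definition miss_bound w h : R :=
  (1 - (1 - p) ^+ (Z.to_nat (n * w) * Z.to_nat (m * h)))%R.

Lemma miss_bound01 w h : (0 <= miss_bound w h < 1)%R.
Proof.
have /andP[p0 p1] := p01; have q0 : (0 < 1 - p)%R by rewrite subr_gt0.
rewrite /miss_bound subr_ge0 exprn_ile1 ?gerBl ?(ltW q0) //=.
by rewrite ltrBlDr ltrDl exprn_gt0.
Qed.

Lemma finitary_forall (I : eqType) (S : nat -> seq I) W :
  finitary (fun s : I -> bool => forall a, (a < W)%N -> has s (S a)).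
Proof.
elim: W => [|W IH].
  rewrite (_ : (fun s => _) = fun=> True); first exact: finitary_cst.
  by apply/funext => s; apply/propext.
rewrite (_ : (fun s => _) = fun s => has s (S W) /\ forall a, (a < W)%N -> has s (S a)).
  by apply: finitary_and => //; exact: finitary_has.
apply/funext => s; apply/propext; split=> [h|[h1 h2] a].
  by split=> [|a aW]; apply: h => //; exact: ltnW.
by rewrite ltnS leq_eqVlt => /orP[/eqP->|/h2].
Qed.

Lemma pr_columns W y h :
  (pr p (fun s : config => forall a, (a < W)%N -> has s (first_sites (Z.of_nat a) 1 y h))
   <= miss_bound 1 h ^+ W)%R.
Proof.
apply: pr_blocks => // [a _|a b [j c] _ _]; first by rewrite size_first_sites.
by move=> /mem_first_sites[_ [ca _]] /mem_first_sites[_ [cb _]]; move: ca cb => /=; nia.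
Qed.

(** At scale l there are m^l starting rows, and staying confined around one of them has probability
    at most r^(n^l) for some r < 1. By [double_exp_small] a suitable l makes the sum at most e/2, so
    the other alternative keeps probability e/2. *)
Lemma possible_vcross_wide K : 0 < K -> poss (hcross n m 0 1 0 1) ->
  exists l, poss (vcross n m 0 (N l) 0 K).
Proof.
move=> K0 [e e0 eF].
have := @double_exp_small R (Z.to_nat n) (Z.to_nat m) _ (e / 2) _
  (miss_bound01 1 (2 * K + 1)) _.
case=> [||l el]; [lia|by rewrite divr_gt0|exists l].
set W := (Z.to_nat n ^ l)%N in el *; set Ht := (Z.to_nat m ^ l)%N in el *.
have NW : N l = Z.of_nat W by rewrite -pw_nat Z2Nat.id; lia.
have MH : M l = Z.of_nat Ht by rewrite -pw_nat Z2Nat.id; lia.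
have gV b := good_vcross n2 m2 0 (Z.of_nat W) (Z.of_nat b) (Z.of_nat b + K).
have [b bH Vb] : exists2 b, (b < Ht)%N &
    poss (vcross n m 0 (Z.of_nat W) (Z.of_nat b) (Z.of_nat b + K)).
  apply: possible_ex => //.
  apply: (@possible_tail _ _ p01' _ 1%N (e / 2)%R); first exact: good_ex.
    by rewrite divr_gt0.
  case=> // k _.
  have := eF (l + k.+1)%N => ek.
  have := le_trans ek (pr_hcross_scale p01' n2 m2 _ _ _ _ _ _).
  rewrite !Z.mul_0_r !Z.mul_1_r NW MH => hk.
  pose G b (s : config) := forall a, (a < W)%N ->
     has s (first_sites (Z.of_nat a) 1 (Z.of_nat b - K) (2 * K + 1)).
  have fG b : finitary (G b) by exact: finitary_forall.
  have fV b := good_fin (gV b) k.+1.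
  have : (e <= pr p (fun s => (exists2 b, (b < Ht)%N &
      vcross n m 0 (Z.of_nat W) (Z.of_nat b) (Z.of_nat b + K) k.+1 s) \/
      exists2 b, (b < Ht)%N & G b s))%R.
    apply: (le_trans hk); apply: pr_le => //.
    - exact/good_fin/good_hcross.
    - by apply: finitary_or; exact: finitary_ex.
    - by move=> s; apply: hcross_confined.
  have := pr_or p01' (finitary_ex Ht fV) (finitary_ex Ht fG).
  have := pr_ex_le fG (fun b _ => pr_columns W (Z.of_nat b - K) (2 * K + 1)).
  by move=> /(_ Ht); lra.
have := possible_vcross_shift p01' n2 m2 0 (- Z.of_nat b) Vb.
by rewrite NW Z.add_0_l Z.add_opp_diag_l (_ : - _ + _ = K) //; lia.
Qed.

End Probability.
End Confinement.

(** * Arcs around a unit segment *)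

Lemma column_or_exit (O : cell -> Prop) (f : cell -> Z) u v : link O u v ->
  link (fun c => O c /\ f c = f u) u v \/
  exists x y, [/\ link O u x, adj x y, O y & f x <> f y].
Proof.
elim=> [Ou|x y ux [IH|IH] xy Oy]; [by left; apply: link0| |by right].
have [fxy|fxy] := Z.eq_dec (f x) (f y).
  left; apply: (link_step IH xy); split=> //.
  by rewrite -fxy; have [_ []] := link_in IH.
by right; exists x, y.
Qed.

(** The path goes from below to above without touching the line at heights from [lo] to [hi]. The
    part between two consecutive visits of the line during which it first passes this gap stays on
    one side, as a king path cannot change sides without a visit. *)
Lemma excursion (O : cell -> Prop) a lo hi u v : lo < hi -> link O u v ->
  a - 1 <= u.1 <= a -> u.2 < lo -> a - 1 <= v.1 <= a -> hi <= v.2 ->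
  (forall c, link O u c -> a - 1 <= c.1 <= a -> c.2 < lo \/ hi <= c.2) ->
  exists s t, s.2 < lo /\ hi <= t.2 /\
    ((s.1 = a - 1 /\ t.1 = a - 1 /\ link (fun c => O c /\ c.1 < a) s t) \/
     (s.1 = a /\ t.1 = a /\ link (fun c => O c /\ a <= c.1) s t)).
Proof.
move=> lohi uv ux uy vx vy gap.
have [//|none] := EM (exists s t, s.2 < lo /\ hi <= t.2 /\
    ((s.1 = a - 1 /\ t.1 = a - 1 /\ link (fun c => O c /\ c.1 < a) s t) \/
     (s.1 = a /\ t.1 = a /\ link (fun c => O c /\ a <= c.1) s t))).
(* Invariant in the absence of an arc: the last visit [e] of the line was below [lo], and since then
   the path has stayed on one side. *)
suff [e [ex [ey [vE|[[vl _]|[vr _]]]]]] : exists e : cell,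
    a - 1 <= e.1 <= a /\ e.2 < lo /\ (v = e \/
    (v.1 < a - 1 /\ e.1 = a - 1 /\ link (fun c => O c /\ c.1 < a) e v) \/
    (a < v.1 /\ e.1 = a /\ link (fun c => O c /\ a <= c.1) e v)).
- by move: vy; rewrite vE; lia.
- lia.
- lia.
elim: uv {vx vy} => [Ou|x y ux' IH xy Oy]; first by exists u; split; [|split; [|left]].
have uy' := link_step ux' xy Oy; have [_ Ox] := link_in ux'.
have restart : a - 1 <= y.1 <= a -> y.2 < lo ->
  exists e : cell, a - 1 <= e.1 <= a /\ e.2 < lo /\ (y = e \/
    (y.1 < a - 1 /\ e.1 = a - 1 /\ link (fun c => O c /\ c.1 < a) e y) \/
    (a < y.1 /\ e.1 = a /\ link (fun c => O c /\ a <= c.1) e y)).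
  by move=> h1 h2; exists y; split; [|split; [|left]].
have [near|[ly|ry]] : a - 1 <= y.1 <= a \/ y.1 < a - 1 \/ a < y.1 by lia.
- have [|ya] := gap y uy' near; first exact: restart.
  exfalso; have [e [ex [ey [xE|[[xl [ea ex']]|[xr [ea ex']]]]]]] := IH.
  + by move: xy; rewrite xE /adj; lia.
  + apply: none; exists e, y; split=> //; split=> //; left.
    have y1 : y.1 = a - 1 by move: xy; rewrite /adj; lia.
    by split=> //; split=> //; apply: link_step ex' xy _; split=> //; lia.
  + apply: none; exists e, y; split=> //; split=> //; right.
    have y1 : y.1 = a by move: xy; rewrite /adj; lia.
    by split=> //; split=> //; apply: link_step ex' xy _; split=> //; lia.
- have [e [ex [ey [xE|[[xl [ea ex']]|[xr [ea ex']]]]]]] := IH.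
  + exists e; split=> //; split=> //; right; left; subst e.
    have x1 : x.1 = a - 1 by move: xy; rewrite /adj; lia.
    split=> //; split=> //; apply: (@link_step _ _ x) => //.
      by apply: link0; split=> //; lia.
    by split=> //; lia.
  + exists e; split=> //; split=> //; right; left; split=> //; split=> //.
    by apply: link_step ex' xy _; split=> //; lia.
  + by move: xy; rewrite /adj; lia.
- have [e [ex [ey [xE|[[xl [ea ex']]|[xr [ea ex']]]]]]] := IH.
  + exists e; split=> //; split=> //; right; right; subst e.
    have x1 : x.1 = a by move: xy; rewrite /adj; lia.
    split=> //; split=> //; apply: (@link_step _ _ x) => //.
      by apply: link0; split=> //; lia.
    by split=> //; lia.
  + by move: xy; rewrite /adj; lia.
  + exists e; split=> //; split=> //; right; right; split=> //; split=> //.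
    by apply: link_step ex' xy _; split=> //; lia.
Qed.

Lemma pigeonhole (f : nat -> nat) W : (forall t, (t <= W)%N -> (f t < W)%N) ->
  exists t t', [/\ (t < t')%N, (t' <= W)%N & f t = f t'].
Proof.
move=> fW.
have [//|none] := EM (exists t t', [/\ (t < t')%N, (t' <= W)%N & f t = f t']).
pose g (i : 'I_W.+1) : 'I_W := Ordinal (fW i (ltn_ord i)).
have gi : injective g.
  move=> i j /(congr1 val) /= fij; apply/val_inj => /=.
  have [ij|ji|//] := ltngtP i j.
    by case: none; exists i, j; split=> //; rewrite -ltnS.
  by case: none; exists j, i; split=> //; rewrite -ltnS.
by have := leq_card g gi; rewrite !card_ord ltnn.
Qed.

Section Lines.
Variables n m : Z.
Hypotheses (n2 : 2 <= n) (m2 : 2 <= m).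
Local Notation N := (pw n).
Local Notation M := (pw m).
Let N0 k : 0 < N k. Proof. by apply: pw_gt0; lia. Qed.
Let M0 k : 0 < M k. Proof. by apply: pw_gt0; lia. Qed.

(** Consider W + 1 bands of K rows, the t-th one starting at height t(L+1)K. In each band the path
    crosses a single column or steps over a vertical line; two bands share such a line, and at least
    L rows lie between them. Either the path touches the line in each of these L rows, or an
    excursion around a missed row is an arc. The radius W + Ht covers the whole box. *)
Lemma vcross_lines (W Ht K L : nat) k s : (0 < K)%N ->
  (K * (W * L.+1 + 1) <= Ht)%N ->
  vcross n m 0 (Z.of_nat W) 0 (Z.of_nat Ht) k.+1 s ->
  (exists2 a, (a < W)%N & exists2 b, (b < Ht)%N &
     vcross n m (Z.of_nat a) (Z.of_nat a + 1) (Z.of_nat b) (Z.of_nat b + Z.of_nat K) k.+1 s)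
  \/ (exists2 a, (a < W)%N & exists2 b, (b < Ht)%N &
     larc n m (Z.of_nat a) (Z.of_nat b) (Z.of_nat (W + Ht)) k.+1 s \/
     rarc n m (Z.of_nat a) (Z.of_nat b) (Z.of_nat (W + Ht)) k.+1 s)
  \/ (exists2 a, (a < W)%N & exists2 b, (b < Ht)%N & forall i, (i < L)%N ->
     has s (first_sites n m (Z.of_nat a - 1) 2 (Z.of_nat (b + i)) 1)).
Proof.
move=> K0 KW [u [v [Bu Tv uv]]]; have Nk := N0 k.+1; have Mk := M0 k.+1.
set O := (fun c => _) in uv.
set V := (X in X \/ _); have [?|nV] := EM V; [by left|right].
set A := (X in X \/ _); have [?|nA] := EM A; [by left|right].
have exits t : (t <= W)%N -> exists a, (a < W)%N /\ exists x, [/\ link O u x,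
    N k.+1 * Z.of_nat a - 1 <= x.1 <= N k.+1 * Z.of_nat a &
    M k.+1 * Z.of_nat (t * L.+1 * K) <= x.2 < M k.+1 * Z.of_nat (t * L.+1 * K + K)].
  move=> tW; set b := (t * L.+1 * K)%N.
  have bKH : (b + K <= Ht)%N.
    have : (t * L.+1 <= W * L.+1)%N by rewrite leq_mul2r tW orbT.
    by rewrite /b; move: KW; nia.
  have [||| x [y [ux xE yE xy]]] := @sub_crossing _ u v
    (M k.+1 * Z.of_nat b) (M k.+1 * Z.of_nat (b + K) - 1) uv.
  - by rewrite Bu; nia.
  - by nia.
  - by rewrite Tv; nia.
  pose col (c : cell) := c.1 / N k.+1.
  have colP c : N k.+1 * col c <= c.1 < N k.+1 * (col c + 1).
    have := Z.div_mod c.1 (N k.+1); have := Z.mod_pos_bound c.1 (N k.+1) Nk.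
    by rewrite /col; nia.
  have [xy'|[x' [y' [xx' xy' Oy' ne]]]] := column_or_exit col xy.
    case: nV; have [_ [[x1 _] _]] := link_in ux.
    have cx := colP x; have [cx0 cxW] : 0 <= col x < Z.of_nat W := div_between Nk x1.
    exists (Z.to_nat (col x)); first lia.
    exists b; first lia.
    exists x, y; split.
    - exact: xE.
    - by rewrite /top_row yE; lia.
    - apply: link_sub xy' => c [[[[_ _] op] cr] cE]; split=> //.
      by have := colP c; rewrite cE Z2Nat.id //; split; lia.
  have ux' : link O u x'.
    by apply: (link_trans ux); apply: link_sub xx' => c [].
  have uy' : link O u y' by apply: link_step ux' xy' _; case: Oy'.
  have [_ [[[x1 _] _] xr]] := link_in xx'; have [[[y1 _] _] yr] := Oy'.
  have [cx0 cxW] : 0 <= col x' < Z.of_nat W := div_between Nk x1.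
  have [cy0 cyW] : 0 <= col y' < Z.of_nat W := div_between Nk y1.
  have cx := colP x'; have cy := colP y'; have [ax _] := xy'.
  have [lt|gt] : col x' < col y' \/ col y' < col x' by lia.
    exists (Z.to_nat (col y')); split; first lia.
    by exists x'; split=> //; [rewrite Z2Nat.id; nia|lia].
  exists (Z.to_nat (col x')); split; first lia.
  by exists x'; split=> //; [rewrite Z2Nat.id; nia|lia].
have /choice[f fP] : forall t, exists a, (t <= W)%N -> (a < W)%N /\
    exists x, [/\ link O u x,
    N k.+1 * Z.of_nat a - 1 <= x.1 <= N k.+1 * Z.of_nat a &
    M k.+1 * Z.of_nat (t * L.+1 * K) <= x.2 < M k.+1 * Z.of_nat (t * L.+1 * K + K)].
  move=> t; have [tW|tW] := leqP t W; last by exists 0%N.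
  by have [a ?] := exits t tW; exists a.
(* There are W + 1 bands but only W possible lines. *)
have [t [t' [tt t'W ff]]] := pigeonhole (fun t tW => proj1 (fP t tW)).
have [aW [x [ux xa xr]]] := fP t (ltnW (leq_trans tt t'W)).
have [_ [x' [ux' xa' xr']]] := fP t' t'W; rewrite -ff in xa'.
exists (f t) => //; set b := (t * L.+1 * K + K)%N.
have bt' : (b + L <= t' * L.+1 * K)%N.
  have : (t.+1 * L.+1 * K <= t' * L.+1 * K)%N by rewrite leq_mul2r leq_mul2r tt orbT orbT.
  by rewrite /b; nia.
have t'H : (t' * L.+1 * K < Ht)%N.
  have : (t' * L.+1 * K <= W * L.+1 * K)%N by rewrite leq_mul2r leq_mul2r t'W orbT orbT.
  by move: KW; nia.
exists b; first by apply: leq_ltn_trans t'H; lia.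
move=> i iL; have [//|nh] := boolP (has s _).
exfalso; apply: nA; exists (f t) => //; exists (b + i)%N; first by apply: leq_ltn_trans t'H; lia.
have xx' : link O x x' := link_trans (link_sym ux) ux'.
have [||||||c [e [c2 [e2 arc]]]] := @excursion O (N k.+1 * Z.of_nat (f t))
  (M k.+1 * Z.of_nat (b + i)) (M k.+1 * (Z.of_nat (b + i) + 1)) x x' _ xx' => //.
- by nia.
- by apply: (Z.lt_le_trans _ (M k.+1 * Z.of_nat b)); [lia|nia].
- apply: (Z.le_trans _ (M k.+1 * Z.of_nat (t' * L.+1 * K))); [nia|lia].
- move=> c xc cx.
  have [//|cr] : (c.2 < M k.+1 * Z.of_nat (b + i) \/
      M k.+1 * (Z.of_nat (b + i) + 1) <= c.2) \/
      M k.+1 * Z.of_nat (b + i) <= c.2 < M k.+1 * (Z.of_nat (b + i) + 1) by lia.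
  have [_ [_ op]] := link_in xc.
  case/negP: nh; apply: (open_first_sites n2 m2 _ op).
  by split=> //; nia.
have inO y : O y -> 0 <= y.1 < N k.+1 * Z.of_nat W /\ 0 <= y.2 < M k.+1 * Z.of_nat Ht.
  by move=> [[y1 y2] _]; lia.
have bH : (b + i < Ht)%N by apply: leq_ltn_trans t'H; lia.
case: arc => [[cE [eE ce]]|[cE [eE ce]]]; [left|right]; exists c, e; split=> //;
  apply: link_sub ce => y [Oy ya]; split; try (by case: Oy);
  by have [y1 y2] := inO y Oy; rewrite Nat2Z.inj_add; split; nia.
Qed.

Section Probability.
Variables (R : realType) (p : R).
Hypothesis p01 : (0 <= p < 1)%R.
Let p01' : (0 <= p <= 1)%R. Proof. by case/andP: p01 => -> /ltW. Qed.
Local Notation poss := (possible p).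

Lemma pr_run L x y :
  (pr p (fun s : config => forall i, (i < L)%N ->
     has s (first_sites n m x 2 (Z.of_nat (y + i)) 1)) <= miss_bound n m p 2 1 ^+ L)%R.
Proof.
apply: (@pr_blocks _ _ p01' _ (fun i => first_sites n m x 2 (Z.of_nat (y + i)) 1)).
  by move=> a _; rewrite size_first_sites.
move=> a b [j c] _ _.
by move=> /mem_first_sites[_ [_ ca]] /mem_first_sites[_ [_ cb]]; move: ca cb => /=; nia.
Qed.

End Probability.
End Lines.

Section Arc.
Variables n m : Z.
Hypotheses (n2 : 2 <= n) (nm : n < m).
Let m2 : 2 <= m. Proof. lia. Qed.
Variables (R : realType) (p : R).
Hypothesis p01 : (0 <= p < 1)%R.
Let p01' : (0 <= p <= 1)%R. Proof. by case/andP: p01 => -> /ltW. Qed.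
Local Notation poss := (possible p).

Lemma pr_vcross_flip x0 x1 y0 y1 k :
  pr p (vcross n m x0 x1 y0 y1 k) = pr p (hcross m n y0 y1 x0 x1 k).
Proof.
rewrite -(pr_map p (inv_inj iflipK) (good_fin (good_vcross n2 m2 _ _ _ _) k)).
by apply: pr_ext => s; rewrite vcross_flip.
Qed.

(** Take L = C i, where nm r^C <= 1/2 for the miss bound r: the number of positions, w n^i m^i,
    times r^L is at most w 2^(-i), while the required height is n^i times a linear function of i,
    which [power_gap] puts below m^i. *)
Lemma arc_scale (w k0 : nat) (e : R) : (0 < e)%R ->
  exists i L, (k0 * (w * Z.to_nat n ^ i * L.+1 + 1) <= Z.to_nat m ^ i)%N /\
   ((w * Z.to_nat n ^ i)%:R * ((Z.to_nat m ^ i)%:R * miss_bound n m p 2 1 ^+ L) <= e)%R.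
Proof.
move=> e0; have r01 := miss_bound01 n m p01 2 1.
move: (miss_bound _ _ _ _ _) r01 => r r01; have /andP[r0 r1] := r01.
set n' := Z.to_nat n; set m' := Z.to_nat m.
have [C mC] : exists C, ((n' * m')%:R * r ^+ C <= 2^-1)%R.
  have [|C rC] := @expr_small _ r (2^-1 / (n' * m').+1%:R)%R r01; first by rewrite divr_gt0.
  exists C; apply: (@le_trans _ _ ((n' * m').+1%:R * r ^+ C)%R).
    by rewrite ler_wpM2r ?exprn_ge0 // ler_nat.
  by move: rC; rewrite ler_pdivlMr // mulrC.
have [j0 je] := half_pow_small w%:R e0.
have [|j1 jg] := @power_gap n' m' (k0 * w * C)%N (k0 * w + k0)%N; first by rewrite /n' /m'; lia.
pose j := maxn j0 j1; pose i := (2 * j)%N; exists i, (C * i)%N; split.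
  apply: leq_trans (jg j (leq_maxr _ _)); rewrite -/i.
  have : (0 < n' ^ i)%N by rewrite expn_gt0 /n'; lia.
  by move: (n' ^ i)%N => x x0; nia.
have ij : (j0 <= i)%N by rewrite (leq_trans (leq_maxl j0 j1)) // /i; lia.
apply: le_trans (je i ij).
rewrite natrM -mulrA ler_wpM2l // mulrA -natrM -expnMn natrX exprM -exprMn.
by rewrite lerXn2r // nnegrE ?mulr_ge0 ?exprn_ge0 // invr_ge0.
Qed.

(** A crossing of w by 1 is scaled up to w n^i by m^i and split by [vcross_lines]. Crossings within
    a column are excluded by hypothesis and long contact with a line is improbable, so a left or
    right arc at some fixed place is possible; reflection and translation move it to the origin. *)
Lemma possible_larc (w : nat) (K : nat) : (0 < K)%N ->
  poss (vcross n m 0 (Z.of_nat w) 0 1) -> ~ poss (vcross n m 0 1 0 (Z.of_nat K)) ->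
  exists2 r, 0 <= r & poss (larc n m 0 0 r).
Proof.
move=> K0 [e e0 eF] nV.
have e2 : (0 < e / 2)%R by rewrite divr_gt0.
have [i [L [big small]]] := arc_scale w K e2.
set W := (w * _)%N in big small; set Ht := (Z.to_nat m ^ i)%N in big small.
pose V : nat -> nat -> event_seq := fun a b => vcross n m (Z.of_nat a) (Z.of_nat a + 1)
  (Z.of_nat b) (Z.of_nat b + Z.of_nat K).
pose A : nat -> nat -> event_seq := fun a b k s =>
  larc n m (Z.of_nat a) (Z.of_nat b) (Z.of_nat (W + Ht)) k s \/
  rarc n m (Z.of_nat a) (Z.of_nat b) (Z.of_nat (W + Ht)) k s.
pose D a b (s : config) := forall i, (i < L)%N ->
  has s (first_sites n m (Z.of_nat a - 1) 2 (Z.of_nat (b + i)) 1).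
have gV a b : good (V a b) by exact: good_vcross.
have gA a b : good (A a b) by apply: good_or; [exact: good_larc|exact: good_rarc].
have fD a b : finitary (D a b).
  exact: (@finitary_forall _ (fun i => first_sites n m (Z.of_nat a - 1) 2 (Z.of_nat (b + i)) 1)).
have gV' a : good (fun k s => exists2 b, (b < Ht)%N & V a b k s) by exact: good_ex.
have gA' a : good (fun k s => exists2 b, (b < Ht)%N & A a b k s) by exact: good_ex.
have fD' a : finitary (fun s => exists2 b, (b < Ht)%N & D a b s) by exact: finitary_ex.
have gV2 := good_ex W gV'; have gA2 := good_ex W gA'.
have fD2 := finitary_ex W fD'.
have pD : (pr p (fun s => exists2 a, (a < W)%N & exists2 b, (b < Ht)%N & D a b s) <= e / 2)%R.
  apply: le_trans small; apply: pr_ex_le => // a _; apply: pr_ex_le => // b _.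
  exact: pr_run.
have : poss (fun k s => (exists2 a, (a < W)%N & exists2 b, (b < Ht)%N & V a b k s) \/
    (exists2 a, (a < W)%N & exists2 b, (b < Ht)%N & A a b k s)).
  apply: (@possible_tail _ _ p01' _ 1%N _ (good_or gV2 gA2) e2); case=> // k _.
  have hk : (e <= pr p (vcross n m 0 (Z.of_nat W) 0 (Z.of_nat Ht) k.+1))%R.
    have := eF (i + k.+1)%N; rewrite !pr_vcross_flip => h.
    have := le_trans h (pr_hcross_scale p01' m2 n2 _ _ _ _ _ _).
    rewrite !Z.mul_0_r !Z.mul_1_r.
    have -> : pw n i * Z.of_nat w = Z.of_nat W.
      by rewrite -[in LHS](@Z2Nat.id n) ?pw_nat /W; lia.
    by have -> : pw m i = Z.of_nat Ht by rewrite -[in LHS](@Z2Nat.id m) ?pw_nat /Ht; lia.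
  have h2 : (pr p (vcross n m 0 (Z.of_nat W) 0 (Z.of_nat Ht) k.+1) <=
      pr p (fun s => ((exists2 a, (a < W)%N & exists2 b, (b < Ht)%N & V a b k.+1 s) \/
        (exists2 a, (a < W)%N & exists2 b, (b < Ht)%N & A a b k.+1 s)) \/
        exists2 a, (a < W)%N & exists2 b, (b < Ht)%N & D a b s))%R.
    apply: pr_le => //; first exact/good_fin/good_vcross.
      by apply: finitary_or => //; exact: (good_fin (good_or gV2 gA2)).
    move=> s /(vcross_lines n2 m2 K0 big)[h|[h|h]]; [by left; left|by left; right|by right].
  have := pr_or p01' (good_fin (good_or gV2 gA2) k.+1) fD2.
  by move: hk h2 pD; lra.
case/(possible_or p01' gV2 gA2).
  move=> /(possible_ex p01' gV')[a aW] /(possible_ex p01' (gV a))[b bH] Vab.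
  case: nV; have := possible_vcross_shift p01' n2 m2 (- Z.of_nat a) (- Z.of_nat b) Vab.
  rewrite !Z.add_opp_diag_l (_ : - _ + (_ + 1) = 1); last lia.
  by rewrite (_ : - _ + (_ + _) = Z.of_nat K); last lia.
move=> /(possible_ex p01' gA')[a aW] /(possible_ex p01' (gA a))[b bH pA].
exists (Z.of_nat (W + Ht)); first lia.
have gl := good_larc n2 m2 (Z.of_nat a) (Z.of_nat b) (Z.of_nat (W + Ht)).
have gr := good_rarc n2 m2 (Z.of_nat a) (Z.of_nat b) (Z.of_nat (W + Ht)).
have [] := possible_or p01' gl gr pA.
  move=> /(possible_larc_shift p01' n2 m2 (- Z.of_nat a) (- Z.of_nat b)).
  by rewrite !Z.add_opp_diag_l.
move=> /(possible_rarc_mirror p01' n2 m2 0).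
move=> /(possible_larc_shift p01' n2 m2 (Z.of_nat a) (- Z.of_nat b)).
by rewrite !Z.add_opp_diag_l (_ : _ + (0 - _) = 0) //; lia.
Qed.

End Arc.

(** * Horizontal versus vertical crossings *)

Lemma pw_ge q k : 2 <= q -> Z.of_nat k <= pw q k.
Proof.
move=> q2; suff : Z.of_nat k + 1 <= pw q k by lia.
by elim: k => //= k IH; nia.
Qed.

Section Equivalence.
Variables n m : Z.
Hypotheses (n2 : 2 <= n) (nm : n < m).
Let m2 : 2 <= m. Proof. lia. Qed.
Variables (R : realType) (p : R).
Hypothesis p01 : (0 < p < 1)%R.
Let p0 : (0 < p)%R. Proof. by case/andP: p01. Qed.
Let p01' : (0 <= p < 1)%R. Proof. by case/andP: p01 => /ltW ->. Qed.
Let p01'' : (0 <= p <= 1)%R. Proof. by case/andP: p01' => -> /ltW. Qed.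
Local Notation poss := (possible p).
Local Notation N := (pw n).
Local Notation M := (pw m).
Let N0 k : 0 < N k. Proof. by apply: pw_gt0; lia. Qed.
Let M0 k : 0 < M k. Proof. by apply: pw_gt0; lia. Qed.

Lemma pw_gap a b : exists i, b <= N i /\ a * N i <= M i.
Proof.
have [|j0 h] := @power_gap (Z.to_nat n) (Z.to_nat m) 0 (Z.to_nat a); first lia.
pose j := maxn j0 (Z.to_nat b); exists (2 * j)%N; split.
  have := @pw_ge n (2 * j)%N n2; have := leq_maxr j0 (Z.to_nat b); rewrite -/j; lia.
have := h j (leq_maxl _ _); rewrite mul0n add0n.
have NE : N (2 * j) = Z.of_nat (Z.to_nat n ^ (2 * j)) by rewrite -pw_nat Z2Nat.id; lia.
have ME : M (2 * j) = Z.of_nat (Z.to_nat m ^ (2 * j)) by rewrite -pw_nat Z2Nat.id; lia.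
rewrite NE ME; move: (Z.to_nat n ^ _)%N (Z.to_nat m ^ _)%N => x y.
have [?|?] : a <= 0 \/ 0 < a by lia.
  by nia.
by nia.
Qed.

Lemma unscale_square i : poss (hcross n m 0 (N i) 0 (M i)) -> poss (hcross n m 0 1 0 1).
Proof.
by move=> h; apply: (possible_unscale p01'' n2 m2 (i := i) p0); rewrite !Z.mul_0_r !Z.mul_1_r.
Qed.

Lemma linear_hcross r w0 h0 w1 h1 : 0 <= r <= w0 -> w0 < w1 -> 0 <= h0 -> 0 <= h1 ->
  poss (larc n m 0 0 r) -> poss (hcross n m 0 w0 0 h0) ->
  poss (hcross n m 0 w1 0 h1) ->
  exists2 c, 0 <= c & forall w, w1 <= w -> poss (hcross n m 0 w 0 (h1 + c * w)).
Proof.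
move=> r0 w01 h0' h1' L H0 H1.
have [c c0 lin] := possible_linear n2 m2 p01'' r0 w01 h0' h1' L H0 H1.
exists c => // w w1w; have := lin (Z.to_nat (w - w1)).
rewrite Z2Nat.id; last lia.
rewrite (_ : w1 + (w - w1) = w); last lia.
by apply: possible_le => //; try exact: good_hcross; move=> k s; apply: hcross_tall => //; nia.
Qed.

Lemma hcross_vcross_possible :
  poss (hcross n m 0 1 0 1) -> poss (vcross n m 0 1 0 1).
Proof.
move=> H; have Hi i : poss (hcross n m 0 (N i) 0 (M i)).
  by have := possible_scale p01'' n2 m2 i H; rewrite !Z.mul_0_r !Z.mul_1_r.
have [l Vl] := possible_vcross_wide n2 m2 p01' (ltac:(lia) : 0 < 1) H.
have [//|nV] := EM (poss (vcross n m 0 1 0 1)).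
have [|r r0 L] := @possible_larc n m n2 nm _ _ p01' (Z.to_nat (N l)) 1 isT _ nV.
  by rewrite Z2Nat.id //; have := N0 l; lia.
(* Scaled squares serve as initial boxes: the width at scale [i1] accommodates the radius [r], and
   the next scale is strictly wider. *)
pose i1 := Z.to_nat r; have ri : r <= N i1 by have := @pw_ge n i1 n2; rewrite /i1; lia.
have i12 : N i1 < N i1.+1 by have := N0 i1; rewrite /=; nia.
have [||c c0 lin] := linear_hcross (conj r0 ri) i12 _ _ L (Hi i1) (Hi i1.+1).
- by have := M0 i1; lia.
- by have := M0 i1.+1; lia.
(* For the width N (l + i) the height of the prolonged crossing is M i1.+1 + c N (l + i), and this
   choice puts it below M i, the height of the scaled vertical crossing. Gluing then raises that one
   to the full height M (l + i). *)
have [i [iw ih]] := pw_gap (M i1.+1 + c * N l + 1) (N i1.+1).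
have Nli : N (l + i) = N l * N i by rewrite pwD.
have wl : N i1.+1 <= N (l + i) by rewrite Nli; have := N0 l; have := N0 i; nia.
have Vli : poss (vcross n m 0 (N (l + i)) 0 (M i)).
  apply/(possible_flip p01'' n2 m2).
  move: Vl => /(possible_flip p01'' n2 m2) /(possible_scale p01'' m2 n2 i).
  by rewrite !Z.mul_0_r Z.mul_1_r Nli Z.mul_comm [N l * _]Z.mul_comm.
have small : 0 < M i1.+1 + c * N (l + i) < M i.
  by rewrite Nli; have := M0 i1.+1; have := N0 l; have := N0 i; nia.
have tall := possible_tall n2 m2 p01'' (Z.to_nat (M (l + i) - M i)) small Vli (lin _ wl).
apply/(possible_flip p01'' n2 m2).
apply: (possible_unscale p01'' m2 n2 (i := (l + i)%N) p0).
rewrite !Z.mul_0_r !Z.mul_1_r; apply/(possible_flip p01'' n2 m2).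
rewrite Z2Nat.id in tall; last by rewrite pwD; have := M0 l; have := M0 i; nia.
by rewrite (_ : M i + _ = M (l + i)) in tall; last lia.
Qed.

Lemma vcross_hcross_possible :
  poss (vcross n m 0 1 0 1) -> poss (hcross n m 0 1 0 1).
Proof.
move=> V; have wide K : 0 < K -> exists l, poss (hcross n m 0 K 0 (M l)).
  move=> K0; move: V => /(possible_flip p01'' n2 m2).
  move=> /(possible_vcross_wide m2 n2 p01' K0)[l h]; exists l.
  exact/(possible_flip p01'' m2 n2).
have [allV|/existsNP[K /not_implyP[K0 nV]]] :=
    EM (forall K : nat, (0 < K)%N -> poss (vcross n m 0 1 0 (Z.of_nat K))).
  (* Here vertical crossings of columns of width 1 connect horizontal crossings of width 2. In
     exchanged coordinates this is [possible_tall], with strip 1 and box 2. *)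
  have [l Hl] := wide 2 (ltac:(lia) : 0 < 2).
  have Vl : poss (hcross m n 0 (M l) 0 1).
    apply/(possible_flip p01'' n2 m2); rewrite -(@Z2Nat.id (M l)); last by have := M0 l; lia.
    by apply: allV; have := M0 l; lia.
  have Hl' : poss (vcross m n 0 (M l) 0 2) by apply/(possible_flip p01'' m2 n2).
  have := possible_tall m2 n2 p01'' (Z.to_nat (N l)) (ltac:(lia) : 0 < 1 < 2) Hl' Vl.
  move=> /(possible_flip p01'' m2 n2) Hw; apply: (@unscale_square l).
  apply: possible_le Hw => //; try exact: good_hcross.
  by move=> k s; apply: hcross_sub => //; have := N0 l; lia.
have [r r0 L] := possible_larc n2 nm p01' K0 (w := 1%N) V nV.
have [l0 H0] := wide (r + 1) (ltac:(lia) : 0 < r + 1).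
have [l1 H1] := wide (r + 2) (ltac:(lia) : 0 < r + 2).
have [||||c c0 lin] := linear_hcross (w0 := r + 1) (w1 := r + 2) _ _ _ _ L H0 H1.
- lia.
- lia.
- by have := M0 l0; lia.
- by have := M0 l1; lia.
(* As N i is at least 1, the linear height M l1 + c N i is at most (M l1 + c) N i, hence fits under
   M i. *)
have [i [iw ih]] := pw_gap (M l1 + c) (r + 2).
apply: (@unscale_square i); apply: possible_le (lin _ iw) => //; try exact: good_hcross.
move=> k s; apply: hcross_tall => //.
by have := N0 i; have := M0 l1; nia.
Qed.

End Equivalence.

(** * Points on the sides of several rectangles *)

Section Touching.
Variables n m : Z.
Hypotheses (n2 : 2 <= n) (m2 : 2 <= m).
Local Notation N := (pw n).
Local Notation M := (pw m).
Let N0 k : 0 < N k. Proof. by apply: pw_gt0; lia. Qed.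
Let M0 k : 0 < M k. Proof. by apply: pw_gt0; lia. Qed.

(* The closed rectangles of the level-[j] cell [d] and of the level-[j + i]
   cell [c] intersect. *)
Definition touch i (d c : cell) :=
  (N i * d.1 - 1 <= c.1 <= N i * (d.1 + 1)) /\
  (M i * d.2 - 1 <= c.2 <= M i * (d.2 + 1)).

(* The carpet is an intersection of unions of closed rectangles which need not
   be nested: a point on the common side of two rectangles may be covered by
   one of them at some levels and by the other one at other levels. *)
Definition touching k (s : config) c :=
  forall j, (0 < j <= k)%N -> exists d, s (j, d) /\ touch (k - j) d c.

Definition tcross : event_seq := fun k s =>
  exists u v, [/\ left_col n 0 k u, right_col n 1 k v &
    link (fun c => box n m 0 1 0 1 k c /\ touching k s c) u v].

Lemma iter_parent i c : iter i (parent n m) c = (c.1 / N i, c.2 / M i).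
Proof.
elim: i => [|i IH]; first by rewrite /= !Z.div_1_r; case: c.
by rewrite iterS IH /parent /= !Z.div_div ?[N i * _]Z.mul_comm ?[M i * _]Z.mul_comm //;
  have := N0 i; have := M0 i; lia.
Qed.

Lemma is_openP k s c :
  is_open n m k s c <-> forall i, (i < k)%N -> s ((k - i)%N, iter i (parent n m) c).
Proof.
elim: k c => [|k IH] c //=; split.
  move=> /andP[sc /IH op] [|i] ik //; rewrite subSS iterSr; exact: op.
move=> h; apply/andP; split; first exact: (h 0%N).
by apply/IH => i ik; have := h i.+1 ik; rewrite subSS iterSr.
Qed.

Lemma is_open_touching k s c : is_open n m k s c -> touching k s c.
Proof.
move=> /is_openP op j /andP[j0 jk].
have := op (k - j)%N; rewrite subKn // => /(_ ltac:(lia)) h.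
exists (iter (k - j) (parent n m) c); split=> //; rewrite iter_parent /touch /=.
have := Z.div_mod c.1 (N (k - j)); have := Z.mod_pos_bound c.1 (N (k - j)) (N0 _).
have := Z.div_mod c.2 (M (k - j)); have := Z.mod_pos_bound c.2 (M (k - j)) (M0 _).
have := N0 (k - j); have := M0 (k - j); lia.
Qed.

Lemma tcross_inc k : increasing (tcross k).
Proof.
move=> s s' ss [u [v [Lu Rv uv]]]; exists u, v; split=> //.
apply: link_sub uv => c [cb tc]; split=> // j /tc[d [sd td]]; exists d; split=> //.
exact: ss.
Qed.

Lemma tcross_ext k (s s' : config) :
  (forall j c, (j <= k)%N -> -1 <= c.1 <= N j -> -1 <= c.2 <= M j -> s (j, c) -> s' (j, c)) ->
  tcross k s -> tcross k s'.
Proof.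
move=> ss [u [v [Lu Rv uv]]]; exists u, v; split=> //.
apply: link_sub uv => c [cb tc]; split=> // j jk; have [d [sd [t1 t2]]] := tc j jk.
exists d; split=> //; have /andP[j0 jk'] := jk.
have Nk : N k = N (k - j) * N j by rewrite -pwD subnK.
have Mk : M k = M (k - j) * M j by rewrite -pwD subnK.
move: cb t1 t2; rewrite /box Nk Mk => -[c1 c2] t1 t2.
have P0 := N0 (k - j); have Q0 := M0 (k - j).
by apply: ss => //; split; nia.
Qed.

Lemma finitary_tcross k : finitary (tcross k).
Proof.
exists (indices k (N k + M k)); first exact: undup_uniq.
have le q j : 2 <= q -> (j <= k)%N -> 1 <= pw q j <= pw q k.
  move=> q2 jk; rewrite -(subnK jk) pwD.
  have := @pw_gt0 q (k - j) ltac:(lia); have := @pw_gt0 q j ltac:(lia); nia.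
have H (s s' : config) : {in indices k (N k + M k), s =1 s'} -> tcross k s -> tcross k s'.
  move=> ss; apply: tcross_ext => j c jk c1 c2; rewrite ss //.
  have := le n j n2 jk; have := le m j m2 jk => *.
  by apply: mem_indices => //; lia.
by move=> s s' ss; apply/propext; split; apply: H => // i /ss.
Qed.

(** * From touching cells to open cells, given a gap in every side *)

Section Gaps.
Variables (k t : nat) (s : config).
Variables gh gv : Z -> Z -> Z.
Local Notation A := (N t).
Local Notation B := (M t).
Let K := (k + t)%N.
Hypothesis ghP : forall a b, -1 <= a <= N k -> -1 <= b <= M k ->
  [/\ A * a + 2 <= gh a b <= A * (a + 1) - 3,
      ~ touching K s (gh a b, B * b - 1) & ~ touching K s (gh a b, B * b)].
Hypothesis gvP : forall a b, -1 <= a <= N k -> -1 <= b <= M k ->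
  [/\ B * b + 2 <= gv a b <= B * (b + 1) - 3,
      ~ touching K s (A * a - 1, gv a b) & ~ touching K s (A * a, gv a b)].
Let A0 : 0 < A. Proof. exact: N0. Qed.
Let B0 : 0 < B. Proof. exact: M0. Qed.

Let anc (c : cell) : cell := (c.1 / A, c.2 / B).
Let good c := is_open n m k s (anc c).
Let inside (c : cell) := (0 <= c.1 < A * N k /\ 0 <= c.2 < B * M k) /\ touching K s c.

Let ancP c : (A * (anc c).1 <= c.1 < A * ((anc c).1 + 1)) /\
  (B * (anc c).2 <= c.2 < B * ((anc c).2 + 1)).
Proof.
rewrite /anc /=; have := Z.div_mod c.1 A; have := Z.mod_pos_bound c.1 A A0.
have := Z.div_mod c.2 B; have := Z.mod_pos_bound c.2 B B0; lia.
Qed.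

(* [near c a b] : the cell [c] touches one of the four sides of level [k]
   ending at the vertex [(a, b)], between the vertex and the gap of that side. *)
Let near (c : cell) a b :=
  ((c.2 = B * b - 1 \/ c.2 = B * b) /\ gh (a - 1) b < c.1 < gh a b) \/
  ((c.1 = A * a - 1 \/ c.1 = A * a) /\ gv a (b - 1) < c.2 < gv a b).
Let vertex a b := 0 <= a <= N k /\ 0 <= b <= M k.

(** Some ancestor of level at most k is not selected, yet a selected rectangle of the same level
    touches [c]. It is a different one, so [c] borders a grid line of that level, which is also a
    line of level k. *)
Lemma bad_line c : touching K s c -> ~ good c ->
  (exists a, c.1 = A * a - 1 \/ c.1 = A * a) \/
  (exists b, c.2 = B * b - 1 \/ c.2 = B * b).
Proof.
move=> tc; rewrite /good is_openP => /existsNP[i /not_implyP[ik nsi]].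
have [|d [sd [d1 d2]]] := tc (k - i)%N; first by rewrite /K; lia.
have Ki : (K - (k - i) = i + t)%N by rewrite /K; lia.
rewrite Ki !pwD in d1 d2; rewrite iter_parent in nsi.
have e1 : N i * ((anc c).1 / N i) <= (anc c).1 < N i * ((anc c).1 / N i + 1).
  have := Z.div_mod (anc c).1 (N i); have := Z.mod_pos_bound (anc c).1 (N i) (N0 i).
  have := N0 i; lia.
have e2 : M i * ((anc c).2 / M i) <= (anc c).2 < M i * ((anc c).2 / M i + 1).
  have := Z.div_mod (anc c).2 (M i); have := Z.mod_pos_bound (anc c).2 (M i) (M0 i).
  have := M0 i; lia.
have [a1 a2] := ancP c.
have [h1|h1] := Z.eq_dec d.1 ((anc c).1 / N i); last first.
  left; move: e1 h1; move: ((anc c).1 / N i) => x e1 h1.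
  have := N0 i => Ni.
  have [lt|gt] : d.1 + 1 <= x \/ x + 1 <= d.1 by lia.
    exists (N i * (d.1 + 1)); right.
    have : N i * (d.1 + 1) <= N i * x by nia.
    have : A * (N i * x) <= A * (anc c).1 by nia.
    nia.
  exists (N i * d.1); left.
  have : N i * (x + 1) <= N i * d.1 by nia.
  have : A * ((anc c).1 + 1) <= A * (N i * (x + 1)) by nia.
  nia.
have [h2|h2] := Z.eq_dec d.2 ((anc c).2 / M i).
  by case: nsi; rewrite -h1 -h2; case: (d) sd.
right; move: e2 h2; move: ((anc c).2 / M i) => x e2 h2.
have := M0 i => Mi.
have [lt|gt] : d.2 + 1 <= x \/ x + 1 <= d.2 by lia.
  exists (M i * (d.2 + 1)); right.
  have : M i * (d.2 + 1) <= M i * x by nia.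
  have : B * (M i * x) <= B * (anc c).2 by nia.
  nia.
exists (M i * d.2); left.
have : M i * (x + 1) <= M i * d.2 by nia.
have : B * ((anc c).2 + 1) <= B * (M i * (x + 1)) by nia.
nia.
Qed.

(** A bad cell along a side is not the gap itself, so it lies on one side of it and is attributed to
    the vertex there. *)
Lemma bad_vertex c : inside c -> ~ good c -> exists a b, vertex a b /\ near c a b.
Proof.
move=> [[c1 c2] tc] bc; have [a1 a2] := ancP c.
have x0 : 0 <= (anc c).1 < N k by split; nia.
have y0 : 0 <= (anc c).2 < M k by split; nia.
have [[a cE]|[b cE]] := bad_line tc bc.
  have a0 : 0 <= a <= N k by case: cE => cE; rewrite cE in c1; split; nia.
  set y := (anc c).2 in a2 y0.
  have [||g1 g2 g3] := gvP (a := a) (b := y); [lia|lia|].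
  have [lt|[eq|gt]] : c.2 < gv a y \/ c.2 = gv a y \/ gv a y < c.2 by lia.
  - exists a, y; split; first by split; lia.
    right; split=> //; have [||h _ _] := gvP (a := a) (b := y - 1); [lia|lia|].
    split=> //; lia.
  - exfalso; case: cE => cE; [apply: g2|apply: g3]; rewrite -eq -cE;
    by move: tc; case: (c).
  - exists a, (y + 1); split; first by split; lia.
    right; split=> //; have [||h _ _] := gvP (a := a) (b := y + 1); [lia|lia|].
    rewrite Z.add_simpl_r; split=> //; lia.
have b0 : 0 <= b <= M k by case: cE => cE; rewrite cE in c2; split; nia.
set x := (anc c).1 in a1 x0.
have [||g1 g2 g3] := ghP (a := x) (b := b); [lia|lia|].
have [lt|[eq|gt]] : c.1 < gh x b \/ c.1 = gh x b \/ gh x b < c.1 by lia.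
- exists x, b; split; first by split; lia.
  left; split=> //; have [||h _ _] := ghP (a := x - 1) (b := b); [lia|lia|].
  split=> //; lia.
- exfalso; case: cE => cE; [apply: g2|apply: g3]; rewrite -eq -cE;
  by move: tc; case: (c).
- exists (x + 1), b; split; first by split; lia.
  left; split=> //; have [||h _ _] := ghP (a := x + 1) (b := b); [lia|lia|].
  rewrite Z.add_simpl_r; split=> //; lia.
Qed.

Lemma near_bounds c a b : vertex a b -> near c a b ->
  A * (a - 1) + 3 <= c.1 <= A * (a + 1) - 4 /\ B * (b - 1) + 3 <= c.2 <= B * (b + 1) - 4.
Proof.
move=> [a0 b0].
have [||h1 _ _] := ghP (a := a) (b := b); try lia.
have [||h2 _ _] := ghP (a := a - 1) (b := b); try lia.
have [||h3 _ _] := gvP (a := a) (b := b); try lia.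
have [||h4 _ _] := gvP (a := a) (b := b - 1); try lia.
by case=> -[cE cr]; split; lia.
Qed.

(** Bad cells form clusters around vertices: a step between bad cells cannot pass a gap, and the
    margins 2 and 3 in [ghP] and [gvP] keep the gaps away from the other grid lines. *)
Lemma near_step c d a b : inside d -> adj c d -> vertex a b ->
  near c a b -> ~ good d -> near d a b.
Proof.
move=> [din td] cd ab nc bd; have [a0 b0] := ab.
have [||h1 g1 g1'] := ghP (a := a) (b := b); try lia.
have [||h2 g2 g2'] := ghP (a := a - 1) (b := b); try lia.
have [||h3 g3 g3'] := gvP (a := a) (b := b); try lia.
have [||h4 g4 g4'] := gvP (a := a) (b := b - 1); try lia.
have dn1 : (d.2 = B * b - 1 \/ d.2 = B * b) -> d.1 <> gh a b /\ d.1 <> gh (a - 1) b.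
  by move=> dE; split=> e; case: dE => dE; move: td; rewrite [d]surjective_pairing dE e.
have dn2 : (d.1 = A * a - 1 \/ d.1 = A * a) -> d.2 <> gv a b /\ d.2 <> gv a (b - 1).
  by move=> dE; split=> e; case: dE => dE; move: td; rewrite [d]surjective_pairing dE e.
have [bx bY] := near_bounds ab nc.
have [[x xE]|[y yE]] := bad_line td bd.
- have xa : x = a.
    have : A * (a - 1) < A * x < A * (a + 1) by move: cd; rewrite /adj; lia.
    nia.
  subst x; right; split=> //; have := dn2 xE.
  case: nc => -[cE cr]; first by move: cd; rewrite /adj; lia.
  by move: cd; rewrite /adj; lia.
- have yb : y = b.
    have : B * (b - 1) < B * y < B * (b + 1) by move: cd; rewrite /adj; lia.
    nia.
  subst y; left; split=> //; have := dn1 yE.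
  by case: nc => -[cE cr]; move: cd; rewrite /adj; lia.
Qed.

Let block (q : cell) a b := (a - 1 <= q.1 <= a) /\ (b - 1 <= q.2 <= b).

(** A cluster has contact only with the four level-k cells around its vertex. Any two of these are
    king-adjacent, so a detour through bad cells connects nothing new. *)
Lemma near_block c d a b : adj c d -> vertex a b -> near c a b -> block (anc d) a b.
Proof.
move=> cd ab nc; have [bx bY] := near_bounds ab nc; have [d1 d2] := ancP d.
by move: cd; rewrite /adj /block => cd; split; nia.
Qed.

Let opens c := box n m 0 1 0 1 k c /\ is_open n m k s c.
Let reached q := exists u, left_col n 0 k u /\ link opens u q.

Let opens_anc c : inside c -> good c -> opens (anc c).
Proof.
move=> [[c1 c2] _] gc; split=> //; have [a1 a2] := ancP c.
by rewrite /box; split; nia.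
Qed.

Let reached_step q q' : reached q -> adj q q' -> opens q' -> reached q'.
Proof. by move=> [u [Lu uq]] qq' Oq'; exists u; split=> //; exact: link_step qq' Oq'. Qed.

(** Invariant along a touching path. For a vertex with [a = 0], a level-k cell of its block inside
    the square is in the left column, hence reached from the start. *)
Let state c := (good c /\ reached (anc c)) \/
  (~ good c /\ exists a b, [/\ vertex a b, near c a b &
     a = 0 \/ exists q, reached q /\ block q a b]).

Lemma state_step c d : inside c -> inside d -> adj c d -> state c -> state d.
Proof.
move=> ic id cd; have [gd|bd] := EM (good d).
  have od := opens_anc id gd; have [[d1 d2] _] := id; have [e1 e2] := ancP d.
  case=> [[gc rc]|[bc [a [b [ab nc st]]]]]; left; split=> //.
    apply: (reached_step rc) od; rewrite /adj /anc /=.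
    by move: cd => [? ?]; split; apply: div_adj.
  have bl := near_block cd ab nc.
  case: st => [a0|[q [rq bq]]].
    exists (anc d); split; last exact: link0.
    by move: bl; rewrite /block /left_col; nia.
  by apply: (reached_step rq) od; move: bl bq; rewrite /block /adj; lia.
case=> [[gc rc]|[bc [a [b [ab nc st]]]]]; right; split=> //.
  have [a [b [ab nd]]] := bad_vertex id bd; exists a, b; split=> //; right.
  by exists (anc c); split=> //; apply: near_block (adjC cd) ab nd.
by exists a, b; split=> //; exact: near_step nc bd.
Qed.

Lemma tcross_hcross : tcross K s -> hcross n m 0 1 0 1 k s.
Proof.
move=> [u [v [Lu Rv uv]]].
have uv' : link inside u v.
  apply: link_sub uv => c [[c1 c2] tc]; split=> //.
  by move: c1 c2; rewrite /K !pwD; lia.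
have iu := proj1 (link_in uv'); have iv := proj2 (link_in uv').
have su : state u.
  have [[u1 u2] _] := iu; have [e1 e2] := ancP u; rewrite /left_col in Lu.
  have [gu|bu] := EM (good u).
    left; split=> //; exists (anc u); split; last exact/link0/opens_anc.
    by rewrite /left_col; nia.
  right; split=> //; have [a [b [ab nu]]] := bad_vertex iu bu.
  exists a, b; split=> //; left; have [bx _] := near_bounds ab nu.
  by case: ab => ab _; nia.
have sv : state v.
  elim: uv' su => // x y ux IH xy iy su.
  by apply: (state_step (proj2 (link_in ux)) iy xy); exact: IH.
have [[v1 v2] _] := iv; have [e1 e2] := ancP v.
rewrite /right_col /K pwD in Rv.
case: sv => [[gv' [w [Lw wv]]]|[bv [a [b [ab nv st]]]]].
  by exists w, (anc v); split=> //; rewrite /right_col; nia.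
have [bx _] := near_bounds ab nv; have Nk := N0 k.
case: ab => ab _; have aE : a = N k by nia.
case: st => [|[q [[w [Lw wq]] bq]]]; first lia.
exists w, q; split=> //; have [_ [[q1 _] _]] := link_in wq.
by move: bq; rewrite /block /right_col; lia.
Qed.

End Gaps.

Definition patch (j : nat) (x : Z) (w : nat) (y : Z) (h : nat) : seq site :=
  [seq (j, c) | c <- [seq (x + Z.of_nat i, y + Z.of_nat i') |
     i <- iota 0 w, i' <- iota 0 h]].

Lemma size_patch j x w y h : size (patch j x w y h) = (w * h)%N.
Proof. by rewrite size_map size_allpairs !size_iota. Qed.

Lemma mem_patch j x w y h l (c : cell) : ((l, c) \in patch j x w y h) <->
  [/\ l = j, x <= c.1 < x + Z.of_nat w & y <= c.2 < y + Z.of_nat h].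
Proof.
split.
  move=> /mapP[c' /allpairsP[[i i'] /= [ii ii' ->]] [-> ->]].
  by move: ii ii'; rewrite !mem_iota => ? ?; split=> //=; lia.
move=> [-> xx yy]; apply/mapP; exists c => //; apply/allpairsP.
exists (Z.to_nat (c.1 - x), Z.to_nat (c.2 - y)).
case: c xx yy => c1 c2 /= xx yy; rewrite !mem_iota; split; [lia|lia|].
by rewrite !Z2Nat.id; try lia; congr pair; lia.
Qed.

Lemma no_patch_no_touch j x w y h (s : config) c : (0 < j)%N ->
  ~~ has s (patch j x w y h) ->
  x + 1 <= c.1 < x + Z.of_nat w - 1 -> y + 1 <= c.2 < y + Z.of_nat h - 1 ->
  ~ touching j s c.
Proof.
move=> j0 /hasPn no cx cy /(_ j); rewrite subnn leqnn j0 => /(_ isT)[d [sd [d1 d2]]].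
rewrite /= in d1 d2.
suff /no : (j, d) \in patch j x w y h by rewrite sd.
by apply/mem_patch; split=> //; lia.
Qed.

Section BridgeProbability.
Variables (R : realType) (p : R).
Hypothesis p01 : (0 <= p < 1)%R.
Let p01' : (0 <= p <= 1)%R. Proof. by case/andP: p01 => -> /ltW. Qed.

(** The 3 by 4 level-K neighbours of the two cells at a candidate gap, one on each side of the line:
    if none of these 12 sites is selected, neither cell is touching. Candidates are 3 apart, so
    their blocks are disjoint. *)
Let hblock K t a b i := patch K (N t * a + 2 + 3 * Z.of_nat i) 3 (M t * b - 2) 4.
Let vblock K t a b i := patch K (N t * a - 2) 4 (M t * b + 2 + 3 * Z.of_nat i) 3.
Let blocked K t T (s : config) a b :=
  (forall i, (i < T)%N -> has s (hblock K t a b i)) \/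
  (forall i, (i < T)%N -> has s (vblock K t a b i)).

Lemma gaps_hcross k t T s : (0 < k + t)%N ->
  3 * Z.of_nat T + 3 <= N t -> 3 * Z.of_nat T + 3 <= M t ->
  (forall a b, -1 <= a <= N k -> -1 <= b <= M k -> ~ blocked (k + t)%N t T s a b) ->
  tcross (k + t)%N s -> hcross n m 0 1 0 1 k s.
Proof.
move=> kt NT MT nb.
have /choice[gh ghP] : forall ab : Z * Z, exists g, -1 <= ab.1 <= N k -> -1 <= ab.2 <= M k ->
   [/\ N t * ab.1 + 2 <= g <= N t * (ab.1 + 1) - 3,
      ~ touching (k + t)%N s (g, M t * ab.2 - 1) & ~ touching (k + t)%N s (g, M t * ab.2)].
  move=> [a b] /=; have [[ha hb]|no] := EM (-1 <= a <= N k /\ -1 <= b <= M k); last first.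
    by exists 0 => *; case: no.
  have := nb a b ha hb; rewrite /blocked not_orP => -[/existsNP[i /not_implyP[iT /negP no]] _].
  exists (N t * a + 3 + 3 * Z.of_nat i) => _ _; split; first lia.
    by apply: (no_patch_no_touch kt no) => /=; lia.
  by apply: (no_patch_no_touch kt no) => /=; lia.
have /choice[gv gvP] : forall ab : Z * Z, exists g, -1 <= ab.1 <= N k -> -1 <= ab.2 <= M k ->
   [/\ M t * ab.2 + 2 <= g <= M t * (ab.2 + 1) - 3,
      ~ touching (k + t)%N s (N t * ab.1 - 1, g) & ~ touching (k + t)%N s (N t * ab.1, g)].
  move=> [a b] /=; have [[ha hb]|no] := EM (-1 <= a <= N k /\ -1 <= b <= M k); last first.
    by exists 0 => *; case: no.
  have := nb a b ha hb; rewrite /blocked not_orP => -[_ /existsNP[i /not_implyP[iT /negP no]]].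
  exists (M t * b + 3 + 3 * Z.of_nat i) => _ _; split; first lia.
    by apply: (no_patch_no_touch kt no) => /=; lia.
  by apply: (no_patch_no_touch kt no) => /=; lia.
apply: (@tcross_hcross k t s (fun a b => gh (a, b)) (fun a b => gv (a, b))).
  by move=> a b; exact: (ghP (a, b)).
by move=> a b; exact: (gvP (a, b)).
Qed.

Let rho : R := (1 - (1 - p) ^+ 12)%R.

Lemma pr_blocked K t T a b : (pr p (fun s => blocked K t T s a b) <= 2 * rho ^+ T)%R.
Proof.
have dis (S : nat -> seq site) :
    (forall i, (i < T)%N -> (size (S i) <= 12)%N) ->
    (forall i i' l, (i < T)%N -> (i' < T)%N -> l \in S i -> l \in S i' -> i = i') ->
    (pr p (fun s => forall i, (i < T)%N -> has s (S i)) <= rho ^+ T)%R.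
  by move=> h1 h2; exact: (pr_blocks p01' h1 h2).
have hh : (pr p (fun s => forall i, (i < T)%N -> has s (hblock K t a b i)) <= rho ^+ T)%R.
  apply: dis => [i _|i i' [l c] _ _]; first by rewrite size_patch.
  by move=> /mem_patch[_ h1 _] /mem_patch[_ h2 _]; lia.
have hv : (pr p (fun s => forall i, (i < T)%N -> has s (vblock K t a b i)) <= rho ^+ T)%R.
  apply: dis => [i _|i i' [l c] _ _]; first by rewrite size_patch.
  by move=> /mem_patch[_ _ h1] /mem_patch[_ _ h2]; lia.
have := pr_or p01' (@finitary_forall _ (hblock K t a b) T) (@finitary_forall _ (vblock K t a b) T).
by rewrite /blocked; lra.
Qed.

(** For fixed k there are finitely many sides. With T candidates on each, the probability that a
    side has no gap is at most e/2 in total; the depth t makes room for them, and a touching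
    crossing at level k + t then leaves e/2 for an open one at level k. *)
Lemma tcross_possible (e : R) : (0 < e)%R -> (forall k, (e <= pr p (tcross k))%R) ->
  possible p (hcross n m 0 1 0 1).
Proof.
move=> e0 te; exists (e / 2)%R; first by rewrite divr_gt0.
move=> k; set W := Z.to_nat (N k + 2); set H := Z.to_nat (M k + 2).
have q0 : (0 < 1 - p)%R by rewrite subr_gt0; case/andP: p01.
have r01 : (0 <= rho < 1)%R.
  rewrite /rho subr_ge0 exprn_ile1 ?(ltW q0) ?gerBl //=; last by case/andP: p01.
  by rewrite ltrBlDr ltrDl exprn_gt0.
have WH0 : (0 < (W%:R * (H%:R * 2) : R))%R.
  have := N0 k; have := M0 k => *.
  by rewrite !mulr_gt0 // ltr0n /W /H; lia.
have [|T rT] := @expr_small _ rho (e / 2 / (W%:R * (H%:R * 2)))%R r01.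
  by rewrite !divr_gt0.
pose t := (3 * T + 3)%N.
have NT : 3 * Z.of_nat T + 3 <= N t by have := @pw_ge n t n2; rewrite /t; lia.
have MT : 3 * Z.of_nat T + 3 <= M t by have := @pw_ge m t m2; rewrite /t; lia.
have kt : (0 < k + t)%N by rewrite /t; lia.
pose D i i' s := blocked (k + t)%N t T s (Z.of_nat i - 1) (Z.of_nat i' - 1).
have fD i i' : finitary (D i i').
  apply: finitary_or.
    exact: (@finitary_forall _ (hblock (k + t)%N t (Z.of_nat i - 1) (Z.of_nat i' - 1))).
  exact: (@finitary_forall _ (vblock (k + t)%N t (Z.of_nat i - 1) (Z.of_nat i' - 1))).
have fD1 i : finitary (fun s => exists2 i', (i' < H)%N & D i i' s) by exact: finitary_ex.
have fD2 : finitary (fun s => exists2 i, (i < W)%N & exists2 i', (i' < H)%N & D i i' s).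
  exact: finitary_ex.
have pD : (pr p (fun s => exists2 i, (i < W)%N & exists2 i', (i' < H)%N & D i i' s) <= e / 2)%R.
  move: rT; rewrite ler_pdivlMr // => rT.
  apply: (@le_trans _ _ (W%:R * (H%:R * (2 * rho ^+ T)))%R).
    apply: pr_ex_le => // i _; apply: pr_ex_le => // i' _; exact: pr_blocked.
  by apply: le_trans rT; rewrite le_eqVlt; apply/orP; left; apply/eqP; ring.
have gH := good_fin (good_hcross n2 m2 0 1 0 1) k.
have : (e <= pr p (fun s => hcross n m 0 1 0 1 k s \/
    exists2 i, (i < W)%N & exists2 i', (i' < H)%N & D i i' s))%R.
  apply: (le_trans (te (k + t)%N)); apply: pr_le => //.
  - exact: finitary_tcross.
  - exact: finitary_or.
  - move=> s ts; have [?|nD] := EM (exists2 i, (i < W)%N & exists2 i', (i' < H)%N & D i i' s).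
      by right.
    left; apply: (gaps_hcross kt NT MT _ ts) => a b ha hb bl; apply: nD.
    exists (Z.to_nat (a + 1)); first by rewrite /W; lia.
    exists (Z.to_nat (b + 1)); first by rewrite /H; lia.
    by rewrite /D !Z2Nat.id ?Z.add_simpl_r //; lia.
have := pr_or p01' gH fD2.
by move: pD; lra.
Qed.

End BridgeProbability.
End Touching.

(** * The carpet as a limit of discrete crossings *)

Local Close Scope Z_scope.
Local Open Scope classical_set_scope.

(** * Decreasing sequences of compact connected sets *)

Section NestedContinua.
Variable T : topologicalType.

Lemma compact_nested (C : set T) (E : nat -> set T) : compact C ->
  (forall k, closed (E k)) -> (forall k, E k `<=` C) -> (forall k, E k !=set0) ->
  (forall k, E k.+1 `<=` E k) -> exists z, forall k, E k z.
Proof.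
move=> cC clE EC E0 dE.
have /choice[x xE] : forall k, exists x, E k x by move=> k; have [x] := E0 k; exists x.
have mono k l : (k <= l)%N -> E l `<=` E k.
  move=> /subnK <-; elim: (l - k)%N => // i IH; rewrite addSn.
  exact: subset_trans (dE _) IH.
have [|z [Cz zx]] := cC (x @ \oo) _.
  by exists 0%N => // k _ /=; exact: EC (xE k).
exists z => k; apply: clE => B Bz.
have [|y [Ey By]] := zx (E k) B _ Bz; last by exists y.
by exists k => // l /= kl; exact: mono kl _ (xE l).
Qed.

Lemma separated_open (U V : set T) : open U -> open V -> U `&` V = set0 ->
  separated U V.
Proof.
move=> oU oV UV; split; rewrite -subset0 => z [].
  move=> clz Vz; have [y [Uy Vy]] := clz V (open_nbhs_nbhs (conj oV Vz)).
  by have : (U `&` V) y by []; rewrite UV.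
move=> Uz clz; have [y [Vy Uy]] := clz U (open_nbhs_nbhs (conj oU Uz)).
by have : (U `&` V) y by []; rewrite UV.
Qed.

Lemma separated_closed (U V : set T) : closed U -> closed V -> U `&` V = set0 ->
  separated U V.
Proof. by move=> /closure_id eU /closure_id eV UV; split; rewrite -?eU -?eV. Qed.

(** A separation of the intersection extends, by normality, to disjoint open sets; by compactness
    some [D k] lies in their union, contradicting its connectedness. *)
Lemma nested_connected (R : realType) (C : set T) (D : nat -> set T) :
  normal_space T -> compact C -> (forall k, closed (D k)) ->
  (forall k, D k `<=` C) -> (forall k, D k.+1 `<=` D k) ->
  (forall k, connected (D k)) -> connected (\bigcap_k D k).
Proof.
move=> nT cC clD DC dD cD; apply/not_notP => /connectedPn[E [E0 DE [sep1 sep2]]].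
have clA : closed (\bigcap_k D k) by apply: closed_bigI => k _; exact: clD.
have clE b : closed (E b).
  have sub : E b `<=` \bigcap_k D k by rewrite DE; case: b; [right|left].
  move=> z clz; have : (\bigcap_k D k) z.
    by apply: clA; apply: closure_subset clz.
  rewrite DE => -[] Ez; case: b sub clz => // _ clz; exfalso.
    have : (E false `&` closure (E true)) z by [].
    by rewrite sep2.
  have : (closure (E false) `&` E true) z by [].
  by rewrite sep1.
have EE : E false `&` E true = set0.
  rewrite -subset0 => z [Ef Et]; rewrite -sep2; split=> //; exact: subset_closure.
have [U [V [oU oV EU EV UV]]] :=
  (@normal_openP R T).1 nT _ _ (clE false) (clE true) EE.
have [k Dk] : exists k, D k `<=` U `|` V.
  apply: contrapT => /forallNP no.
  have [||||z zG] := @compact_nested C (fun k => D k `&` ~` (U `|` V)) cC.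
  - by move=> k; apply: closedI => //; apply: open_closedC; exact: openU.
  - by move=> k z [/DC].
  - move=> k; have /existsNP[z /not_implyP[Dz nz]] := no k.
    by exists z.
  - by move=> k z [/dD Dz nz].
  have : (\bigcap_k D k) z by move=> k _; case: (zG k).
  rewrite DE => -[/EU|/EV] h; case: (zG 0%N) => _; apply; [by left|by right].
have sub b : E b `<=` D k.
  have : E b `<=` \bigcap_k D k by rewrite DE; case: b; [right|left].
  by move=> h z /h; exact.
have [DU|DV] := connected_subset (separated_open oU oV UV) Dk (cD k).
  have [z Ez] := E0 true; suff : (U `&` V) z by rewrite UV.
  by split; [apply/DU/(sub true)|apply: EV].
have [z Ez] := E0 false; suff : (U `&` V) z by rewrite UV.
by split; [apply: EU|apply/DV/(sub false)].
Qed.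

End NestedContinua.

(** * Closed q-adic intervals of the real line *)

Section Slabs.
Variables (R : realType) (q : nat).
Hypothesis q2 : (2 <= q)%N.
Implicit Types (x d : Z) (r : R) (k i j : nat).

(** The endpoints are multiplied out to avoid division. [Z.to_nat] sends negative [x] to 0, whence
    the sign hypotheses in the lemmas. *)
Definition slab k x r :=
  (Z.to_nat x)%:R <= r * q%:R ^+ k <= (Z.to_nat x).+1%:R.

Let Q := Z.of_nat q.

Let qk0 k : 0 < q%:R ^+ k :> R.
Proof. by rewrite exprn_gt0 // ltr0n; lia. Qed.

Let qN0 k : (0 < q ^ k)%N.
Proof. by rewrite expn_gt0 (ltnW q2). Qed.

Let qR0 : 0 < q%:R :> R. Proof. by rewrite ltr0n; lia. Qed.

Lemma slab_ex k r : 0 <= r <= 1 -> exists2 x, (0 <= x < pw Q k)%coqZ & slab k x r.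
Proof.
move=> /andP[r0 r1].
have ex : exists i, r * q%:R ^+ k <= i.+1%:R.
  exists (q ^ k)%N; rewrite -natrX; apply: (@le_trans _ _ (q ^ k)%:R).
    by rewrite ler_piMl.
  by rewrite ler_nat.
(* The least such i, rather than the integer part, keeps r = 1 in the last interval. *)
case: (ex_minnP ex) => i ri mi; exists (Z.of_nat i).
  rewrite pw_nat; suff : (i <= (q ^ k).-1)%N by have := qN0 k; lia.
  apply: mi; rewrite prednK //.
  by rewrite natrX ler_piMl // ltW.
rewrite /slab Nat2Z.id ri andbT; case: i ri mi => [|i] ri mi.
  by rewrite mulr_ge0 // ltW.
by rewrite leNgt; apply/negP => /ltW /mi; rewrite ltnn.
Qed.

Lemma slab_adj k x d r : (0 <= x)%coqZ -> (0 <= d)%coqZ -> slab k x r -> slab k d r ->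
  (Z.abs (x - d) <= 1)%coqZ.
Proof.
move=> x0 d0 /andP[x1 x2] /andP[d1 d2].
have := le_trans x1 d2; have := le_trans d1 x2; rewrite !ler_nat; lia.
Qed.

Lemma slab_touch i j d x r : (0 <= d)%coqZ -> (0 <= x)%coqZ -> slab j d r ->
  slab (i + j) x r -> (pw Q i * d - 1 <= x <= pw Q i * (d + 1))%coqZ.
Proof.
move=> d0 x0 /andP[d1 d2] /andP[]; rewrite exprD [q%:R ^+ i * _]mulrC mulrA => x1 x2.
have h1 : (Z.to_nat d)%:R * q%:R ^+ i <= (Z.to_nat x).+1%:R :> R.
  by apply: le_trans x2; rewrite ler_pM2r.
have h2 : (Z.to_nat x)%:R <= (Z.to_nat d).+1%:R * q%:R ^+ i :> R.
  by apply: (le_trans x1); rewrite ler_pM2r.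
move: h1 h2; rewrite -natrX -!natrM !ler_nat pw_nat.
move: (q ^ i)%N => y h1 h2.
have := Z2Nat.id d d0; have := Z2Nat.id x x0; move: (Z.to_nat d) (Z.to_nat x) h1 h2.
by move=> a b h1 h2 <- <-; nia.
Qed.

Lemma slab_parent k x r : (0 <= x)%coqZ -> slab k.+1 x r -> slab k (x / Q) r.
Proof.
move=> x0 /andP[]; rewrite exprSr mulrA => x1 x2.
have := Z.div_mod x Q; have := Z.mod_pos_bound x Q; have := Z.div_pos x Q x0.
set y := (x / Q)%coqZ => y0 hm hd.
have e1 : (Z.to_nat y * q <= Z.to_nat x)%N by rewrite /Q in y0 hm hd; nia.
have e2 : ((Z.to_nat x).+1 <= (Z.to_nat y).+1 * q)%N by rewrite /Q in y0 hm hd; nia.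
apply/andP; split; rewrite -(ler_pM2r qR0).
  by apply: le_trans x1; rewrite -natrM ler_nat.
by apply: (le_trans x2); rewrite -natrM ler_nat.
Qed.

Lemma slab_meet k x d : (0 <= x)%coqZ -> (0 <= d)%coqZ -> (Z.abs (x - d) <= 1)%coqZ ->
  exists2 r, slab k x r & slab k d r.
Proof.
move=> x0 d0 xd; exists ((Z.to_nat (Z.max x d))%:R / q%:R ^+ k); rewrite /slab mulfVK ?gt_eqF //;
by rewrite !ler_nat; lia.
Qed.

(** The distance of r from the closed interval [d] is at most of the order of the length of a level
    i + j interval, for every i; so it vanishes. *)
Lemma slab_limit j d r (x : nat -> Z) : (0 <= d)%coqZ -> (forall i, 0 <= x i)%coqZ ->
  (forall i, pw Q i * d - 1 <= x i <= pw Q i * (d + 1))%coqZ ->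
  (forall i, slab (i + j) (x i) r) -> slab j d r.
Proof.
move=> d0 x0 dx sx.
have small (a : R) : (forall i, a * q%:R ^+ i <= 1) -> a <= 0.
  move=> h; rewrite leNgt; apply/negP => a0.
  have := archi_boundP (ltW (divr_gt0 ltr01 a0)); set i := Num.bound _ => ia.
  have := h i; rewrite leNgt => /negP; apply.
  rewrite -ltr_pdivrMl // mulrC; apply: (lt_le_trans ia).
  rewrite -natrX ler_nat; apply: (@leq_trans (2 ^ i)); first by rewrite ltnW // ltn_expl.
  by case: (i) => // i'; rewrite leq_exp2r.
have e i : ((Z.to_nat d)%:R * q%:R ^+ i <= (Z.to_nat (x i)).+1%:R :> R) /\
    ((Z.to_nat (x i))%:R <= (Z.to_nat d).+1%:R * q%:R ^+ i :> R).
  rewrite -natrX -!natrM !ler_nat; have := dx i; rewrite pw_nat.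
  have := Z2Nat.id d d0; have := Z2Nat.id (x i) (x0 i).
  move: (Z.to_nat d) (Z.to_nat (x i)) (q ^ i)%N => a b c <- <-; split; nia.
apply/andP; split; rewrite -subr_le0; apply: small => i; have /andP[s1 s2] := sx i;
  have [e1 e2] := e i; rewrite mulrBl -mulrA -exprD addnC.
  by move: e1 s1; rewrite -natr1; lra.
by move: e2 s2; rewrite -[(Z.to_nat (x i)).+1%:R]natr1; lra.
Qed.

Lemma slab_itv k x : [set r | slab k x r] =
  `[(Z.to_nat x)%:R / q%:R ^+ k, (Z.to_nat x).+1%:R / q%:R ^+ k].
Proof.
apply/seteqP; split => r /=; rewrite in_itv /= /slab.
  by rewrite ler_pdivrMr // ler_pdivlMr.
by rewrite ler_pdivrMr // ler_pdivlMr.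
Qed.

Lemma slab_unit k x r : (x < pw Q k)%coqZ -> slab k x r -> 0 <= r <= 1.
Proof.
move=> xk /andP[x1 x2]; have r0 : 0 <= r * q%:R ^+ k by apply: le_trans x1.
rewrite pmulr_lge0 // in r0; rewrite r0 /= -(ler_pM2r (qk0 k)) mul1r.
apply: (le_trans x2); rewrite -natrX ler_nat; rewrite pw_nat in xk.
have := qN0 k; lia.
Qed.

Lemma slab0 k x : (0 <= x)%coqZ -> slab k x 0 <-> x = 0%coqZ.
Proof.
move=> x0; rewrite /slab mul0r ler0n andbT; split=> [|->]; last by rewrite lexx.
by rewrite (_ : 0 = 0%:R) // ler_nat; lia.
Qed.

Lemma slab1 k x : (0 <= x < pw Q k)%coqZ -> slab k x 1 <-> x = (pw Q k - 1)%coqZ.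
Proof.
move=> xk; rewrite /slab mul1r -natrX !ler_nat; rewrite pw_nat in xk *.
by split; lia.
Qed.

End Slabs.

Section Tiles.
Variables (R : realType) (n m : nat).
Hypotheses (n2 : (2 <= n)%N) (m2 : (2 <= m)%N).
Local Notation nz := (Z.of_nat n).
Local Notation mz := (Z.of_nat m).
Let nz2 : (2 <= nz)%coqZ. Proof. lia. Qed.
Let mz2 : (2 <= mz)%coqZ. Proof. lia. Qed.
Local Notation unit_box := (box nz mz 0 1 0 1).

Definition tile k (c : cell) : set (R * R) :=
  [set z | slab n k c.1 z.1 /\ slab m k c.2 z.2].

Lemma unit_boxE k c : unit_box k c <->
  (0 <= c.1 < pw nz k)%coqZ /\ (0 <= c.2 < pw mz k)%coqZ.
Proof. by rewrite /box !Z.mul_0_r !Z.mul_1_r. Qed.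

Lemma tile_ex k (z : R * R) : 0 <= z.1 <= 1 -> 0 <= z.2 <= 1 ->
  exists2 c, unit_box k c & tile k c z.
Proof.
move=> /(slab_ex n2 k)[x xk sx] /(slab_ex m2 k)[y yk sy].
by exists (x, y) => //; apply/unit_boxE.
Qed.

Lemma tile_adj k c d z : unit_box k c -> unit_box k d -> tile k c z -> tile k d z ->
  adj c d.
Proof.
move=> /unit_boxE[c1 c2] /unit_boxE[d1 d2] [t1 t2] [u1 u2].
split; [apply: (slab_adj n2 _ _ t1 u1)|apply: (slab_adj m2 _ _ t2 u2)]; lia.
Qed.

Lemma tile_meet k c d : unit_box k c -> unit_box k d -> adj c d ->
  tile k c `&` tile k d !=set0.
Proof.
move=> /unit_boxE[c1 c2] /unit_boxE[d1 d2] [a1 a2].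
have [||x x1 x2] := @slab_meet R n n2 k c.1 d.1 _ _ a1; try lia.
have [||y y1 y2] := @slab_meet R m m2 k c.2 d.2 _ _ a2; try lia.
by exists (x, y).
Qed.

Lemma tile_touch i j c d z : unit_box j d -> unit_box (i + j) c ->
  tile j d z -> tile (i + j) c z -> touch nz mz i d c.
Proof.
move=> /unit_boxE[d1 d2] /unit_boxE[c1 c2] [t1 t2] [u1 u2].
split; [apply: (slab_touch n2 _ _ t1 u1)|apply: (slab_touch m2 _ _ t2 u2)]; lia.
Qed.

Lemma tile_parent k c z : unit_box k.+1 c -> tile k.+1 c z -> tile k (parent nz mz c) z.
Proof.
move=> /unit_boxE[c1 c2] [t1 t2].
split; [apply: (slab_parent n2 _ t1)|apply: (slab_parent m2 _ t2)]; lia.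
Qed.

Lemma tile_unit k c z : unit_box k c -> tile k c z -> 0 <= z.1 <= 1 /\ 0 <= z.2 <= 1.
Proof.
move=> /unit_boxE[c1 c2] [t1 t2].
split; [apply: (slab_unit n2 _ t1)|apply: (slab_unit m2 _ t2)]; lia.
Qed.

Lemma tileE k c : tile k c =
  (fst @^-1` `[(Z.to_nat c.1)%:R / n%:R ^+ k, (Z.to_nat c.1).+1%:R / n%:R ^+ k]) `&`
  (snd @^-1` `[(Z.to_nat c.2)%:R / m%:R ^+ k, (Z.to_nat c.2).+1%:R / m%:R ^+ k]).
Proof.
rewrite -!slab_itv //; exact: n2.
Qed.

Lemma closed_preimage (T U : topologicalType) (f : T -> U) (D : set U) :
  continuous f -> closed D -> closed (f @^-1` D).
Proof. by move=> /continuous_closedP; apply. Qed.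

Lemma continuous_fst : continuous (fst : R * R -> R).
Proof. by move=> z; exact: cvg_fst. Qed.

Lemma continuous_snd : continuous (snd : R * R -> R).
Proof. by move=> z; exact: cvg_snd. Qed.

Lemma closed_tile k c : closed (tile k c).
Proof.
rewrite tileE; apply: closedI; apply: closed_preimage.
- exact: continuous_fst.
- exact: interval_closed.
- exact: continuous_snd.
- exact: interval_closed.
Qed.

Lemma closed_tiles k (P : cell -> Prop) : (forall c, P c -> unit_box k c) ->
  closed [set z | exists2 c, P c & tile k c z].
Proof.
move=> Pb; pose F (i : 'I_(n ^ k) * 'I_(m ^ k)) : cell := (Z.of_nat i.1, Z.of_nat i.2).
rewrite (_ : mkset _ = \bigcup_(i in [set i | P (F i)]) tile k (F i)); last first.
  apply/seteqP; split=> z [].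
    move=> c Pc cz; have /unit_boxE := Pb c Pc; rewrite !pw_nat => -[c1 c2].
    have i1 : (Z.to_nat c.1 < n ^ k)%N by lia.
    have i2 : (Z.to_nat c.2 < m ^ k)%N by lia.
    have FE : F (Ordinal i1, Ordinal i2) = c.
      by rewrite /F /= !Z2Nat.id; try lia; case: (c).
    by exists (Ordinal i1, Ordinal i2); rewrite /= FE.
  by move=> i /= Pi iz; exists (F i).
by apply: closed_bigcup => [|i _]; [exact: finite_finset|exact: closed_tile].
Qed.

Lemma connected_tile k c : connected (tile k c).
Proof.
have [[z0 tz0]|no] := EM (tile k c !=set0); last first.
  rewrite (_ : tile k c = set0); first exact: connected0.
  by rewrite -subset0 => z tz; apply: no; exists z.
pose I := [set r : R | slab n k c.1 r]; pose J := [set r : R | slab m k c.2 r].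
have cI : connected I by rewrite /I slab_itv //; exact: segment_connected.
have cJ : connected J by rewrite /J slab_itv //; exact: segment_connected.
(* A horizontal segment through [z0] followed by a vertical one through [z]; these connected sets
   share [z0] and cover the tile. *)
pose S (z : R * R) := ((fun t => (t, z0.2)) @` I) `|` ((fun u => (z.1, u)) @` J).
have S0 z : tile k c z -> S z z0.
  by move=> _; left; exists z0.1; [case: tz0|case: (z0)].
have Sz z : tile k c z -> S z z.
  by move=> [_ zJ]; right; exists z.2 => //; case: (z).
have Ssub z : tile k c z -> S z `<=` tile k c.
  move=> [zI zJ] y [[t It <-]|[u Ju <-]]; split=> //=; by case: tz0.
rewrite (_ : tile k c = \bigcup_(z in tile k c) S z); last first.
  by apply/seteqP; split=> [z tz|z [y ty /(Ssub _ ty)]] //; exists z => //; exact: Sz.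
apply: bigcup_connected; first by exists z0 => z; exact: S0.
move=> z [zI zJ]; apply: connectedU.
- exists (z.1, z0.2); split; [by exists z.1|by exists z0.2 => //; case: tz0].
- apply: connected_continuous_connected => //; apply: continuous_subspaceT => t.
  by apply: (@cvg_pair R R R (nbhs t) (nbhs t) (nbhs z0.2) _ _ _ id (fun=> z0.2));
    [exact: cvg_id|exact: cvg_cst].
- apply: connected_continuous_connected => //; apply: continuous_subspaceT => t.
  by apply: (@cvg_pair R R R (nbhs t) (nbhs z.1) (nbhs t) _ _ _ (fun=> z.1) id);
    [exact: cvg_cst|exact: cvg_id].
Qed.

Lemma parent_touch i d c : touch nz mz i.+1 d c -> touch nz mz i d (parent nz mz c).
Proof.
have half q a x : (0 < q)%coqZ -> (q * a - 1 <= x)%coqZ -> (a - 1 <= x / q)%coqZ.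
  by move=> q0 h; apply: Z.div_le_lower_bound => //; nia.
have half' q a x : (0 < q)%coqZ -> (x <= q * a)%coqZ -> (x / q <= a)%coqZ.
  by move=> q0 h; apply: Z.div_le_upper_bound.
rewrite /touch /= -!Z.mul_assoc => -[[h1 h2] [h3 h4]].
by split; split; (apply: half || apply: half') => //; lia.
Qed.

Lemma parent_touching k s c : touching nz mz k.+1 s c ->
  touching nz mz k s (parent nz mz c).
Proof.
move=> tc j /andP[j0 jk]; have [|d [sd dc]] := tc j; first by rewrite j0 ltnW.
by exists d; split=> //; apply: parent_touch; rewrite -subSn.
Qed.

(** A common threshold for finitely many statements that hold eventually; it serves as the
    compactness step of the arguments below. *)
Lemma finite_uniform (P : nat -> nat -> Prop) H :
  (forall a, (a < H)%N -> exists i0, forall i, (i0 <= i)%N -> P a i) ->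
  exists i0, forall a, (a < H)%N -> forall i, (i0 <= i)%N -> P a i.
Proof.
elim: H => [|H IH] h; first by exists 0%N.
have [i0 h0] := IH (fun a aH => h a (ltnW aH)); have [i1 h1] := h H (ltnSn H).
exists (maxn i0 i1) => a; rewrite ltnS leq_eqVlt => /orP[/eqP->|aH] i ii.
  by apply: h1; apply: leq_trans ii; exact: leq_maxr.
by apply: h0 => //; apply: leq_trans ii; exact: leq_maxl.
Qed.

Section Crossing.
Variable s : config.
Hypothesis s_box : forall j c, s (j, c) -> unit_box j c.

Definition limit_set : set (R * R) :=
  [set z | forall j, (0 < j)%N -> exists2 c, s (j, c) & tile j c z].

Let O k (c : cell) := unit_box k c /\ touching nz mz k s c.

Let linkO k u c : link (O k) u c -> O k c.
Proof. by move=> uc; have [] := link_in uc. Qed.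

Let O_parent k c : O k.+1 c -> O k (parent nz mz c).
Proof.
move=> [cb tc]; split; last exact: parent_touching.
by apply: (stable_box nz2 mz2).
Qed.

Lemma limit_set_unit z : limit_set z -> 0 <= z.1 <= 1 /\ 0 <= z.2 <= 1.
Proof. by move=> /(_ 1%N isT)[c /s_box cb tc]; exact: tile_unit cb tc. Qed.

Lemma limit_set_touching k c z : limit_set z -> unit_box k c -> tile k c z ->
  touching nz mz k s c.
Proof.
move=> Fz cb tc j /andP[j0 jk]; have [d sd td] := Fz j j0.
exists d; split=> //; apply: (tile_touch (s_box sd) _ td); by rewrite subnK.
Qed.

(** The tiles linked to the left column and the remaining touching tiles form two disjoint closed
    sets that cover the limit set, so a component starting on the left stays in the first one. *)
Lemma crossing_tcross k : H_crossing limit_set -> tcross nz mz k s.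
Proof.
move=> [x1 [x2 [[[x10 x1I] Fx1] [[x21 x2I] Fx2] cx]]].
pose reach c := exists u, left_col nz 0 k u /\ link (O k) u c.
have reachO c : reach c -> O k c by move=> [u [_ /linkO]].
pose A := [set z | exists2 c, reach c & tile k c z].
pose B := [set z | exists2 c, O k c /\ ~ reach c & tile k c z].
have clA : closed A by apply: closed_tiles => c /reachO[].
have clB : closed B by apply: closed_tiles => c [[]].
have AB : A `&` B = set0.
  rewrite -subset0 => z [[c rc tc] [d [Od nd] td]]; apply: nd.
  have [cb _] := reachO c rc; have [u [Lu uc]] := rc; exists u; split=> //.
  by apply: (link_step uc _ Od); apply: tile_adj tc td; case: Od.
have FAB : limit_set `<=` A `|` B.
  move=> z Fz; have [z1 z2] := limit_set_unit Fz; have [c cb tc] := tile_ex k z1 z2.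
  have Oc : O k c by split=> //; exact: limit_set_touching tc.
  by have [rc|nc] := EM (reach c); [left|right]; exists c.
have x1A : A x1.
  have [z1 z2] := limit_set_unit Fx1; have [c cb tc] := tile_ex k z1 z2.
  exists c => //; exists c; split; last first.
    by apply: link0; split=> //; exact: limit_set_touching tc.
  have /unit_boxE[c1 _] := cb; rewrite /left_col Z.mul_0_r.
  by have [t1 _] := tc; move: t1; rewrite x10 slab0 //; lia.
have [CA|CB] := connected_subset (separated_closed clA clB AB)
    (subset_trans (@connected_component_sub _ limit_set x1) FAB)
    (@component_connected _ limit_set x1); last first.
  have : (A `&` B) x1 by split=> //; apply: CB; exact: connected_component_refl.
  by rewrite AB.
have [c [u [Lu uc]] tc] := CA _ cx; exists u, c; split=> //.
have [_ [/unit_boxE[c1 _] _]] := link_in uc.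
by have [t1 _] := tc; move: t1; rewrite x21 slab1 // /right_col; lia.
Qed.

(** The selected rectangle of level j near [z] may depend on the depth of observation. As there are
    finitely many, one of them works at all depths, and it contains [z] because it is closed. *)
Lemma touching_limit_set z :
  (forall k, exists2 c, O k c & tile k c z) -> limit_set z.
Proof.
move=> Oz j j0.
pose Q i d := exists c, [/\ unit_box (i + j) c, tile (i + j) c z & touch nz mz i d c].
have Qdec i d : Q i.+1 d -> Q i d.
  move=> [c [cb tc dc]]; exists (parent nz mz c); split.
  - exact: (stable_box nz2 mz2 cb).
  - exact: tile_parent tc.
  - exact: parent_touch.
have Qmono i i' d : (i <= i')%N -> Q i' d -> Q i d.
  by move=> /subnK <-; elim: (i' - i)%N => // l IH /Qdec.
have [[d [sd Qd]]|no] := EM (exists d, s (j, d) /\ forall i, Q i d).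
  exists d => //; have /choice[c cP] := Qd.
  have /unit_boxE[d1 d2] := s_box sd.
  split; [apply: (@slab_limit _ _ n2 _ _ _ (fun i => (c i).1))|
          apply: (@slab_limit _ _ m2 _ _ _ (fun i => (c i).2))]; try lia;
  by move=> i; have [/unit_boxE[? ?] [? ?] [? ?]] := cP i => //; lia.
exfalso.
have [i0 h] : exists i0, forall a, (a < n ^ j)%N -> forall i, (i0 <= i)%N ->
    forall b, (b < m ^ j)%N -> s (j, (Z.of_nat a, Z.of_nat b)) ->
    ~ Q i (Z.of_nat a, Z.of_nat b).
  apply: finite_uniform => a _.
  have [|i0 h0] := @finite_uniform (fun b i => s (j, (Z.of_nat a, Z.of_nat b)) ->
    ~ Q i (Z.of_nat a, Z.of_nat b)) (m ^ j).
    move=> b _; have [sb|nsb] := EM (s (j, (Z.of_nat a, Z.of_nat b))); last first.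
      by exists 0%N.
    have /existsNP[i nQ] : ~ forall i, Q i (Z.of_nat a, Z.of_nat b).
      by move=> h; apply: no; exists (Z.of_nat a, Z.of_nat b).
    by exists i => i' ii _ /(Qmono _ _ _ ii).
  by exists i0 => i ii b bm; exact: h0.
have [c [cb tc] cz] := Oz (i0 + j)%N.
have [|d [sd dc]] := tc j; first by rewrite j0 leq_addl.
rewrite addnK in dc; have /unit_boxE := s_box sd; rewrite !pw_nat => -[d1 d2].
have dE : d = (Z.of_nat (Z.to_nat d.1), Z.of_nat (Z.to_nat d.2)).
  by rewrite !Z2Nat.id; try lia; case: (d).
apply: (h (Z.to_nat d.1) _ i0 (leqnn _) (Z.to_nat d.2)); try lia.
  by rewrite -dE.
by rewrite -dE; exists c.
Qed.

Let X l u := left_col nz 0 l u /\ exists v, right_col nz 1 l v /\ link (O l) u v.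

Let X_parent l u : X l.+1 u -> X l (parent nz mz u).
Proof.
move=> [Lu [v [Rv uv]]]; split; first exact: (stable_left mz nz2).
exists (parent nz mz v); split; first exact: (stable_right mz nz2).
by apply: link_map uv; [exact: O_parent|exact: parent_adj].
Qed.

(* Koenig's lemma applied to the left ends of the crossings of all levels. *)
Let rich k c := forall i, exists u, X (i + k) u /\ iter i (parent nz mz) u = c.

(** If each of the nm children had descendants among the left ends only down to some level, then
    beyond a common level [c] would have none. *)
Lemma rich_child k c : rich k c -> exists d, rich k.+1 d /\ parent nz mz d = c.
Proof.
move=> rc; apply: contrapT => /forallNP no.
have dead d : parent nz mz d = c -> exists i0, forall i, (i0 <= i)%N ->
    ~ exists u, X (i + k.+1) u /\ iter i (parent nz mz) u = d.
  move=> dc; have /not_andP[/existsNP[i0 ni]|//] := no d.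
  exists i0 => i /subnK <-; elim: (i - i0)%N => // l IH [u [Xu iu]]; apply: IH.
  exists (parent nz mz u); split; first exact: X_parent.
  by rewrite -iterSr.
have child d : parent nz mz d = c -> exists a b, [/\ (a < n)%N, (b < m)%N &
    d = (nz * c.1 + Z.of_nat a, mz * c.2 + Z.of_nat b)%coqZ].
  move=> <-; exists (Z.to_nat (d.1 mod nz)%coqZ), (Z.to_nat (d.2 mod mz)%coqZ).
  have := Z.mod_pos_bound d.1 nz; have := Z.mod_pos_bound d.2 mz.
  have := Z.div_mod d.1 nz; have := Z.div_mod d.2 mz.
  case: d => d1 d2 /= *; split; [lia|lia|]; congr pair; lia.
pose D a b : cell := (nz * c.1 + Z.of_nat a, mz * c.2 + Z.of_nat b)%coqZ.
have [i0 h] : exists i0, forall a, (a < n)%N -> forall i, (i0 <= i)%N ->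
    forall b, (b < m)%N -> parent nz mz (D a b) = c ->
    ~ exists u, X (i + k.+1) u /\ iter i (parent nz mz) u = D a b.
  apply: finite_uniform => a _.
  have [|i0 h0] := @finite_uniform (fun b i => parent nz mz (D a b) = c ->
    ~ exists u, X (i + k.+1) u /\ iter i (parent nz mz) u = D a b) m.
    move=> b _; have [/dead[i0 h0]|nb] := EM (parent nz mz (D a b) = c).
      by exists i0 => i ii _; exact: h0.
    by exists 0%N.
  by exists i0 => i ii b bm; exact: h0.
have [u [Xu iu]] := rc i0.+1.
have [a [b [an bm uE]]] := child (iter i0 (parent nz mz) u) iu.
apply: (h a an i0 (leqnn _) b bm); first by rewrite -/(D a b) in uE; rewrite -uE.
by exists u; rewrite addnS -addSn; split.
Qed.

Lemma rich_thread : (forall k, tcross nz mz k s) ->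
  exists f, forall k, rich k (f k) /\ parent nz mz (f k.+1) = f k.
Proof.
move=> tc.
have rich0 : rich 0 (0, 0)%coqZ.
  move=> i; have [u [v [Lu Rv uv]]] := tc (i + 0)%N; exists u; split.
    by split=> //; exists v.
  have [[ub _] _] := link_in uv.
  have : unit_box 0 (iter i (parent nz mz) u).
    by apply: stable_iter ub; exact: stable_box.
  move=> /unit_boxE.
  rewrite /=; case: (iter _ _ _) => x y /= [hx hy]; congr pair; lia.
have /choice[g gP] : forall kc : nat * cell, exists d, rich kc.1 kc.2 ->
    rich kc.1.+1 d /\ parent nz mz d = kc.2.
  move=> [k c] /=; have [rc|nr] := EM (rich k c); last by exists c.
  by have [d ?] := rich_child rc; exists d.
pose f := fix f k : cell := if k is k'.+1 then g (k', f k') else (0, 0)%coqZ.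
have fr k : rich k (f k).
  by elim: k => //= k IH; have [] := gP (k, f k) IH.
by exists f => k; split=> //=; have [] := gP (k, f k) (fr k).
Qed.

(** Consecutive tiles of a path meet, so each path yields a connected union of tiles; all of these
    contain the tile of [e]. *)
Lemma connected_linked k e : O k e ->
  connected [set z | exists2 c, link (O k) e c & tile k c z].
Proof.
move=> Oe; set D := mkset _.
have path c : link (O k) e c -> exists S : set (R * R),
    [/\ connected S, S `<=` D, tile k e `<=` S & tile k c `<=` S].
  elim=> [_|x y ex [S [cS SD eS xS]] xy Oy].
    by exists (tile k e); split=> //; [exact: connected_tile|move=> z ez; exists e => //; exact: link0].
  exists (S `|` tile k y); split.
  - apply: connectedU => //; last exact: connected_tile.
    have [z [xz yz]] := tile_meet (proj1 (proj2 (link_in ex))) (proj1 Oy) xy.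
    by exists z; split=> //; exact: xS.
  - by move=> z [/SD//|yz]; exists y => //; exact: link_step ex xy Oy.
  - by move=> z /eS; left.
  - by right.
have /choice[S SP] : forall c, exists S : set (R * R), link (O k) e c ->
    [/\ connected S, S `<=` D, tile k e `<=` S & tile k c `<=` S].
  move=> c; have [/path[S ?]|no] := EM (link (O k) e c); first by exists S.
  by exists set0.
rewrite (_ : D = \bigcup_(c in link (O k) e) S c); last first.
  apply/seteqP; split=> z; first by move=> [c ec cz]; exists c => //; case: (SP c ec) => _ _ _; apply.
  by move=> [c ec cz]; case: (SP c ec) => _ SD _ _; exact: SD.
apply: bigcup_connected; last by move=> c /SP[].
have [z [ez _]] := tile_meet (proj1 Oe) (proj1 Oe) (adj_refl e).
by exists z => c /SP[_ _ eS _]; exact: eS.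
Qed.

(** Crossings of different levels may belong to unrelated clusters. The thread [f] selects one
    cluster per level such that the unions of tiles [D k] decrease; their intersection is then
    connected and meets both sides of the square. *)
Lemma tcross_crossing : (forall k, tcross nz mz k s) -> H_crossing limit_set.
Proof.
move=> /rich_thread[f fP].
have fX k : X k (f k).
  by have [u [Xu <-]] := (fP k).1 0%N.
have fO k : O k (f k) by have [_ [v [_ fv]]] := fX k; have [] := link_in fv.
pose D k := [set z | exists2 c, link (O k) (f k) c & tile k c z].
pose C : set (R * R) := `[0, 1] `*` `[0, 1].
have cC : compact C by apply: compact_setX; exact: segment_compact.
have clD k : closed (D k) by apply: closed_tiles => c /linkO[].
have DC k : D k `<=` C.
  move=> z [c /linkO[cb _] cz]; have [z1 z2] := tile_unit cb cz.
  by split; rewrite /= in_itv.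
have dD k : D k.+1 `<=` D k.
  move=> z [c fc cz]; exists (parent nz mz c).
    rewrite -(fP k).2; apply: link_map fc; [exact: O_parent|exact: parent_adj].
  by have [_ [cb _]] := link_in fc; exact: tile_parent cz.
have cD : connected (\bigcap_k D k).
  apply: (@nested_connected _ R C) => // [|k]; first exact: (@pseudometric_normal R).
  exact: connected_linked.
have edge (a : R) : (forall k, exists2 c, link (O k) (f k) c & slab n k c.1 a) ->
    exists z, z.1 = a /\ (\bigcap_k D k) z.
  move=> ha; have cl : closed (fst @^-1` [set a] : set (R * R)).
    by apply: closed_preimage; [exact: continuous_fst|exact: closed_eq].
  have [||||z zP] := @compact_nested _ C (fun k => D k `&` fst @^-1` [set a]) cC.
  - by move=> k; apply: closedI.
  - by move=> k z [/DC].
  - move=> k; have [c fc ca] := ha k; have [_ [cb _]] := link_in fc.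
    have [z [[_ z2] _]] := tile_meet cb cb (adj_refl c).
    by exists (a, z.2); split=> //; exists c.
  - by move=> k z [/dD Dz za].
  by exists z; split; [case: (zP 0%N)|move=> k _; case: (zP k)].
have [|z1 [z10 Dz1]] := edge 0.
  move=> k; exists (f k); first exact: link0.
  by have [-> _] := fX k; rewrite Z.mul_0_r slab0.
have [|z2 [z21 Dz2]] := edge 1.
  move=> k; have [_ [v [Rv fv]]] := fX k; exists v => //.
  have [_ [/unit_boxE[v1 _] _]] := link_in fv.
  by rewrite slab1 //; move: Rv; rewrite /right_col; lia.
have DF : \bigcap_k D k `<=` limit_set.
  move=> z Dz; apply: touching_limit_set => k; have [c fc cz] := Dz k I.
  by exists c => //; case: (link_in fc).
exists z1, z2; split.
- split; last exact: DF.
  by split=> //; have [_] := DC 0%N z1 (Dz1 0%N I).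
- split; last exact: DF.
  by split=> //; have [_] := DC 0%N z2 (Dz2 0%N I).
- exact: (connected_component_max Dz1 DF cD Dz2).
Qed.

End Crossing.
End Tiles.

(** * The law of the selected rectangles *)

Section Coding.
Variables n m : nat.
Local Notation nz := (Z.of_nat n).
Local Notation mz := (Z.of_nat m).
Local Notation unit_box := (box nz mz 0 1 0 1).

Definition site_of (r : rect_index n m) : site :=
  (level r, (Z.of_nat (tagged r).1, Z.of_nat (tagged r).2)).

Lemma site_of_inj : injective site_of.
Proof.
move=> [k [a b]] [k' [a' b']]; rewrite /site_of /level /= => -[kk].
subst k' => /Nat2Z.inj /val_inj -> /Nat2Z.inj /val_inj -> //.
Qed.

Lemma site_of_box r : unit_box (site_of r).1 (site_of r).2.
Proof.
apply/unit_boxE; rewrite /site_of /level /= -/(pw nz (tag r).+1) -/(pw mz (tag r).+1).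
rewrite !pw_nat; have := ltn_ord (tagged r).1; have := ltn_ord (tagged r).2; lia.
Qed.

Lemma site_of_ex k c : (0 < k)%N -> unit_box k c -> exists r, site_of r = (k, c).
Proof.
case: k => // k _ /unit_boxE; rewrite !pw_nat => -[c1 c2].
have i1 : (Z.to_nat c.1 < n ^ k.+1)%N by lia.
have i2 : (Z.to_nat c.2 < m ^ k.+1)%N by lia.
exists (existT _ k (Ordinal i1, Ordinal i2)); rewrite /site_of /level /=.
by rewrite !Z2Nat.id; try lia; case: (c).
Qed.

Definition valid (i : site) : bool := `[< exists r, site_of r = i >].

(** In [pr] all sites of the plane are random, but only those of the unit square at levels at least
    1 correspond to rectangles; the others are switched off. *)
Definition valid_part (s : config) : config := fun i => s i && valid i.

Lemma validE k c : valid (k, c) <-> (0 < k)%N /\ unit_box k c.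
Proof.
split; last by move=> [k0 /(site_of_ex k0) ?]; apply/asboolP.
by move=> /asboolP[r rE]; have := site_of_box r; rewrite rE; split=> //; case: rE => <-.
Qed.

Definition rects k : seq (rect_index n m) := undup (flatten
  [seq [seq existT (fun j : nat => ('I_(n ^ j.+1) * 'I_(m ^ j.+1))%type) j ab |
    ab <- enum {: 'I_(n ^ j.+1) * 'I_(m ^ j.+1)}] | j <- iota 0 k]).

Lemma mem_rects k r : (level r <= k)%N -> r \in rects k.
Proof.
case: r => j ab; rewrite /level /= => jk; rewrite mem_undup.
apply/flatten_mapP; exists j; first by rewrite mem_iota.
by apply/mapP; exists ab => //; rewrite mem_enum.
Qed.

Section Bits.
Variables (T : Type) (sel : rect_index n m -> set T).

Definition bits (w : T) : config := fun i => `[< exists2 r, site_of r = i & sel r w >].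

Lemma bits_site_of w r : bits w (site_of r) = `[< sel r w >].
Proof.
rewrite /bits; apply: asbool_equiv_eq; split=> [[r' /site_of_inj ->]|] //.
by exists r.
Qed.

Lemma bits_valid w i : bits w i -> valid i.
Proof. by move=> /asboolP[r ri _]; apply/asboolP; exists r. Qed.

Lemma bits_box w j c : bits w (j, c) -> unit_box j c.
Proof. by move=> /bits_valid /validE[]. Qed.

(** Inserts the selections one by one, in the same recursion as [expect], so that the two laws can
    be compared by induction on the list. *)
Fixpoint sample (L : seq (rect_index n m)) (w : T) (s : config) : config :=
  if L is r :: L' then sample L' w (upd s (site_of r) `[< sel r w >]) else s.

Lemma sample_out L w s i : (forall r, r \in L -> site_of r != i) -> sample L w s i = s i.
Proof.
elim: L s => //= r L IH s h; rewrite IH; last first.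
  by move=> r' r'L; apply: h; rewrite inE r'L orbT.
by rewrite /upd eq_sym (negbTE (h r (mem_head _ _))).
Qed.

Lemma sample_in L w s r : uniq L -> r \in L -> sample L w s (site_of r) = `[< sel r w >].
Proof.
elim: L s => //= r' L IH s /andP[r'L uL]; rewrite inE => /predU1P[->|rL]; last exact: IH.
rewrite sample_out ?/upd ?eqxx // => r'' r''L; rewrite (inj_eq site_of_inj).
by apply: contraNneq r'L => <-.
Qed.

End Bits.
End Coding.

Lemma expect_eq_on (R : realType) (p : R) (I : eqType) (V : pred I) (S : seq I)
  (f g : (I -> bool) -> R) (s : I -> bool) :
  (forall s : I -> bool, (forall i, s i -> V i) -> f s = g s) -> (forall i, s i -> V i) ->
  {subset S <= V} -> expect p S f s = expect p S g s.
Proof.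
move=> fg; elim: S s => [|i S IH] s sV SV /=; first exact: fg.
have SV' : {subset S <= V} by move=> j jS; apply: SV; rewrite inE jS orbT.
have Vi : V i by apply: SV; rewrite mem_head.
have uV b j : upd s i b j -> V j by rewrite /upd; case: eqP => [->|_ /sV].
by rewrite !IH //; exact: uV.
Qed.

Section Law.
Context d (T : measurableType d) (R : realType) (P : probability T R).
Variables (n m : nat) (p : R) (sel : rect_index n m -> set T).
Hypothesis hsel : bernoulli_selection P p sel.
Local Notation sample := (sample sel).

Let msel r : measurable (sel r). Proof. by case: hsel. Qed.

Let inter (J : {fset rect_index n m}) : set T := \bigcap_(r in [set` J]) sel r.

Let minter J : measurable (inter J).
Proof. by apply: fin_bigcap_measurable => [|r _]; [exact: finite_fset|exact: msel]. Qed.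

Let P_inter J : P (inter J) = (p ^+ #|` J|)%:E.
Proof.
have [_ Psel indep] := hsel; rewrite /inter indep.
rewrite (eq_bigr (fun=> p%:E)) => [|r _]; last exact: Psel.
by rewrite prodEFin big_const_seq count_predT iter_mulr_1.
Qed.

Lemma sample_cons r L A s : [set w | A (sample (r :: L) w s)] =
  (sel r `&` [set w | A (sample L w (upd s (site_of r) true))]) `|`
  (~` sel r `&` [set w | A (sample L w (upd s (site_of r) false))]).
Proof.
apply/seteqP; split=> w /=.
  by case: asboolP => rw Aw; [left|right].
by case=> -[rw Aw]; [rewrite asboolT|rewrite asboolF].
Qed.

Lemma measurable_sample L A s : measurable [set w | A (sample L w s)].
Proof.
elim: L s => [|r L IH] s.
  by have [As|nAs] := EM (A s); [rewrite (_ : mkset _ = setT)|rewrite (_ : mkset _ = set0)];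
    try exact: measurableT; try exact: measurable0;
    apply/seteqP; split=> w //= /nAs.
rewrite sample_cons; apply: measurableU; apply: measurableI => //.
exact: measurableC.
Qed.

(** Independence speaks only of intersections of selections, so the induction carries the set [J] of
    rectangles already required; the event that [r] is not selected is obtained by subtraction. *)
Lemma P_sample_inter L A s J : uniq L -> (forall r, r \in L -> r \notin J) ->
  P (inter J `&` [set w | A (sample L w s)]) =
  (p ^+ #|` J| * expect p (map (@site_of n m) L) (ind R A) s)%:E.
Proof.
elim: L s J => [|r L IH] s J /=.
  move=> _ _; have [As|nAs] := EM (A s).
    rewrite (_ : [set w | A s] = setT) ?setIT ?P_inter /ind ?asboolT ?mulr1 //.
    by apply/seteqP; split.
  rewrite (_ : [set w | A s] = set0) ?setI0 ?measure0 /ind ?asboolF ?mulr0 //.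
  by apply/seteqP; split=> w //= /nAs.
move=> /andP[rL uL] dis.
have rJ : r \notin J by apply: dis; rewrite mem_head.
have disL r' : r' \in L -> r' \notin J by move=> r'L; apply: dis; rewrite inE r'L orbT.
set B1 := [set w | A (sample L w (upd s (site_of r) true))].
set B0 := [set w | A (sample L w (upd s (site_of r) false))].
have mB1 : measurable B1 by exact: measurable_sample.
have mB0 : measurable B0 by exact: measurable_sample.
have interU : inter (r |` J)%fset = sel r `&` inter J.
  apply/seteqP; split=> w.
    move=> h; split; first by apply: h; rewrite /= fset1U1.
    by move=> r' r'J; apply: h; rewrite /= fset1Ur.
  by move=> [rw h] r' /=; rewrite in_fset1U => /orP[/eqP->//|]; exact: h.
have card1 : #|` (r |` J)%fset| = #|` J|.+1 by rewrite cardfsU1 rJ.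
have IH1 b := IH (upd s (site_of r) b) (r |` J)%fset uL.
have IHd b : P (sel r `&` inter J `&` [set w | A (sample L w (upd s (site_of r) b))]) =
    (p ^+ #|` J|.+1 * expect p (map (@site_of n m) L) (ind R A) (upd s (site_of r) b))%:E.
  rewrite -interU IH1 ?card1 // => r' r'L; rewrite in_fset1U negb_or disL // andbT.
  by apply: contraNneq rL => <-.
have E0 : P (inter J `&` (~` sel r `&` B0)) =
    (p ^+ #|` J| * expect p (map (@site_of n m) L) (ind R A) (upd s (site_of r) false)
     - p ^+ #|` J|.+1 * expect p (map (@site_of n m) L) (ind R A) (upd s (site_of r) false))%:E.
  have IH0 : P (inter J `&` B0) = _ := IH _ J uL disL.
  have split0 : P (inter J `&` B0) =
      (P (inter J `&` (~` sel r `&` B0)) + P (sel r `&` inter J `&` B0))%E.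
    rewrite (_ : sel r `&` inter J `&` B0 = inter J `&` B0 `&` sel r); last first.
      by rewrite [RHS]setIC setIA.
    rewrite (_ : inter J `&` (_ `&` _) = inter J `&` B0 `\` sel r); last first.
      by rewrite setDE -setIA [B0 `&` _]setIC.
    by rewrite -measureDI //; exact: measurableI.
  have fin : P (inter J `&` (~` sel r `&` B0)) \is a fin_num.
    by apply: fin_num_measure; do 2 apply: measurableI => //; exact: measurableC.
  move: split0; rewrite IH0 (IHd false) -[P (inter J `&` (_ `&` _))]fineK //.
  by rewrite -EFinD => -[->]; congr EFin; ring.
rewrite -[X in P (_ `&` X)]/[set w | A (sample (r :: L) w s)] sample_cons -/B1 -/B0 setIUr.
have -> : P (inter J `&` (sel r `&` B1) `|` inter J `&` (~` sel r `&` B0)) =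
    (P (inter J `&` (sel r `&` B1)) + P (inter J `&` (~` sel r `&` B0)))%E.
  rewrite measureU //.
  - by do 2 apply: measurableI => //.
  - by do 2 apply: measurableI => //; exact: measurableC.
  - by rewrite -subset0 => w [[_ [rw _]] [_ [nrw _]]].
rewrite E0 setIA [inter J `&` sel r]setIC (IHd true) -EFinD; congr EFin.
by rewrite exprS; ring.
Qed.

Lemma P_sample L A s : uniq L ->
  P [set w | A (sample L w s)] = (expect p (map (@site_of n m) L) (ind R A) s)%:E.
Proof.
move=> uL; have := @P_sample_inter L A s fset0 uL (fun r _ => isT).
rewrite cardfs0 expr0 mul1r => <-; congr (P _).
by rewrite (_ : inter fset0 = setT) ?setTI //; apply/seteqP; split=> w //= _ r.
Qed.

Lemma bits_sample A : finitary A -> exists2 L, uniq L &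
  (forall w, A (bits sel w) <-> A (sample L w (@sfalse _))) /\
  pr p (fun s => A (valid_part n m s)) = expect p (map (@site_of n m) L) (ind R A) (@sfalse _).
Proof.
move=> [S uS AS]; pose L := rects n m (\max_(i <- S) i.1); have uL : uniq L by exact: undup_uniq.
have inL r i : i \in S -> site_of r = i -> r \in L.
  by move=> iS ri; apply: mem_rects; rewrite (_ : level r = i.1) ?leq_bigmax_seq // -ri.
exists L => //; split.
  move=> w; suff -> : A (bits sel w) = A (sample L w (@sfalse _)) by [].
  apply: AS => i iS; case: (boolP (valid n m i)) => [/asboolP[r ri]|ni].
    by rewrite -ri bits_site_of sample_in // (inL r i).
  rewrite sample_out; last first.
    by move=> r rL; apply: contraNneq ni => <-; apply/asboolP; exists r.
  by apply/negP => bi; have := bits_valid bi; rewrite (negbTE ni).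
have sup : supported (map (@site_of n m) L) (fun s => A (valid_part n m s)).
  move=> s s' ss; apply: AS => i iS; rewrite /valid_part.
  case: (boolP (valid n m i)) => [/asboolP[r ri]|ni]; last by rewrite !andbF.
  by rewrite !andbT; apply: ss; rewrite -ri map_f // (inL r i).
rewrite (@prE _ _ _ _ _ (@sfalse _) _ sup); last by rewrite map_inj_uniq //; exact: site_of_inj.
have eqA (s : config) : (forall i, s i -> valid n m i) ->
    ind R (fun s => A (valid_part n m s)) s = ind R A s.
  move=> sv; rewrite /ind (_ : valid_part n m s = s) //; apply/funext => i.
  by rewrite /valid_part; case: (boolP (s i)) => // /sv ->.
apply: (@expect_eq_on R p site (valid n m) _ _ _ (@sfalse site) eqA) => //.
by move=> i /mapP[r _ ->]; apply/asboolP; exists r.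
Qed.

Lemma measurable_bits A : finitary A -> measurable [set w | A (bits sel w)].
Proof.
move=> /bits_sample[L uL [h _]]; rewrite (_ : mkset _ = [set w | A (sample L w (@sfalse _))]).
  exact: measurable_sample.
by apply/seteqP; split=> w /= /h.
Qed.

Lemma P_bits A : finitary A ->
  P [set w | A (bits sel w)] = (pr p (fun s => A (valid_part n m s)))%:E.
Proof.
move=> /bits_sample[L uL [h ->]]; rewrite -P_sample //; congr (P _).
by apply/seteqP; split=> w /= /h.
Qed.

Hypotheses (n2 : (2 <= n)%N) (m2 : (2 <= m)%N) (p01 : 0 <= p <= 1).
Local Notation nz := (Z.of_nat n).
Local Notation mz := (Z.of_nat m).
Let nz2 : (2 <= nz)%coqZ. Proof. lia. Qed.
Let mz2 : (2 <= mz)%coqZ. Proof. lia. Qed.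

Lemma rect_tile (r : rect_index n m) :
  rect r = tile n m (level r) (site_of r).2 :> set (R * R).
Proof.
have Q0 q k : (2 <= q)%N -> 0 < q%:R ^+ k :> R by move=> ?; rewrite exprn_gt0 // ltr0n; lia.
apply/seteqP; split=> z; rewrite /rect /tile /slab /site_of /= !Nat2Z.id !in_itv /=.
  by move=> [h1 h2]; move: h1 h2; rewrite !ler_pdivrMr ?ler_pdivlMr ?Q0.
by move=> [h1 h2]; rewrite !ler_pdivrMr ?ler_pdivlMr ?Q0.
Qed.

Lemma carpet_limit w : carpet R sel w = limit_set n m (bits sel w).
Proof.
apply/seteqP; split=> z h j j0.
  have [r [rj rw] rz] := h j j0; exists (site_of r).2.
    by rewrite (_ : (j, _) = site_of r) ?bits_site_of ?asboolT // /site_of rj.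
  by rewrite -rj -rect_tile.
have [c /asboolP[r ri rw] cz] := h j j0; exists r.
  by split=> //; case: ri.
by rewrite rect_tile ri; case: ri => ->.
Qed.

Lemma H_crossingE w : H_crossing (carpet R sel w) <->
  forall k, tcross nz mz k (bits sel w).
Proof.
rewrite carpet_limit; split=> [h k|h].
  exact: (crossing_tcross n2 m2 (@bits_box _ _ _ sel w) k h).
exact: (tcross_crossing R n2 m2 (@bits_box _ _ _ sel w) h).
Qed.

Let crossings := [set w | H_crossing (carpet R sel w)].

Let crossingsE : crossings = \bigcap_k [set w | tcross nz mz k (bits sel w)].
Proof.
apply/seteqP; split=> w; first by move=> /H_crossingE h k _; exact: h.
by move=> h; apply/H_crossingE => k; exact: h.
Qed.

Let measurable_crossings : measurable crossings.
Proof.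
rewrite crossingsE; apply: bigcapT_measurable => k.
by apply: measurable_bits; exact: finitary_tcross.
Qed.

(** The bound is the crossing probability itself: a crossing of the carpet gives a touching crossing
    at every level, and switching on sites outside the square only helps. *)
Lemma theta_H_tcross : (0 < theta_H P sel)%E ->
  exists2 e : R, 0 < e & forall k, e <= pr p (tcross nz mz k).
Proof.
rewrite /theta_H -/crossings => th.
have fin : P crossings \is a fin_num by exact: fin_num_measure.
exists (fine (P crossings)); first by rewrite fine_gt0 // th /= ltey_eq fin.
move=> k; have fT := finitary_tcross nz2 mz2 k.
rewrite -lee_fin fineK //.
apply: (@le_trans _ _ (P [set w | tcross nz mz k (bits sel w)])).
  apply: le_measure; rewrite ?inE //; first exact: measurable_bits.
  by rewrite crossingsE => w h; exact: h.
rewrite P_bits // lee_fin.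
have [S uS TS] := fT.
apply: pr_le => //.
  exists S => // s s' ss; apply: TS => i iS; by rewrite /valid_part ss.
by move=> s; apply: tcross_inc => i /andP[].
Qed.

Lemma hcross_valid_part k s : hcross nz mz 0 1 0 1 k s <-> hcross nz mz 0 1 0 1 k (valid_part n m s).
Proof.
split=> -[u [v [Lu Rv uv]]]; exists u, v; split=> //; apply: link_sub uv => c [cb op];
  split=> //; last by apply: is_open_inc op => i /andP[].
apply/is_openP => i ik; move/is_openP: op => /(_ i ik) si; rewrite /valid_part si /=.
apply/validE; split; first lia.
apply: stable_iter; first exact: stable_box.
by rewrite subnKC // ltnW.
Qed.

(** Continuity from above gives the intersection over all levels probability at least e, and open
    cells are touching. *)
Lemma possible_theta_H : possible p (hcross nz mz 0 1 0 1) -> (0 < theta_H P sel)%E.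
Proof.
move=> [e e0 eH]; rewrite /theta_H -/crossings.
pose U k := [set w | hcross nz mz 0 1 0 1 k (bits sel w)].
have gH := good_hcross nz2 mz2 0 1 0 1.
have mU k : measurable (U k) by apply: measurable_bits; exact: good_fin.
have PU k : (e%:E <= P (U k))%E.
  rewrite P_bits; last exact: good_fin.
  rewrite lee_fin (_ : pr p _ = pr p (hcross nz mz 0 1 0 1 k)) //.
  by apply: pr_ext => s; rewrite -hcross_valid_part.
have mbU : measurable (\bigcap_k U k) by exact: bigcapT_measurable.
have cvgU : (P \o U) k @[k --> \oo] --> P (\bigcap_k U k).
  apply: nonincreasing_cvg_mu => //.
    by apply: le_lt_trans (probability_le1 P (mU 0%N)) (ltry _).
  by move=> k l kl; apply/subsetPset => w; exact: (good_decn gH kl).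
apply: (@lt_le_trans _ _ e%:E); first by rewrite lte_fin.
apply: (@le_trans _ _ (P (\bigcap_k U k))).
  apply: (@cvge_ge _ _ _ _ _ _ _ _ cvgU).
  by near=> k; exact: PU.
apply: le_measure; rewrite ?inE //.
rewrite crossingsE => w h k _; have [u [v [Lu Rv uv]]] := h k I.
exists u, v; split=> //; apply: link_sub uv => c [cb op]; split=> //.
exact: (is_open_touching nz2 mz2).
Unshelve. all: by end_near. Qed.

End Law.

(** * The theorem *)

Section Extremes.
Variables (R : realType) (p : R) (n m : Z).
Hypotheses (n2 : (2 <= n)%coqZ) (m2 : (2 <= m)%coqZ) (p01 : 0 <= p <= 1).

(** A crossing at level 1 already needs a selected site. This excludes p = 0, where boxes cannot be
    scaled down. *)
Lemma possible_hcross_gt0 : possible p (hcross n m 0 1 0 1) -> 0 < p.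
Proof.
move=> [e e0 /(_ 1%N) h]; have /andP[p0 p1] := p01.
rewrite lt_neqAle p0 andbT; apply/eqP => p0E.
have : pr p (hcross n m 0 1 0 1 1) <=
    pr p (fun s => has s (first_sites n m 0 1 0 1)).
  apply: pr_le => //; [exact/good_fin/good_hcross|exact: finitary_has|].
  move=> s [u [v [_ _ uv]]]; have [[ub op] _] := link_in uv.
  exact: (open_first_sites n2 m2 ub op).
have := pr_has p01 (first_sites n m 0 1 0 1).
move: h; rewrite -p0E subr0 expr1n subrr => h h1 h2.
by have := le_trans h (le_trans h2 h1); rewrite leNgt e0.
Qed.

(** At p = 1 gaps never occur and the bounds above degenerate, but the bottom row is always open. *)
Lemma possible_hcross1 : p = 1 -> possible p (hcross n m 0 1 0 1).
Proof.
move=> p1; exists 1 => // k.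
have [b bd] := @bounded_box n m 0 1 0 1 k.
have Nk : (0 < pw n k)%coqZ by apply: pw_gt0; lia.
have Mk : (0 < pw m k)%coqZ by apply: pw_gt0; lia.
apply: (@le_trans _ _ (pr p (fun s : config => all s (indices k b)))).
  by apply: le_trans (pr_all p01 (indices k b)); rewrite p1 expr1n.
apply: pr_le => //; [exact: finitary_all|exact/good_fin/good_hcross|].
move=> s /allP sel.
have op c : box n m 0 1 0 1 k c -> is_open n m k s c.
  move=> cb; have [b1 b2] := bd c cb.
  have -> : is_open n m k s c = is_open n m k (fun=> true) c.
    by apply: is_open_ext b1 b2 _ => // i /sel ->.
  by elim: (k) (c) => //= j IH c'; exact: IH.
have path i : (Z.of_nat i < pw n k)%coqZ ->
    link (fun c => box n m 0 1 0 1 k c /\ is_open n m k s c) (0, 0)%coqZ (Z.of_nat i, 0%coqZ).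
  elim: i => [|i IH] ik.
    have cb : box n m 0 1 0 1 k (0, 0)%coqZ by rewrite /box /=; lia.
    by apply: link0; split=> //; exact: op.
  apply: (@link_step _ _ (Z.of_nat i, 0%coqZ)).
  - by apply: IH; lia.
  - by rewrite /adj /=; lia.
  - have cb : box n m 0 1 0 1 k (Z.of_nat i.+1, 0%coqZ) by rewrite /box /=; lia.
    by split=> //; exact: op.
exists (0, 0)%coqZ, (Z.of_nat (Z.to_nat (pw n k - 1)), 0%coqZ); split.
- by rewrite /left_col Z.mul_0_r.
- by rewrite /right_col /= Z2Nat.id; lia.
- by apply: path; lia.
Qed.

End Extremes.

(** * Vertical crossings as horizontal crossings of the transposed carpet *)

Section Transpose.
Variable R : realType.

Definition transpose (z : R * R) : R * R := (z.2, z.1).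

Definition rect_transpose n m (r : rect_index m n) : rect_index n m :=
  existT _ (tag r) ((tagged r).2, (tagged r).1).

Lemma rect_transposeK n m : cancel (@rect_transpose n m) (@rect_transpose m n).
Proof. by case=> k [a b]. Qed.

Lemma transposeK : involutive transpose. Proof. by case. Qed.

Lemma continuous_transpose : continuous transpose.
Proof.
move=> z; apply: (@cvg_pair _ _ _ (nbhs z) (nbhs z.2) (nbhs z.1) _ _ _ snd fst).
  exact: cvg_snd.
exact: cvg_fst.
Qed.

Lemma connected_transpose (F : set (R * R)) x y :
  connected_component F x y ->
  connected_component (transpose @^-1` F) (transpose x) (transpose y).
Proof.
move=> [C [Cx CF cC] Cy]; exists (transpose @` C); last by exists y.
split; first by exists x.
  by move=> z [c Cc <-] /=; rewrite transposeK; exact: CF.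
apply: connected_continuous_connected => //; apply: continuous_subspaceT.
exact: continuous_transpose.
Qed.

Lemma V_crossing_transpose (F : set (R * R)) :
  V_crossing F <-> H_crossing (transpose @^-1` F).
Proof.
split=> -[x [y [[[x1 x2] Fx] [[y1 y2] Fy] c]]].
  exists (transpose x), (transpose y); split.
  - by split=> //=; rewrite transposeK.
  - by split=> //=; rewrite transposeK.
  - exact: connected_transpose.
exists (transpose x), (transpose y); split=> //.
have := connected_transpose c; congr connected_component.
by apply/seteqP; split=> z /=; rewrite transposeK.
Qed.

Lemma carpet_transpose n m (T : Type) (sel : rect_index n m -> set T) w :
  transpose @^-1` (carpet R sel w) = carpet R (fun r => sel (rect_transpose r)) w.
Proof.
apply/seteqP; split=> z h k k1.
  have [r [rk rw] [r1 r2]] := h k k1; exists (rect_transpose r).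
    by split=> //; rewrite rect_transposeK.
  by split.
by have [r [rk rw] [r1 r2]] := h k k1; exists (rect_transpose r).
Qed.

Lemma theta_V_transpose d (T : measurableType d) (P : probability T R) n m
    (sel : rect_index n m -> set T) :
  theta_V P sel = theta_H P (fun r => sel (rect_transpose r)).
Proof.
rewrite /theta_V /theta_H; congr (P _); apply/seteqP; split=> w /=.
  by rewrite V_crossing_transpose carpet_transpose.
by rewrite -carpet_transpose -V_crossing_transpose.
Qed.

Lemma bernoulli_transpose d (T : measurableType d) (P : probability T R) n m p
    (sel : rect_index n m -> set T) : bernoulli_selection P p sel ->
  bernoulli_selection P p (fun r => sel (@rect_transpose n m r)).
Proof.
move=> [msel psel indep]; split=> // J.
have inj : injective (@rect_transpose n m) := can_inj (@rect_transposeK n m).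
have := indep ((@rect_transpose n m) @` J)%fset.
rewrite big_imfset /=; last by move=> *; exact: inj.
move=> <-; congr (P _); apply/seteqP; split=> w h r /=.
  by move=> /imfsetP[r' /= r'J ->]; exact: h.
by move=> rJ; apply: h; apply/imfsetP; exists r.
Qed.

End Transpose.

Section Positivity.
Context d (T : measurableType d) (R : realType) (P : probability T R).
Variables (n m : nat) (p : R) (sel : rect_index n m -> set T).
Hypotheses (n2 : (2 <= n)%N) (nm : (n < m)%N) (p01 : 0 <= p <= 1).
Hypothesis hsel : bernoulli_selection P p sel.
Local Notation nz := (Z.of_nat n).
Local Notation mz := (Z.of_nat m).

Lemma theta_H_possible k l (sel' : rect_index k l -> set T) :
  (2 <= k)%N -> (2 <= l)%N -> bernoulli_selection P p sel' ->
  (0 < theta_H P sel')%E <->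
  possible p (hcross (Z.of_nat k) (Z.of_nat l) 0 1 0 1).
Proof.
move=> k2 l2 hs; have k2' : (2 <= Z.of_nat k)%coqZ by lia.
have l2' : (2 <= Z.of_nat l)%coqZ by lia.
split; last exact: possible_theta_H.
move=> /(theta_H_tcross hs k2 l2 p01)[e e0 he].
have [p1|p1] := eqVneq p 1; first exact: possible_hcross1.
apply: (tcross_possible k2' l2' _ e0 he).
by have /andP[-> p1'] := p01; rewrite lt_neqAle p1.
Qed.

Lemma theta_H_theta_V : (0 < theta_H P sel)%E <-> (0 < theta_V P sel)%E.
Proof.
have m2 : (2 <= m)%N by apply: ltn_trans nm.
have nz2 : (2 <= nz)%coqZ by lia.
have mz2 : (2 <= mz)%coqZ by lia.
have nmz : (nz < mz)%coqZ by lia.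
rewrite theta_V_transpose (theta_H_possible n2 m2 hsel).
rewrite (theta_H_possible m2 n2 (bernoulli_transpose hsel)).
have [p1|p1] := eqVneq p 1.
  by split=> _; apply: possible_hcross1.
have in01 : 0 < p -> 0 < p < 1.
  by move=> p0; rewrite p0 lt_neqAle p1; case/andP: p01.
split=> h.
  have pp := in01 (possible_hcross_gt0 nz2 mz2 p01 h).
  apply/(possible_flip p01 nz2 mz2); exact: hcross_vcross_possible.
have pp := in01 (possible_hcross_gt0 mz2 nz2 p01 h).
apply: (vcross_hcross_possible nz2 nmz pp); exact/(possible_flip p01 nz2 mz2).
Qed.

End Positivity.

(* For each p a probability space carrying the independent selections is
   given, so that [theta_H] and [theta_V] become functions of p. *)
Theorem theorem2p3 (R : realType) (n m : nat) (hn : (2 <= n)%N) (hm : (n < m)%N)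
    (d : R -> measure_display) (Omega : forall p : R, measurableType (d p))
    (P : forall p : R, probability (Omega p) R)
    (sel : forall p : R, rect_index n m -> set (Omega p))
    (hsel : forall p : R, 0 <= p <= 1 -> bernoulli_selection (P p) p (sel p)) :
  (forall p : R, 0 <= p <= 1 ->
     (0 < theta_H (P p) (sel p))%E <-> (0 < theta_V (P p) (sel p))%E) /\
  (forall pH pV : R,
     critical_probability (fun p => theta_H (P p) (sel p)) pH ->
     critical_probability (fun p => theta_V (P p) (sel p)) pV ->
     pH = pV).
Proof.
have HV p : 0 <= p <= 1 ->
    (0 < theta_H (P p) (sel p))%E <-> (0 < theta_V (P p) (sel p))%E.
  by move=> p01; exact: theta_H_theta_V (hsel p p01).
split=> // pH pV [/andP[pH0 pH1] H0 H1] [/andP[pV0 pV1] V0 V1].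
(* Were the two numbers distinct, one crossing probability would vanish at their midpoint and the
   other be positive. *)
have [lt|gt|//] := ltgtP pH pV.
- have q01 : 0 <= (pH + pV) / 2 <= 1 by apply/andP; split; lra.
  have qH : pH < (pH + pV) / 2 <= 1 by apply/andP; split; lra.
  have qV : 0 <= (pH + pV) / 2 < pV by apply/andP; split; lra.
  by have := (HV _ q01).1 (H1 _ qH); rewrite (V0 _ qV) ltxx.
- have q01 : 0 <= (pH + pV) / 2 <= 1 by apply/andP; split; lra.
  have qV : pV < (pH + pV) / 2 <= 1 by apply/andP; split; lra.
  have qH : 0 <= (pH + pV) / 2 < pH by apply/andP; split; lra.
  by have := (HV _ q01).2 (V1 _ qV); rewrite (H0 _ qH) ltxx.
Qed.
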